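(* Let $d\in\mathbb{N}$, $\beta>0$, $a>0$, $\alpha\le 0$, $\mu\in\mathbb{R}$ and $\mathrm{bc}\in\{\emptyset,\mathrm{Dir},\mathrm{per}\}$. Then the sequence $(\nu_{N,\mu,\alpha}^{\mathrm{PMF}})_{N\ge1}$ satisfies a large deviation principle on $\ell_1(\mathbb{R})$ with rate $|\Lambda_N|$ and rate function $$I_{\mu,\alpha}^{\mathrm{PMF}}(x)=\beta H^{\mathrm{PMF}}_{\mu+\alpha,l.s.c.}(x)+I(x)-\inf_{y\in\ell_1(\mathbb{R})}\{\beta H^{\mathrm{PMF}}_{\mu+\alpha,l.s.c.}(y)+I(y)\},$$ where $H^{\mathrm{PMF}}_{\mu,l.s.c.}$, the lower semicontinuous regularisation of $H^{\mathrm{PMF}}_\mu$ on $\ell_1(\mathbb{R}_+)$, is given for every $\mu\in\mathbb{R}$ by $$H^{\mathrm{PMF}}_{\mu,l.s.c.}(x)=H^{\mathrm{PMF}}_\mu(x)-\frac1{2a}\big(\mu-aD(x)\big)_+^2=\begin{cases}-\mu D(x)+\frac a2D(x)^2, & D(x)\ge\frac\mu a,\\ -\frac{\mu^2}{2a}, & D(x)<\frac\mu a.\end{cases}$$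
   Context: $\Lambda_N=[-N,N]^d$, $|\Lambda_N|=(2N)^d$. For $\alpha\le 0$ and $k\in\mathbb{N}$ put $q_k^{(\alpha)}=\frac{e^{\beta\alpha k}}{(4\pi\beta)^{d/2}k^{1+d/2}}$ and $\bar q^{(\alpha)}=\sum_{k\ge1}q_k^{(\alpha)}$. Let $g_t(x,y)=(4\pi t)^{-d/2}e^{-|x-y|^2/(4t)}$; let $g_t^{(\mathrm{per})}(x,y)=\sum_{z\in\mathbb{Z}^d}g_t(x,y+2Nz)$; let $g_t^{(\mathrm{Dir})}(x,y)$ be the transition density of Brownian motion with generator $\Delta$ killed on leaving $\Lambda_N$. For $\mathrm{bc}=\emptyset$ set $q_k^{(\mathrm{bc},\alpha)}=q_k^{(\alpha)}$ for all $k$; for $\mathrm{bc}\in\{\mathrm{per},\mathrm{Dir}\}$ set $q_k^{(\mathrm{bc},\alpha)}=\frac{e^{\beta\alpha k}}{k|\Lambda_N|}\int_{\Lambda_N}g^{(\mathrm{bc})}_{k\beta}(x,x)\,dx$ for $k\le N$ and $0$ for $k>N$. Let $(\mathcal{N}_k)_k$ be independent Poisson random variables with means $|\Lambda_N|q_k^{(\mathrm{bc},\alpha)}$, and let $\nu_{N,\alpha}^{(\mathrm{bc})}$ be the law of $(\mathcal{N}_k/|\Lambda_N|)_{k\in\mathbb{N}}$ on $\ell_1(\mathbb{R}_+)\subset\ell_1(\mathbb{R})$ (norm topology). $I=I_0$: $I(x)=\sum_{k\ge1}x_k(\log\frac{x_k}{q_k^{(0)}}-1)+\bar q^{(0)}$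 for $x\in\ell_1(\mathbb{R}_+)$ and $I(x)=+\infty$ otherwise ($0\log0=0$). For $x\in\ell_1(\mathbb{R}_+)$, $D(x)=\sum_{k\ge1}kx_k\in[0,\infty]$. Particle-mean-field (PMF) model: $H^{\mathrm{PMF}}_\mu(x)=-\mu D(x)+\frac a2D(x)^2$ (equal to $+\infty$ when $D(x)=\infty$), and $\nu_{N,\mu,\alpha}^{\mathrm{PMF}}(dx)=\frac{\exp(-|\Lambda_N|\beta H^{\mathrm{PMF}}_\mu(x))}{Z_N}\nu_{N,\alpha}^{(\mathrm{bc})}(dx)$ with $Z_N$ the normalising constant. $(t)_+=\max(t,0)$. Off $\ell_1(\mathbb{R}_+)$ the rate function is $+\infty$. *)

(* Defs.v *)
From HB Require Import structures.
From mathcomp Require Import all_boot all_order all_algebra finmap.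
From mathcomp Require Import all_classical all_reals all_analysis.
Import Order.TTheory GRing.Theory Num.Theory.
Import numFieldNormedType.Exports.

Set Implicit Arguments.
Unset Strict Implicit.
Unset Printing Implicit Defensive.

Local Open Scope classical_set_scope.
Local Open Scope ring_scope.

(* Sequences indexed by k >= 1 in the source are indexed by nat here, so that
   entry number k : nat stands for the k.+1-st term. *)

Section ell1.
Context {R : realType}.

Definition ell1_pred : {pred (nat -> R^o)} :=
  mem [set x : nat -> R^o | cvgn [normed series (x : R^nat)]].

Lemma ell1_submod_closed : submod_closed ell1_pred.
Proof.
split.
  rewrite inE/=; have -> : [normed series (0 : nat -> R^o)] = cst 0.
    by apply/funext => n; apply: big1 => i _; exact: normr0.
  exact: is_cvg_cst.
move=> a x y; rewrite !inE /= => cx cy.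
have cz : cvgn (series (fun k => `|a| * `|x k| + `|y k|)).
  have -> : series (fun k => `|a| * `|x k| + `|y k|) =
      (fun n => `|a| * [normed series (x : R^nat)] n +
                [normed series (y : R^nat)] n).
    by apply/funext => n; rewrite /series/= big_split/= mulr_sumr.
  apply: is_cvgD => //; exact: is_cvgMr.
apply: series_le_cvg cz => k //=.
by rewrite (le_trans (ler_normD _ _)) // normrM.
Qed.

HB.instance Definition _ :=
  GRing.isSubmodClosed.Build R (nat -> R^o) ell1_pred ell1_submod_closed.

Record ell1 := Ell1 { ell1_val :> nat -> R^o ; _ : ell1_val \in ell1_pred }.

HB.instance Definition _ := [isSub for ell1_val].
HB.instance Definition _ := [Choice of ell1 by <:].
HB.instance Definition _ := [SubChoice_isSubLmodule of ell1 by <:].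

Definition ell1_norm (x : ell1) : R := limn [normed series (x : R^nat)].

Lemma ell1_cvg (x : ell1) : cvgn [normed series (x : R^nat)].
Proof. by have := valP x; rewrite inE. Qed.

Lemma ell1_normD x y : ell1_norm (x + y) <= ell1_norm x + ell1_norm y.
Proof.
rewrite /ell1_norm -limD; [|exact: ell1_cvg|exact: ell1_cvg].
apply: ler_lim; [exact: ell1_cvg|exact: is_cvgD (@ell1_cvg x) (@ell1_cvg y)|].
apply: nearW => n; rewrite /series/=.
rewrite -[leRHS]/(\sum_(0 <= k < n) `|x k| + \sum_(0 <= k < n) `|y k|).
rewrite -big_split/=.
by apply: ler_sum => k _; exact: ler_normD.
Qed.

Lemma ell1_normZ (l : R) x : ell1_norm (l *: x) = `|l| * ell1_norm x.
Proof.
rewrite /ell1_norm.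
have -> : [normed series ((l *: x : ell1) : R^nat)] =
    (fun n => `|l| * [normed series (x : R^nat)] n).
  apply/funext => n; rewrite /series/= mulr_sumr.
  by apply: eq_bigr => k _; exact: normrM.
by apply: cvg_lim => //; apply: cvgM; [exact: cvg_cst|exact: ell1_cvg].
Qed.

Lemma ell1_norm0_eq0 x : ell1_norm x = 0 -> x = 0.
Proof.
move=> x0; apply/val_inj/funext => k; apply/normr0_eq0/eqP.
rewrite eq_le normr_ge0 andbT -[leRHS]x0.
have nd : nondecreasing_seq [normed series (x : R^nat)].
  by apply/nondecreasing_series => n _ _; exact: normr_ge0.
apply: le_trans (nondecreasing_cvgn_le nd (@ell1_cvg x) k.+1).
rewrite -[leRHS]/(\sum_(0 <= i < k.+1) `|x i|) big_nat_recr//= lerDr.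
by apply: sumr_ge0 => i _; exact: normr_ge0.
Qed.

HB.instance Definition _ := @Lmodule_isNormed.Build R ell1 ell1_norm
  ell1_normD ell1_normZ ell1_norm0_eq0.

End ell1.
Arguments ell1 : clear implicits.

Definition borel_ell1 (R : realType) :=
  g_sigma_algebraType (@open (ell1 R)).

Section lebesgue_tuple.
Context {R : realType}.
Local Open Scope ereal_scope.

Definition cons_pair n (p : measurableTypeR R * n.-tuple (measurableTypeR R)) :
  n.+1.-tuple (measurableTypeR R) := [the n.+1.-tuple _ of p.1 :: p.2].

Lemma measurable_cons_pair n : measurable_fun setT (@cons_pair n).
Proof. by apply: measurable_cons. Qed.

Definition cons_measure n
    (m : {sigma_finite_measure set (n.-tuple (measurableTypeR R)) -> \bar R}) :=
  pushforward (@lebesgue_measure R \x m) (@cons_pair n).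

Section cons_measure.
Variable n : nat.
Variable m :
  {sigma_finite_measure set (n.-tuple (measurableTypeR R)) -> \bar R}.

Let cons0 : cons_measure m set0 = 0.
Proof. by rewrite /cons_measure /pushforward preimage_set0 measure0. Qed.

Let cons_ge0 A : 0 <= cons_measure m A.
Proof. by rewrite /cons_measure /pushforward; exact: measure_ge0. Qed.

Let cons_sigma_additive : semi_sigma_additive (cons_measure m).
Proof.
have mC A : measurable A -> measurable (@cons_pair n @^-1` A).
  by move=> mA; rewrite -[X in measurable X]setTI; exact: measurable_cons_pair.
move=> F mF tF mUF; rewrite /cons_measure /pushforward preimage_bigcup.
apply: measure_semi_sigma_additive.
- by move=> i; exact: mC.
- apply/trivIsetP => /= i j _ _ ij; rewrite -preimage_setI.
  by move/trivIsetP : tF => /(_ _ _ _ _ ij) ->//; rewrite preimage_set0.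
- by rewrite -preimage_bigcup; exact: mC.
Qed.

HB.instance Definition _ :=
  isMeasure.Build _ _ _ (cons_measure m) cons0 cons_ge0 cons_sigma_additive.

Let cons_sigma_finite : sigma_finite setT (cons_measure m).
Proof.
have /sigma_finiteP[F [TF ndF Foo]] := sigma_finiteT (@lebesgue_measure R).
have /sigma_finiteP[G [TG ndG Goo]] := sigma_finiteT m.
pose tl (t : n.+1.-tuple (measurableTypeR R)) :=
  [tuple of behead t] : n.-tuple (measurableTypeR R).
exists (fun i => (@thead n _) @^-1` F i `&` tl @^-1` G i).
  apply/esym/seteqP; split=> // t _.
  have [i _ Fi] : (\bigcup_i F i) (thead t) by rewrite -TF.
  have [j _ Gj] : (\bigcup_i G i) (tl t) by rewrite -TG.
  exists (maxn i j) => //; split.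
  - by have /subsetPset := ndF _ _ (leq_maxl i j); exact.
  - by have /subsetPset := ndG _ _ (leq_maxr i j); exact.
move=> i; have [mF oF] := Foo i; have [mG oG] := Goo i; split.
  apply: measurableI.
    by rewrite -[X in measurable X]setTI; exact: (measurable_tnth ord0).
  by rewrite -[X in measurable X]setTI; exact: measurable_behead.
rewrite /cons_measure /pushforward (_ : _ @^-1` _ = F i `*` G i).
  rewrite product_measure1E// lte_mul_pinfty// ge0_fin_numE//.
apply/seteqP; split=> -[x t]; rewrite /= /cons_pair/= theadE;
  by rewrite (_ : tl _ = t)//; exact: val_inj.
Qed.

HB.instance Definition _ :=
  Measure_isSigmaFinite.Build _ _ _ (cons_measure m) cons_sigma_finite.
End cons_measure.

Fixpoint lebesgue_tuple n :
    {sigma_finite_measure set (n.-tuple (measurableTypeR R)) -> \bar R} :=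
  if n is n'.+1 then cons_measure (lebesgue_tuple n')
  else \d_([tuple] : 0.-tuple (measurableTypeR R)).
Lemma lebesgue_tuple_box n (A : 'I_n -> set (measurableTypeR R)) :
  (forall i, measurable (A i)) ->
  lebesgue_tuple n [set x | forall i, A i (tnth x i)] =
  \prod_(i < n) lebesgue_measure (A i).
Proof.
elim: n A => [|n IH] A mA.
  by rewrite big_ord0 [LHS]diracE mem_set//; case.
rewrite [LHS](_ : _ = (lebesgue_measure \x lebesgue_tuple n)%E
  (@cons_pair n @^-1` [set x | forall i, A i (tnth x i)]))// (_ : _ @^-1` _ = A ord0 `*` [set x : n.-tuple (measurableTypeR R) | forall i, A (lift ord0 i) (tnth x i)]).
  rewrite product_measure1E//; last first.
    rewrite (_ : [set x | _ ] = \bigcap_(i in [set: 'I_n]) [set x : n.-tuple (measurableTypeR R) | A (lift ord0 i) (tnth x i)]); last first.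
      by apply/seteqP; split => x h i; [move=> _; exact: h|exact: (h i I)].
    apply: fin_bigcap_measurable => // i _.
    by rewrite -[X in measurable X]setTI; exact: (measurable_tnth i).
  rewrite big_ord_recl; congr (_ * _)%E; by apply: (IH (fun i => A (lift ord0 i))) => i; exact: mA.
apply/seteqP; split=> -[x t] /=.
  move=> h; split; first by have := h ord0; rewrite /cons_pair/=. 
  by move=> i; have := h (lift ord0 i); rewrite tnthS.
move=> [h1 h2] i; case: (unliftP ord0 i) => [j|] -> //=; by rewrite tnthS; exact: h2.
Qed.

End lebesgue_tuple.

Section heat_kernels.
Context {R : realType} {d : nat}.
Implicit Types (x y : d.-tuple R) (t : R) (N : nat).

Definition tuple_zero : d.-tuple R := [tuple 0 | i < d].
Definition tuple_add x y : d.-tuple R := [tuple tnth x i + tnth y i | i < d].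
Definition tuple_sub x y : d.-tuple R := [tuple tnth x i - tnth y i | i < d].
Definition tuple_of_row (u : 'rV[R]_d) : d.-tuple R := [tuple u ord0 i | i < d].

Definition cube N : set (d.-tuple R) :=
  [set x | forall i, - N%:R <= tnth x i <= N%:R].
Definition open_cube N : set (d.-tuple R) :=
  [set x | forall i, - N%:R < tnth x i < N%:R].
Definition cube_volume N : R := (2 * N%:R) ^+ d.

Definition heat_kernel t x y : R :=
  (4 * pi * t) `^ (- (d%:R / 2)) *
  expR (- (\sum_(i < d) (tnth x i - tnth y i) ^+ 2) / (4 * t)).

Definition periodic_heat_kernel N t x y : \bar R :=
  \esum_(z in [set: d.-tuple int])
    (heat_kernel t x
      [tuple tnth y i + 2 * N%:R * (tnth z i)%:~R | i < d])%:E.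

(* Brownian motion with generator the Laplacian, started at the origin: its
   increment over a time t has density heat_kernel t 0, that is, each coordinate
   has variance 2 * t. The values B s with s < 0 are irrelevant. *)
Definition brownian_motion {dO} {Om : measurableType dO}
    (P : probability Om R) (B : R -> Om -> d.-tuple R) : Prop :=
  [/\ forall s, 0 <= s -> measurable_fun setT (B s),
      forall w, B 0 w = tuple_zero,
      forall w i, {within `[0, +oo[, continuous (fun s => tnth (B s w) i)} &
      forall (n : nat) (s : nat -> R) (A : nat -> set (d.-tuple R)),
        0 <= s 0%N -> (forall j, s j < s j.+1) ->
        (forall j, measurable (A j)) ->
        P [set w | forall j, (j < n)%N ->
                     A j (tuple_sub (B (s j.+1) w) (B (s j) w))] =
        (\prod_(j < n) \int[lebesgue_tuple d]_(y in A j)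
           (heat_kernel (s j.+1 - s j) tuple_zero y)%:E)%E].

(* g is the transition density of Brownian motion killed on leaving cube N. The
   first three clauses determine g t x only almost everywhere; continuity on the
   interior selects the version whose diagonal values are meaningful (the
   boundary is Lebesgue-negligible). *)
Definition killed_transition_density N (g : R -> d.-tuple R -> d.-tuple R -> R)
    : Prop :=
  exists (dO : measure_display) (Om : measurableType dO)
    (P : probability Om R) (B : R -> Om -> d.-tuple R),
  brownian_motion P B /\
  forall t, 0 < t ->
  [/\ forall x y, cube N x -> cube N y -> 0 <= g t x y,
      forall x, cube N x -> measurable_fun (cube N) (g t x),
      forall x A, cube N x -> measurable A -> A `<=` cube N ->
        P [set w | A (tuple_add x (B t w)) /\
                   forall s, 0 <= s <= t -> cube N (tuple_add x (B s w))] =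
        (\int[lebesgue_tuple d]_(y in A) (g t x y)%:E)%E &
      forall u v : 'rV[R]_d,
        open_cube N (tuple_of_row u) -> open_cube N (tuple_of_row v) ->
        {for (u, v), continuous (fun p : 'rV[R]_d * 'rV[R]_d =>
           g t (tuple_of_row p.1) (tuple_of_row p.2))}].

End heat_kernels.
Arguments cube_volume R d N : clear implicits.

Inductive boundary_condition := BCfree | BCper | BCdir.

Section cycle_counts.
Context {R : realType}.

(* Entry k belongs to cycles of length k.+1. *)
Definition free_weight (d : nat) (beta alpha : R) (k : nat) : R :=
  expR (beta * alpha * k.+1%:R) /
  ((4 * pi * beta) `^ (d%:R / 2) * k.+1%:R `^ (1 + d%:R / 2)).

(* gDir is the Dirichlet heat kernel of the cube of side 2 * N; it is used only
   for BCdir. *)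
Definition cycle_weight (d : nat) (beta alpha : R)
    (gDir : R -> d.-tuple R -> d.-tuple R -> R)
    (bc : boundary_condition) (N k : nat) : R :=
  let bounded_weight (g : R -> d.-tuple R -> d.-tuple R -> \bar R) :=
    if (k.+1 <= N)%N then
      expR (beta * alpha * k.+1%:R) / (k.+1%:R * cube_volume R d N) *
      fine (\int[lebesgue_tuple d]_(x in cube N) g (k.+1%:R * beta)%R x x)
    else 0 in
  match bc with
  | BCfree => free_weight d beta alpha k
  | BCper => bounded_weight (periodic_heat_kernel N)
  | BCdir => bounded_weight (fun t x y => (gDir t x y)%:E)
  end.

Section random_variables.
Context {dO} {Om : measurableType dO} (P : probability Om R).

Definition independent_counts (X : nat -> Om -> nat) : Prop :=
  forall (J : {fset nat}) (A : nat -> set nat),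
    P (\bigcap_(k in [set` J]) (X k @^-1` A k)) =
    (\prod_(k <- J) P (X k @^-1` A k))%E.

(* The second argument of the library's poisson_prob is unused. *)
Definition independent_poisson (rate : nat -> R) (X : nat -> Om -> nat) : Prop :=
  [/\ forall k, measurable_fun setT (X k),
      independent_counts X &
      forall k (A : set nat),
        P (X k @^-1` A) = poisson_prob (rate k) 0%N A].

(* The sequence of normalised counts is summable almost surely; it is sent to 0
   on the exceptional null set. *)
Definition empirical_counts (vol : R) (X : nat -> Om -> nat) (w : Om) : ell1 R :=
  insubd (0 : ell1 R) (fun k => (X k w)%:R / vol).

Definition counts_law (vol : R) (X : nat -> Om -> nat) :
    set (borel_ell1 R) -> \bar R :=
  pushforward P (empirical_counts vol X : Om -> borel_ell1 R).

End random_variables.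

Definition ell1_nonneg : set (ell1 R) := [set x | forall k, 0 <= x k].

Local Open Scope ereal_scope.

Definition particle_density (x : ell1 R) : \bar R :=
  \sum_(0 <= k <oo) (k.+1%:R * x k)%:E.

(* The 0 log 0 = 0 convention is automatic: a term with x k = 0 has factor x k.
   The partial sums are bounded below, the terms being at least - q k. *)
Definition ideal_rate (d : nat) (beta : R) (x : ell1 R) : \bar R :=
  let q := free_weight d beta 0 in
  if x \in ell1_nonneg then
    (\sum_(0 <= k <oo) (x k * (ln (x k / q k) - 1))%:E) +
    (\sum_(0 <= k <oo) (q k)%:E)
  else +oo.

Definition pmf_hamiltonian (a mu : R) (x : ell1 R) : \bar R :=
  if x \in ell1_nonneg then
    if particle_density x is D%:E then (- mu * D + a / 2 * D ^+ 2)%:E else +oo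
  else +oo.

Definition pmf_measure (a mu beta vol : R) (nu : set (borel_ell1 R) -> \bar R)
    (A : set (borel_ell1 R)) : \bar R :=
  let density (x : borel_ell1 R) :=
    expeR (- ((vol * beta)%:E * pmf_hamiltonian a mu x)) in
  (\int[nu]_(x in A) density x) / (\int[nu]_x density x).

(* Lower semicontinuous regularisation, relative to ell1_nonneg. *)
Definition pmf_hamiltonian_lsc (a mu : R) (x : ell1 R) : \bar R :=
  if x \in ell1_nonneg then
    limf_einf (pmf_hamiltonian a mu) (within ell1_nonneg (nbhs x))
  else +oo.

Definition pmf_rate (d : nat) (a beta mu : R) (x : ell1 R) : \bar R :=
  let F y := beta%:E * pmf_hamiltonian_lsc a mu y + ideal_rate d beta y in
  F x - ereal_inf (range F).

End cycle_counts.

Definition large_deviation_principle {R : realType} {T : topologicalType}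
    (rate : nat -> R) (nu : nat -> set T -> \bar R) (I : T -> \bar R) : Prop :=
  [/\ forall x, (0 <= I x)%E,
      lower_semicontinuous I,
      forall C : set T, closed C ->
        (limn_esup (fun N => (rate N)^-1%:E * lne (nu N C)) <=
         - ereal_inf (I @` C))%E &
      forall O : set T, open O ->
        (- ereal_inf (I @` O) <=
         limn_einf (fun N => (rate N)^-1%:E * lne (nu N O)))%E].

(* Main.v *)
Require Import Defs.
From HB Require Import structures.
From mathcomp Require Import all_boot all_order all_algebra finmap.
From mathcomp Require Import all_classical all_reals all_analysis.
From mathcomp Require Import measurable_realfun ring lra zify.
Import Order.TTheory GRing.Theory Num.Theory.
Import numFieldNormedType.Exports.

(* The Poisson law of (N_k) is written as a sum over finite configurations n.
   Absorbing the tilt exp(beta alpha k) of the intensities into the Hamiltonian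
   turns mu into mu + alpha and leaves weights r_k that tend to q_k and are at
   most (1 + o(1)) q_k.  With h(t) = - m^2/(2a) + (a/2) (t - m/a)_+^2 and
   m = mu + alpha, the candidate rate F(x) = beta h(D(x)) + I(x) is a supremum
   over K of beta h(D_K(x)) + sum_{k<K} (lambda_k x_k - q_k e^lambda_k + q_k),
   D_K being the partial sums of D, so F is lower semicontinuous and exponential
   Chebyshev bounds give the upper bound locally; tightness comes from a weight
   theta_k -> oo with sum_k q_k e^theta_k < oo.  For the lower bound and for the
   regularised Hamiltonian, x is truncated at K and the missing density
   max(D(x), m/a) - D_K(x) is put on cycles of length K + 1, which costs o(1) in
   the l1 norm; finitely supported points are reached by one atom and
   n! <= (n + 1)^(n + 1) e^(- n).

   Periodic weights are compared to q_k by a theta series.  For Dirichlet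
   weights, the diagonal of the killed density is squeezed by continuity from
   small boxes: it is at most the heat kernel, and the loss is the probability
   that a Brownian path pinned near its start leaves a large ball, bounded by a
   dyadic chaining argument uniformly in the starting point. *)

Set Implicit Arguments.
Unset Strict Implicit.
Unset Printing Implicit Defensive.

Local Open Scope classical_set_scope.
Local Open Scope ring_scope.

(** In the l1 norm [particle_density] is unbounded and merely lower semicontinuous, and for mu > 0
    the Hamiltonian is not even that, so a large deviation principle for the Poisson law cannot be
    tilted by a continuous functional; both bounds are proved directly on sums of atoms. The total
    intensity enters every atom through the same factor, which is carried along unevaluated and
    cancels against the normalising constant. What a boundary condition has to supply is asymmetric:
    the upper bound uses the domination of r_k by q_k, uniform in k, the lower bound the limits of
    finitely many r_k. For Dirichlet weights the diagonal is invisible to the law of the killed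
    motion, which gives integrals of the density over sets. The probability of a large excursion
    must therefore be bounded jointly with the return to a box of side 2 e, by a constant times (2
    e)^d, so that the estimate survives division by the volume of the box as e tends to 0. The
    chaining rests on finite-dimensional laws and continuity of paths, with no stopping times or
    reflection. *)

Lemma lipschitz1_continuous (R : realType) (V : normedModType R) (f : V -> R) :
  (forall x y, `|f x - f y| <= `|x - y|) -> continuous f.
Proof.
move=> fL x; apply/cvgrPdist_lt => e e0; near=> y.
apply: le_lt_trans (fL _ _) _.
by near: y; apply: cvgr_dist_lt.
Unshelve. all: by end_near. Qed.

Lemma fmap_ultrafilter (T U : Type) (f : T -> U) (F : set_system T) :
  UltraFilter F -> UltraFilter (f @ F).
Proof.
move=> uF; have pF : ProperFilter F := ultra_proper.
split=> [|G pG FG]; first exact: fmap_proper_filter.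
apply/seteqP; split=> A; last exact: FG.
move=> GA; have [//|FA] := in_ultra_setVsetC (f @^-1` A) uF.
have /filterI/(_ GA) : G (~` A) by apply: FG; rewrite /nbhs/= preimage_setC.
by rewrite setICl => /filter_not_empty.
Qed.

Lemma cvg_sumr (R : realType) (T : Type) (F : set_system T) {FF : Filter F} (I : Type)
    (r : seq I) (f : I -> T -> R) (l : I -> R) :
  (forall k, f k @ F --> l k) ->
  (fun x => \sum_(k <- r) f k x) @ F --> \sum_(k <- r) l k.
Proof.
move=> fl; elim: r => [|k r IH].
  rewrite big_nil; under eq_fun do rewrite big_nil; exact: cvg_cst.
rewrite big_cons; under eq_fun do rewrite big_cons.
exact: cvgD.
Qed.

Lemma continuous_sum_nat (R : realType) (T : topologicalType) (f : nat -> T -> R) n :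
  (forall k, continuous (f k)) -> continuous (fun x => \sum_(0 <= k < n) f k x).
Proof. by move=> fc x; apply: cvg_sumr => k; exact: fc. Qed.

Lemma continuousZl (R : realType) (T : topologicalType) (f : T -> R) (c : R) :
  continuous f -> continuous (fun x => c * f x).
Proof. by move=> fc x; apply: cvgMr; exact: fc. Qed.

(** * Compactness in l1 *)

Section ell1_topology.
Context {R : realType}.
Implicit Types (x y : ell1 R) (f : nat -> R).

Lemma ell1_psum_le x n : \sum_(0 <= k < n) `|x k| <= `|x|.
Proof.
apply: (@nondecreasing_cvgn_le _ [normed series (x : R^nat)]).
  by apply/nondecreasing_series => k _ _; exact: normr_ge0.
exact: ell1_cvg.
Qed.

Lemma ell1_norm_le x (B : R) :
  (forall n, \sum_(0 <= k < n) `|x k| <= B) -> `|x| <= B.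
Proof.
by move=> xB; apply: limr_le; [exact: ell1_cvg|exact: nearW].
Qed.

Lemma ell1_coord_le x k : `|x k| <= `|x|.
Proof.
apply: le_trans (ell1_psum_le x k.+1).
by rewrite big_nat_recr//= lerDr sumr_ge0.
Qed.

Lemma ell1_bounded f (B : R) : (forall n, \sum_(0 <= k < n) `|f k| <= B) ->
  exists2 x : ell1 R, x = f :> (nat -> R) & `|x| <= B.
Proof.
move=> fB; have fl : (f : nat -> R^o) \in ell1_pred.
  rewrite inE/=; apply: nondecreasing_is_cvgn.
    by apply/nondecreasing_series => k _ _; exact: normr_ge0.
  by exists B => _ [n _ <-]; exact: fB.
by exists (Ell1 fl) => //; exact: ell1_norm_le.
Qed.

Lemma ell1_coord_continuous k : continuous (fun x : ell1 R => x k : R).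
Proof.
apply: (@lipschitz1_continuous _ (ell1 R)) => x y.
exact: (ell1_coord_le (x - y)).
Qed.

Lemma ell1_sum_continuous (c : nat -> R) n :
  continuous (fun x : ell1 R => \sum_(0 <= k < n) c k * x k : R).
Proof.
apply: (@continuous_sum_nat _ (ell1 R) (fun k x => c k * x k)) => k.
apply: (@continuousZl _ (ell1 R)); exact: ell1_coord_continuous.
Qed.

Lemma closed_ell1_nonneg : closed (@ell1_nonneg R).
Proof.
have -> : @ell1_nonneg R =
    \bigcap_(k in setT) ((fun x : ell1 R => x k) @^-1` [set t | 0 <= t]).
  by apply/seteqP; split => [x x0 k _|x x0 k]; [exact: x0|exact: (x0 k I)].
apply: closed_bigI => k _; apply: closed_comp; last exact: closed_ge.
by move=> x _; exact: ell1_coord_continuous.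
Qed.

(** Markov's inequality: beyond n each entry is at most theta_k x_k / t. *)
Lemma ell1_tail_le x (theta : nat -> R) (B t : R) n M : ell1_nonneg x ->
  (forall k, 0 <= theta k) -> 0 < t -> (forall k, (n <= k)%N -> t <= theta k) ->
  (forall m, \sum_(0 <= k < m) theta k * x k <= B) ->
  \sum_(n <= k < M) `|x k| <= B / t.
Proof.
move=> x0 th0 t0 tth xB; rewrite ler_pdivlMr// mulr_suml.
have [nM|/ltnW Mn] := leqP n M; last first.
  rewrite big_geq//; apply: le_trans (xB 0%N); by rewrite big_nil.
apply: (@le_trans _ _ (\sum_(n <= k < M) theta k * x k)).
  rewrite big_nat_cond [leRHS]big_nat_cond; apply: ler_sum => k.
  rewrite andbT => /andP[nk _]; rewrite ger0_norm; last exact: x0.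
  by rewrite mulrC ler_wpM2r ?tth//; exact: x0.
apply: le_trans (xB M); rewrite (big_cat_nat (leq0n n) nM)/= lerDr.
by apply: sumr_ge0 => k _; rewrite mulr_ge0//; exact: x0.
Qed.

(* An ultrafilter on the set converges coordinatewise; the weights, tending to
   infinity, make the tails uniformly small, which upgrades this to l1. *)
Lemma ell1_compact (theta : nat -> R) (B : R) :
  (forall k, 0 < theta k) -> theta @ \oo --> +oo ->
  compact [set x : ell1 R | ell1_nonneg x /\
             forall n, \sum_(0 <= k < n) theta k * x k <= B].
Proof.
move=> th0 thoo; set K := [set x | _]; rewrite compact_ultra => F uF FK.
have thx k : exists l : R, (fun x : ell1 R => x k) @ F --> l.
  have Fk : UltraFilter ((fun x : ell1 R => x k : R) @ F) by exact: fmap_ultrafilter.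
  (* The weight bound confines coordinate k to the compact interval [0, B / theta_k]. *)
  have cI := @segment_compact R 0 (B / theta k).
  rewrite compact_ultra in cI.
  have [|l [_ Fl]] := cI ((fun x : ell1 R => x k : R) @ F) Fk; last by exists l.
    suff : F (fun x : ell1 R => `[0, B / theta k]%classic (x k)) by [].
    apply: filterS FK => x [x0 xB]; rewrite /= in_itv/= x0/= ler_pdivlMr//.
    rewrite mulrC; apply: le_trans (xB k.+1); rewrite big_nat_recr//= lerDr.
    by apply: sumr_ge0 => i _; rewrite mulr_ge0// ltW.
have [l ltoF] := choice thx.
have l0 k : 0 <= l k.
  apply: (cvgr_to_ge (ltoF k)).
  by apply: filterS FK => x [x0 _]; exact: x0.
have lB n : \sum_(0 <= k < n) theta k * l k <= B.
  have sl : (fun x : ell1 R => \sum_(0 <= k < n) theta k * x k : R) @ F -->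
      (\sum_(0 <= k < n) theta k * l k : R).
    by apply: cvg_sumr => k; apply: cvgMr; exact: ltoF.
  apply: (cvgr_to_le sl).
  by apply: filterS FK => x [_ xB]; exact: xB.
have /cvgryPge thge := thoo.
have [n0 _ n01] := thge 1.
(* Beyond n0 the weights are at least 1, so B also bounds the tail of l, which is therefore
   summable. *)
have hl : exists C : R, forall n, \sum_(0 <= k < n) `|l k| <= C.
  exists (\sum_(0 <= k < n0) `|l k| + B) => n.
  apply: (@le_trans _ _ (\sum_(0 <= k < n0 + n) `|l k|)).
    by rewrite [leRHS](@big_cat_nat _ _ _ n)//= ?lerDl ?sumr_ge0// leq_addl.
  rewrite (@big_cat_nat _ _ _ n0)//= ?leq_addr// lerD2l.
  apply: (@le_trans _ _ (\sum_(0 <= k < n0 + n) theta k * l k)) => //.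
  rewrite [leRHS](@big_cat_nat _ _ _ n0)//= ?leq_addr//.
  rewrite -[leLHS]add0r lerD//.
    by apply: sumr_ge0 => k _; rewrite mulr_ge0// ltW.
  rewrite big_nat_cond [leRHS]big_nat_cond; apply: ler_sum => k.
  rewrite andbT => /andP[nk _]; rewrite ger0_norm// ler_peMl//.
  exact: (n01 k nk).
have [C lC] := hl.
have [y yl _] := ell1_bounded lC.
have Ky : K y by split; [move=> k; rewrite yl|move=> n; rewrite yl].
exists y; split => //.
apply/cvgrPdist_lt => e e0.
have B0 : 0 <= B by apply: le_trans (lB 0%N); rewrite big_nil.
(* This makes B / t < e / 4, so the tails of y and z together cost less than e / 2. The 1 keeps t
   positive when B = 0. *)
pose t := (4 * B + 1) / e; have t0 : 0 < t by rewrite divr_gt0// ltr_wpDl// mulr_ge0.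
have [n _ nt] := thge t.
have Bt : B / t < e / 4.
  rewrite /t invf_div mulrA ltr_pdivrMr; last by rewrite ltr_wpDl// mulr_ge0.
  by rewrite mulrDr mulr1 mulrC mulrCA; nra.
have tl z M : K z -> \sum_(n <= k < M) `|z k| <= B / t.
  move=> [z0 zB]; apply: (ell1_tail_le (theta := theta)) => //.
  by move=> k; exact: ltW.
near=> z.
have Kz : K z by near: z.
have hn : \sum_(0 <= k < n) `|y k - z k| < e / 4.
  near: z.
  have yl0 : \sum_(0 <= k < n) `|y k - l k| = 0.
    by rewrite big1// => k _; rewrite yl subrr normr0.
  have : (fun z : ell1 R => \sum_(0 <= k < n) `|y k - z k| : R) @ F -->
      (\sum_(0 <= k < n) `|y k - l k| : R).
    apply: cvg_sumr => k; apply: cvg_norm; apply: cvgB; first exact: cvg_cst.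
    exact: ltoF.
  rewrite yl0.
  move=> /cvgrPdist_lt/(_ (e / 4)) h.
  have /h : 0 < e / 4 by lra.
  apply: filterS => z /=; rewrite sub0r normrN ger0_norm//.
  by apply: sumr_ge0.
apply: (@le_lt_trans _ _ (e / 4 + (B / t + B / t))); last by lra.
apply: ell1_norm_le => M.
apply: (@le_trans _ _ (\sum_(0 <= k < n + M) `|(y - z) k|)).
  by rewrite [leRHS](@big_cat_nat _ _ _ M)//= ?lerDl ?sumr_ge0// leq_addl.
rewrite (@big_cat_nat _ _ _ n)//= ?leq_addr//; apply: lerD; first exact: ltW.
apply: le_trans (lerD (tl _ (n + M)%N Ky) (tl _ (n + M)%N Kz)).
rewrite -big_split/=; apply: ler_sum => k _.
exact: (ler_normB (y k) (z k)).
Unshelve. all: by end_near. Qed.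

End ell1_topology.

Section limf_einf_bounds.
Context {R : realType} {T : ptopologicalType}.
Implicit Types (f : T -> \bar R) (F : set_system T) (c : \bar R).
Local Open Scope ereal_scope.

Lemma limf_einf_ge f F V c : F V -> (forall y, V y -> c <= f y) ->
  c <= limf_einf f F.
Proof.
move=> FV fc; rewrite /limf_einf leeNr limf_esupE.
apply: ge_ereal_inf; exists (ereal_sup [set (\- f) x | x in V]); first by exists V.
by apply: ge_ereal_sup => _ [y Vy <-]; rewrite leeN2; exact: fc.
Qed.

Lemma limf_einf_le f F c : (forall V, F V -> exists2 y, V y & f y <= c) ->
  limf_einf f F <= c.
Proof.
move=> fc; rewrite /limf_einf leeNl limf_esupE.
apply: le_ereal_inf_tmp => _ [V FV <-].
have [y Vy fyc] := fc _ FV.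
apply: le_ereal_sup_tmp; exists (- f y); first by exists y.
by rewrite leeN2.
Qed.

End limf_einf_bounds.

(** * The regularised Hamiltonian *)

Section pmf_profile.
Context {R : realType}.
Variables (a m : R).
Hypothesis a0 : 0 < a.

(** The infimum of - m s + (a / 2) s^2 over s >= t: in an l1 limit density can be lost, never
    gained, so an approximating point may carry any larger density. *)
Definition pmf_profile (t : R) : R :=
  a / 2 * Num.max (t - m / a) 0 ^+ 2 - m ^+ 2 / (2 * a).

Lemma pmf_profile_ge t : m / a <= t -> pmf_profile t = - m * t + a / 2 * t ^+ 2.
Proof.
move=> mt; rewrite /pmf_profile max_l ?subr_ge0//.
by field; rewrite gt_eqF.
Qed.

Lemma pmf_profile_lt t : t < m / a -> pmf_profile t = - (m ^+ 2 / (2 * a)).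
Proof.
by move=> tm; rewrite /pmf_profile max_r ?subr_le0 ?(ltW tm)// expr0n/= mulr0 add0r.
Qed.

(** The infimum is attained at s = max(t, m / a), the density up to which truncated points are
    filled later. *)
Lemma pmf_profile_max t s : Num.max t (m / a) = s -> pmf_profile t = - m * s + a / 2 * s ^+ 2.
Proof.
move=> <-; case: (leP (m / a) t) => h.
  by rewrite pmf_profile_ge.
by rewrite pmf_profile_lt//; field; rewrite gt_eqF.
Qed.

Lemma pmf_profile_le_quadratic t : pmf_profile t <= - m * t + a / 2 * t ^+ 2.
Proof.
case: (leP (m / a) t) => h; first by rewrite pmf_profile_ge.
rewrite pmf_profile_lt// -subr_ge0.
rewrite [leRHS](_ : _ = a / 2 * (t - m / a) ^+ 2); last by field; rewrite gt_eqF.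
by rewrite mulr_ge0 ?sqr_ge0// divr_ge0// ltW.
Qed.

Lemma pmf_profile_lower t : - (m ^+ 2 / (2 * a)) <= pmf_profile t.
Proof.
by rewrite /pmf_profile -[leLHS]add0r lerD2r mulr_ge0 ?sqr_ge0// divr_ge0// ltW.
Qed.

Lemma pmf_profile_homo : {homo pmf_profile : s t / s <= t}.
Proof.
move=> s t st; rewrite /pmf_profile lerD2r ler_wpM2l ?divr_ge0 ?(ltW a0)//.
apply: lerXn2r; rewrite ?nnegrE ?(le_max, lexx, orbT)// ge_max.
rewrite lerD2r st ge_max lexx/= andbT.
by have [//|] := leP 0 (t - m / a); move=> /ltW t0; apply: le_trans t0; rewrite lerD2r.
Qed.

Lemma pmf_profile_continuous : continuous pmf_profile.
Proof.
move=> t; rewrite /pmf_profile; apply: cvgB; last exact: cvg_cst.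
apply: cvgMr.
have mc : (fun s : R => Num.max (s - m / a) 0) @ t --> Num.max (t - m / a) 0.
  rewrite maxr_absE; under eq_fun do rewrite maxr_absE.
  have c1 : (fun s : R => s - m / a) @ t --> t - m / a.
    by apply: cvgB => //; exact: cvg_cst.
  apply: cvgMl; apply: cvgD; first by apply: cvgD => //; exact: cvg_cst.
  by apply: cvg_norm; apply: cvgB => //; exact: cvg_cst.
by rewrite expr2; under eq_fun do rewrite expr2; exact: cvgM.
Qed.

Lemma pmf_profile_cvgy (u : R^nat) : u @ \oo --> +oo -> pmf_profile \o u @ \oo --> +oo.
Proof.
move=> /cvgryPge uoo; apply/cvgryPge => A.
(* At distance s >= 1 from m / a one has s <= s^2, so a threshold linear in [|A|] suffices. *)
have [n _ nA] := uoo (m / a + 2 / a * (`|A| + m ^+ 2 / (2 * a)) + 1).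
exists n => // k nk /=; have := nA _ nk.
set u' := u k => hu; rewrite /pmf_profile.
have h0 : 0 <= 2 / a * (`|A| + m ^+ 2 / (2 * a)).
  by rewrite mulr_ge0// ?divr_ge0 ?(ltW a0)// addr_ge0// divr_ge0 ?sqr_ge0// mulr_ge0// ltW.
rewrite max_l; last by rewrite subr_ge0; lra.
apply: le_trans (ler_norm A) _; rewrite lerBrDr.
have h1 : 2 / a * (`|A| + m ^+ 2 / (2 * a)) <= (u' - m / a) ^+ 2.
  by apply: (@le_trans _ _ (u' - m / a)); [lra|rewrite expr2 ler_peMr; lra].
rewrite -ler_pdivrMl; last by rewrite divr_gt0.
by rewrite invf_div.
Qed.

End pmf_profile.

Lemma continuous_near_gt (R : realType) (T : topologicalType) (f : T -> R) x (c : R) :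
  continuous f -> c < f x -> nbhs x [set y | c < f y].
Proof. by move=> fc cf; exact: (cvgr_gt (f x) (fc x)). Qed.

Lemma nbhs_normP (R : realType) (V : normedModType R) (x : V) (A : set V) :
  nbhs x A -> exists2 e : R, 0 < e & forall y, `|x - y| < e -> A y.
Proof.
by move=> /nbhs_ballP[e e0 eA]; exists e => // y xy; apply: eA; rewrite -ball_normE.
Qed.

Lemma sum_nat_eq0 (V : nmodType) (F : nat -> V) n p :
  (forall k, (n <= k < p)%N -> F k = 0) -> \sum_(n <= k < p) F k = 0.
Proof. by move=> F0; rewrite big_nat_cond big1// => k /andP[/F0]. Qed.

(** * Particle density, its partial sums and truncations *)

Section particle_density.
Context {R : realType}.
Implicit Types (x y : ell1 R) (T D : R) (n K : nat).

Definition psum_density n x : R := \sum_(0 <= k < n) k.+1%:R * x k.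

Lemma psum_density_continuous n : continuous (psum_density n).
Proof. exact: ell1_sum_continuous. Qed.

Lemma psum_density_homo x : ell1_nonneg x ->
  {homo psum_density ^~ x : n k / (n <= k)%N >-> n <= k}.
Proof.
move=> x0; apply: (@nondecreasing_series _ _ predT 0) => k _ _.
by rewrite mulr_ge0//; exact: x0.
Qed.

Lemma psum_density_ge0 x n : ell1_nonneg x -> 0 <= psum_density n x.
Proof. by move=> x0; apply: sumr_ge0 => k _; rewrite mulr_ge0//; exact: x0. Qed.

Lemma particle_density_cvg x : ell1_nonneg x ->
  (psum_density n x)%:E @[n --> \oo] --> particle_density x.
Proof.
move=> x0; rewrite /particle_density.
have -> : (fun n => (psum_density n x)%:E) =
    (fun n => \sum_(0 <= k < n) (k.+1%:R * x k)%:E)%E.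
  by apply/funext => n; rewrite sumEFin.
apply: is_cvg_nneseries => k _ _.
by rewrite lee_fin mulr_ge0//; exact: x0.
Qed.

Lemma psum_density_le x n : ell1_nonneg x ->
  ((psum_density n x)%:E <= particle_density x)%E.
Proof.
move=> x0; rewrite /psum_density -sumEFin.
by apply: nneseries_lim_ge => k _ _; rewrite lee_fin mulr_ge0//; exact: x0.
Qed.

Lemma particle_density_ge0 x : ell1_nonneg x -> (0 <= particle_density x)%E.
Proof. by move=> x0; have := psum_density_le 0 x0; rewrite /psum_density big_nil. Qed.

Lemma particle_density_finite x n : (forall k, (n <= k)%N -> x k = 0) ->
  particle_density x = (psum_density n x)%:E.
Proof.
move=> x0; apply/cvg_lim => //; apply/cvg_ballP => e e0.
exists n => // k/= nk.
suff -> : (\sum_(0 <= i < k) (i.+1%:R * x i)%:E)%E = (psum_density n x)%:E.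
  exact: ballxx.
rewrite sumEFin /psum_density; congr (_%:E).
rewrite (big_cat_nat (leq0n n) nk)/= [X in _ + X]sum_nat_eq0 ?addr0// => i.
by move=> /andP[ni _]; rewrite x0 ?mulr0.
Qed.

Lemma pmf_hamiltonian_fin (a m : R) x D : ell1_nonneg x ->
  particle_density x = D%:E ->
  pmf_hamiltonian a m x = (- m * D + a / 2 * D ^+ 2)%:E.
Proof. by move=> x0 xD; rewrite /pmf_hamiltonian mem_set// xD. Qed.

Lemma pmf_hamiltonian_oo (a m : R) x : particle_density x = +oo%E ->
  pmf_hamiltonian a m x = +oo%E.
Proof. by move=> xD; rewrite /pmf_hamiltonian xD; case: ifP. Qed.

(** Partial densities are continuous in x and increase to the density; as the profile is
    nondecreasing, they yield continuous minorants of the Hamiltonian. *)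
Lemma pmf_profile_le_hamiltonian (a m : R) x n : 0 < a -> ell1_nonneg x ->
  ((pmf_profile a m (psum_density n x))%:E <= pmf_hamiltonian a m x)%E.
Proof.
move=> a0 x0; have := psum_density_le n x0.
rewrite /pmf_hamiltonian mem_set//; case E : particle_density => [D| |] //.
  rewrite !lee_fin => nD.
  apply: le_trans (pmf_profile_le_quadratic _ a0 _); exact: pmf_profile_homo.
by move=> _; rewrite leey.
Qed.

(* Truncation at K, completed by a small mass at the long cycle K + 1 so that
   the particle density becomes exactly T: the missing density escapes into
   long cycles at no cost in the l1 norm. *)
Definition trunc_fill x T K k : R :=
  if (k < K)%N then x k else
  if k == K then (T - psum_density K x) / K.+1%:R else 0.

(** The hypothesis [D <= T] makes the filled entry nonnegative. Entry K stands for length K + 1, so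
    it holds mass at most T / (K + 1), which is the l1 cost on top of the discarded tail of x. *)
Lemma trunc_fillP x D T K : ell1_nonneg x -> particle_density x = D%:E -> D <= T ->
  exists y : ell1 R, [/\ y = trunc_fill x T K :> (nat -> R), ell1_nonneg y,
    particle_density y = T%:E &
    `|x - y| <= (`|x| - \sum_(0 <= k < K) `|x k|) + T / K.+1%:R].
Proof.
move=> x0 xD DT.
have KD : psum_density K x <= T.
  by apply: le_trans DT; have := psum_density_le K x0; rewrite xD lee_fin.
pose z := trunc_fill x T K.
have z0 k : 0 <= z k.
  rewrite /z/trunc_fill; case: ifP => _; first exact: x0.
  by case: ifP => // _; rewrite divr_ge0// subr_ge0.
have zK k : (K.+1 <= k)%N -> z k = 0.
  by move=> Kk; rewrite /z/trunc_fill ltnNge (ltnW Kk)/= gtn_eqF.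
have [|y yz _] := @ell1_bounded R z (\sum_(0 <= k < K.+1) `|z k|).
  move=> n; have [nK|/ltnW Kn] := leqP n K.+1.
    by rewrite (big_cat_nat (leq0n n) nK)/= lerDl sumr_ge0.
  rewrite (big_cat_nat (leq0n _) Kn)/= [X in _ + X]sum_nat_eq0 ?addr0// => i.
  by move=> /andP[ni _]; rewrite zK ?normr0.
exists y; split => //.
- by move=> k; rewrite yz.
- rewrite (@particle_density_finite _ K.+1); last by move=> k Kk; rewrite yz zK.
  rewrite {1}/psum_density big_nat_recr//= yz {2}/z/trunc_fill ltnn eqxx.
  rewrite mulrC divfK// [X in X + _](_ : _ = psum_density K x) ?subrKC//.
  by apply: eq_big_nat => k /andP[_ kK]; rewrite /z/trunc_fill kK.
apply: ell1_norm_le => n.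
apply: (@le_trans _ _ (\sum_(0 <= k < K.+1 + n) `|(x - y) k|)).
  by rewrite [leRHS](@big_cat_nat _ _ _ n)//= ?lerDl ?sumr_ge0// leq_addl.
have h1 : \sum_(K <= k < K.+1 + n) `|x k| <= `|x| - \sum_(0 <= k < K) `|x k|.
  rewrite lerBrDl; apply: le_trans (ell1_psum_le x (K.+1 + n)).
  by rewrite [leRHS](@big_cat_nat _ _ _ K)//= addSn ltnW// ltnS leq_addr.
rewrite (@big_cat_nat _ _ _ K)//= ?addSn ?(leqW (leq_addr _ _))//.
rewrite [X in X + _ <= _]sum_nat_eq0 ?add0r; last first.
  move=> i /andP[_ ni].
  by rewrite -[LHS]/(`|x i - y i|) yz /z/trunc_fill ni subrr normr0.
apply: (@le_trans _ _ (\sum_(K <= k < K.+1 + n) `|x k| + \sum_(K <= k < K.+1 + n) `|y k|)).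
  rewrite -big_split/=; apply: ler_sum => k _; exact: (ler_normB (x k) (y k)).
apply: lerD => //.
rewrite big_ltn ?addSn ?ltnS ?leq_addr// [X in _ + X]sum_nat_eq0 ?addr0; last first.
  by move=> i /andP[ni _]; rewrite yz zK ?normr0.
rewrite yz ger0_norm// /z/trunc_fill ltnn eqxx ler_pM2r ?invr_gt0//.
by rewrite lerBlDr lerDl psum_density_ge0.
Qed.

Lemma trunc_fill_close x T (e : R) : 0 < e -> exists n, forall K, (n <= K)%N ->
  (`|x| - \sum_(0 <= k < K) `|x k|) + T / K.+1%:R < e.
Proof.
move=> e0.
suff : (fun K => (`|x| - \sum_(0 <= k < K) `|x k|) + T / K.+1%:R) @ \oo --> (0 : R).
  move=> /cvgrPdist_lt/(_ _ e0)[n _ nh]; exists n => K nK.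
  by have := nh _ nK; rewrite /= sub0r normrN; apply: le_lt_trans; exact: ler_norm.
rewrite [X in _ --> X](_ : _ = (`|x| - `|x|) + T * 0); last by rewrite subrr mulr0 addr0.
apply: cvgD; last by apply: cvgMr; exact: cvg_harmonic.
by apply: cvgB; [exact: cvg_cst|exact: ell1_cvg].
Qed.

End particle_density.

Section hamiltonian_lsc.
Context {R : realType}.
Variables (a m : R).
Hypothesis a0 : 0 < a.
Implicit Types x : ell1 R.

Lemma pmf_hamiltonian_lsc_ge x n (c : R) : ell1_nonneg x ->
  c < pmf_profile a m (psum_density n x) -> (c%:E <= pmf_hamiltonian_lsc a m x)%E.
Proof.
move=> x0 cn; rewrite /pmf_hamiltonian_lsc mem_set//.
apply: (@limf_einf_ge _ _ _ _
  [set y : ell1 R | ell1_nonneg y /\ c < pmf_profile a m (psum_density n y)]).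
  have : nbhs x [set y : ell1 R | c < pmf_profile a m (psum_density n y)].
    have pc : continuous (pmf_profile a m \o psum_density n).
      move=> y; apply: continuous_comp; first exact: psum_density_continuous.
      exact: pmf_profile_continuous.
    exact: (@continuous_near_gt _ (ell1 R) _ x c pc cn).
  by move=> xV; apply: filterS xV => y yc yn; split.
move=> y [y0 yc]; apply: le_trans (pmf_profile_le_hamiltonian _ n a0 y0).
by rewrite lee_fin ltW.
Qed.

(** From below, the partial densities converge to D and the profile is continuous. From above,
    truncations of x filled up to density max(D, m / a) converge to x and have energy exactly
    [pmf_profile a m D]. *)
Lemma pmf_hamiltonian_lsc_fin x D : ell1_nonneg x -> particle_density x = D%:E ->
  pmf_hamiltonian_lsc a m x = (pmf_profile a m D)%:E.
Proof.
move=> x0 xD; apply/eqP; rewrite eq_le; apply/andP; split; last first.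
  apply/lee_subgt0Pr => e e0.
  have Dn : psum_density ^~ x @ \oo --> D.
    by have := particle_density_cvg x0; rewrite xD => /fine_cvgP[].
  have Pn : (fun n => pmf_profile a m (psum_density n x)) @ \oo --> pmf_profile a m D.
    by apply: continuous_cvg => //; exact: pmf_profile_continuous.
  have : \forall n \near \oo, pmf_profile a m D - e < pmf_profile a m (psum_density n x).
    by apply: (cvgr_gt _ Pn); rewrite ltrBlDr ltrDl.
  move=> [n _ /(_ n (leqnn n))/= h].
  by rewrite -EFinB; exact: (@pmf_hamiltonian_lsc_ge _ n).
rewrite /pmf_hamiltonian_lsc mem_set//; apply: limf_einf_le => V.
rewrite /within/= => /(@nbhs_normP _ (ell1 R))[e e0 eV].
have DT : D <= Num.max D (m / a) by rewrite le_max lexx.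
have [K /(_ K (leqnn K)) Ke] := trunc_fill_close x (Num.max D (m / a)) e0.
have [y [_ y0 yT xy]] := trunc_fillP K x0 xD DT.
exists y; first by apply: eV => //; exact: le_lt_trans Ke.
by rewrite (pmf_hamiltonian_fin _ _ y0 yT) (pmf_profile_max a0 erefl).
Qed.

Lemma pmf_hamiltonian_lsc_oo x : ell1_nonneg x -> particle_density x = +oo%E ->
  pmf_hamiltonian_lsc a m x = +oo%E.
Proof.
move=> x0 xD; apply: eq_infty => c.
have Dn : psum_density ^~ x @ \oo --> +oo.
  by apply/cvgeryP; rewrite -xD; exact: particle_density_cvg.
have /cvgryPgt/(_ c)[n _ /(_ n (leqnn n))/= h] := pmf_profile_cvgy m a0 Dn.
exact: (@pmf_hamiltonian_lsc_ge _ n).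
Qed.

Lemma pmf_hamiltonian_lscE x : ell1_nonneg x ->
  pmf_hamiltonian_lsc a m x =
    (pmf_hamiltonian a m x -
     ((2 * a)^-1)%:E * maxe (m%:E - a%:E * particle_density x) 0 ^+ 2)%E /\
  pmf_hamiltonian_lsc a m x =
    (if ((m / a)%:E <= particle_density x)%E then pmf_hamiltonian a m x
     else (- (m ^+ 2 / (2 * a)))%:E).
Proof.
move=> x0; have := particle_density_ge0 x0.
case E : (particle_density x) => [D| |] // D0.
  rewrite (pmf_hamiltonian_lsc_fin x0 E) (pmf_hamiltonian_fin _ _ x0 E); split.
    rewrite -EFinM -EFinB -EFin_max -EFin_expe -EFinM -EFinB; congr (_%:E).
    have [h|h] := leP (m / a) D.
      rewrite pmf_profile_ge// max_r ?expr0n/= ?mulr0 ?subr0//.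
      by rewrite subr_le0 mulrC -ler_pdivrMr.
    rewrite pmf_profile_lt// max_l; last by rewrite subr_ge0 mulrC -ler_pdivlMr// ltW.
    by field; rewrite gt_eqF.
  rewrite lee_fin; case: ifP => h; first by rewrite pmf_profile_ge.
  by rewrite pmf_profile_lt// ltNge h.
(* At infinite density m - a D is -oo, so the subtracted square vanishes and all sides are +oo. *)
rewrite (pmf_hamiltonian_lsc_oo x0 E) (pmf_hamiltonian_oo _ _ E) leey; split => //.
by rewrite gt0_muley ?lte_fin//= maxNye/=.
Qed.

End hamiltonian_lsc.

(** * The rate function *)

Section inverse_sqrt_series.
Context {R : realType}.

(** Comparison of the series of k^(-3/2) with an integral, in telescoping form: for consecutive
    square roots s < u, u^(-3) <= 2 / s - 2 / u. *)
Lemma sum_inv_sqrt_bound n :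
  \sum_(0 <= k < n.+1) (k.+1%:R * Num.sqrt k.+1%:R)^-1 <= 3 - 2 / Num.sqrt n.+1%:R :> R.
Proof.
elim: n => [|n IH]; first by rewrite big_nat1 sqrtr1 mul1r !divr1 invr1; lra.
rewrite big_nat_recr//=; apply: le_trans (lerD IH (lexx _)) _.
set s := Num.sqrt n.+1%:R; set u := Num.sqrt n.+2%:R.
have s0 : 0 < s by rewrite sqrtr_gt0.
have u0 : 0 < u by rewrite sqrtr_gt0.
have ss : s ^+ 2 = n.+1%:R by rewrite sqr_sqrtr.
have uu : u ^+ 2 = n.+2%:R by rewrite sqr_sqrtr.
have us : u ^+ 2 = s ^+ 2 + 1 by rewrite ss uu -natr1.
rewrite -uu.
suff : (u ^+ 2 * u)^-1 <= 2 / s - 2 / u by lra.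
have -> : 2 / s - 2 / u = 2 * u ^+ 2 * (u ^+ 2 - s ^+ 2) / (s * (u + s)) / (u ^+ 2 * u).
  by field; rewrite !gt_eqF// addr_gt0.
rewrite us addrAC subrr add0r mulr1 -us.
rewrite ler_peMl ?invr_ge0 ?mulr_ge0 ?sqr_ge0 ?(ltW u0)//.
rewrite ler_pdivlMr ?mulr_gt0 ?addr_gt0// mul1r.
nra.
Qed.

Lemma sum_inv_sqrt_le n : \sum_(0 <= k < n) (k.+1%:R * Num.sqrt k.+1%:R)^-1 <= 3 :> R.
Proof.
case: n => [|n]; first by rewrite big_nil.
by apply: le_trans (sum_inv_sqrt_bound n) _; rewrite lerBlDr lerDl divr_ge0// sqrtr_ge0.
Qed.

Lemma ln_le_sqrt (x : R) : 0 < x -> ln x <= 2 * Num.sqrt x.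
Proof.
move=> x0; have s0 : 0 < Num.sqrt x by rewrite sqrtr_gt0.
have -> : ln x = 2 * ln (Num.sqrt x).
  by rewrite -{1}(sqr_sqrtr (ltW x0)) lnXn// mulr_natl.
rewrite ler_pM2l//.
have -> : ln (Num.sqrt x) = ln (1 + (Num.sqrt x - 1)) by rewrite subrKC.
apply: le_trans (le_ln1Dx _) _; lra.
Qed.

End inverse_sqrt_series.

(** * Size of the free weights *)

Section free_weight.
Context {R : realType}.
Variables (d : nat) (beta : R).
Hypotheses (d0 : (0 < d)%N) (beta0 : 0 < beta).
Let q := free_weight d beta (0 : R).

Lemma free_weightE k : q k = ((4 * pi * beta) `^ (d%:R / 2))^-1 *
  (k.+1%:R `^ (1 + d%:R / 2))^-1.
Proof. by rewrite /q/free_weight mulr0 mul0r expR0 div1r invfM. Qed.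

Let c0 : 0 < 4 * pi * beta.
Proof. by rewrite !mulr_gt0// pi_gt0. Qed.

Lemma free_weight_gt0 k : 0 < q k.
Proof. by rewrite free_weightE mulr_gt0// invr_gt0 powR_gt0. Qed.

(** Here d >= 1 enters: the decay exponent 1 + d / 2 is at least 3/2. *)
Lemma free_weight_le k : q k <=
  ((4 * pi * beta) `^ (d%:R / 2))^-1 * (k.+1%:R * Num.sqrt k.+1%:R)^-1.
Proof.
have s0 : 0 < k.+1%:R * Num.sqrt k.+1%:R :> R by rewrite mulr_gt0// sqrtr_gt0.
rewrite free_weightE ler_pM2l ?invr_gt0 ?powR_gt0// lef_pV2 ?posrE ?powR_gt0//.
rewrite -powR12_sqrt// -{1}(@powRr1 _ k.+1%:R)// -powRD; last by rewrite pnatr_eq0 implybT.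
apply: ler_powR; first by rewrite ler1n.
by rewrite lerD2l ler_peMl ?ler1n.
Qed.

Lemma free_weight_sum_le n : \sum_(0 <= k < n) q k <= ((4 * pi * beta) `^ (d%:R / 2))^-1 * 3.
Proof.
apply: le_trans (ler_sum _ (fun k _ => free_weight_le k)) _.
by rewrite -mulr_sumr ler_pM2l ?invr_gt0 ?powR_gt0// sum_inv_sqrt_le.
Qed.

Lemma free_weight_cvg : cvgn (series q).
Proof.
apply: nondecreasing_is_cvgn.
  by apply: nondecreasing_series => k _ _; exact/ltW/free_weight_gt0.
by exists (((4 * pi * beta) `^ (d%:R / 2))^-1 * 3) => _ [n _ <-]; exact: free_weight_sum_le.
Qed.

Lemma free_weight_series : (\sum_(0 <= k <oo) (q k)%:E = (limn (series q))%:E)%E.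
Proof.
apply/cvg_lim => //.
have -> : (fun n => \sum_(0 <= k < n) (q k)%:E)%E = EFin \o series q.
  by apply/funext => n; rewrite sumEFin.
by apply: cvg_EFin; [exact: nearW|exact: free_weight_cvg].
Qed.

Lemma free_weight_psum_le n : \sum_(0 <= k < n) q k <= limn (series q).
Proof.
apply: (@nondecreasing_cvgn_le _ (series q)).
  by apply: nondecreasing_series => k _ _; exact/ltW/free_weight_gt0.
exact: free_weight_cvg.
Qed.

(** What matters is growth slower than linear: a mass of order 1 / K placed on length K then has an
    entropy cost of order 1 / sqrt K. *)
Lemma ln_free_weight_le : exists A : R, 0 <= A /\
  forall k, - ln (q k) <= A * Num.sqrt k.+1%:R.
Proof.
pose c : R := `|ln ((4 * pi * beta) `^ (d%:R / 2))|.
exists (c + (1 + d%:R / 2) * 2); split; first by rewrite addr_ge0 ?normr_ge0 ?mulr_ge0 ?addr_ge0 ?divr_ge0.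
move=> k; rewrite free_weightE -invfM lnV ?posrE ?mulr_gt0 ?powR_gt0// opprK.
rewrite lnM ?posrE ?powR_gt0// [ln (k.+1%:R `^ _)]ln_powR [leRHS]mulrDl; apply: lerD.
  apply: le_trans (ler_norm _) _; rewrite -/c ler_peMr//.
    exact: normr_ge0.
  by rewrite -[leLHS]sqrtr1 ler_sqrt ?ler1n.
by rewrite -mulrA ler_wpM2l ?ln_le_sqrt// addr_ge0// divr_ge0.
Qed.

(* Dini: dividing the terms by the square roots of the tail sums keeps the
   series convergent. *)
Lemma free_weight_tilt : exists theta : nat -> R, [/\ (forall k, 0 < theta k),
  theta @ \oo --> +oo & exists B, forall n, \sum_(0 <= k < n) q k * expR (theta k) <= B].
Proof.
pose Q := limn (series q).
pose t k := Q - \sum_(0 <= j < k) q j.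
have tS k : t k = q k + t k.+1 by rewrite /t big_nat_recr//=; lra.
have t0 k : 0 < t k.
  rewrite tS ltr_wpDr ?free_weight_gt0// subr_ge0; exact: free_weight_psum_le.
have tQ k : t k <= Q by rewrite /t lerBlDr lerDl sumr_ge0// => j _; exact/ltW/free_weight_gt0.
have Q0 : 0 < Q by apply: lt_le_trans (t0 0%N) (tQ 0%N).
(* That is, e^theta_k = e sqrt (Q / t_k) with t_k the tail sum; since t_k <= Q, the summand 1 keeps
   theta positive. *)
pose theta k := 1 - ln (t k / Q) / 2.
have thE k : expR (theta k) = expR 1 * Num.sqrt Q / Num.sqrt (t k).
  rewrite /theta expRD -mulrA; congr (_ * _).
  have tq : 0 < t k / Q by rewrite divr_gt0.
  have -> : Num.sqrt Q / Num.sqrt (t k) = (Num.sqrt (t k / Q))^-1.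
    by rewrite sqrtrM ?(ltW (t0 _))// sqrtrV ?(ltW Q0)// invf_div mulrC mulrC.
  rewrite expRN; congr (_^-1).
  by rewrite -powR12_sqrt ?(ltW tq)// /powR gt_eqF// mulrC.
exists theta; split.
- move=> k; rewrite /theta.
  have : ln (t k / Q) <= 0 by apply: ln_le0; rewrite ler_pdivrMr// mul1r.
  by lra.
- have tto0 : t @ \oo --> (0 : R).
    by rewrite -(subrr Q); apply: cvgB; [exact: cvg_cst|exact: free_weight_cvg].
  apply/cvgryPge => A.
  have : \forall k \near \oo, t k < Q * expR (- (2 * `|A|)).
    by apply: (cvgr_lt _ tto0); rewrite mulr_gt0// expR_gt0.
  apply: filterS => k; rewrite mulrC -ltr_pdivrMr// => h; rewrite /theta.
  have : ln (t k / Q) <= - (2 * `|A|).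
    by rewrite -(expRK (- (2 * `|A|))) ler_ln ?posrE ?expR_gt0 ?divr_gt0// ltW.
  have := ler_norm A; lra.
(* The sum telescopes: as q_n = t_n - t_(n+1), q_n / sqrt t_n is at most 2 (sqrt t_n - sqrt
   t_(n+1)). *)
exists (expR 1 * Num.sqrt Q * (2 * Num.sqrt Q)) => n.
apply: (@le_trans _ _ (expR 1 * Num.sqrt Q * (2 * (Num.sqrt (t 0%N) - Num.sqrt (t n))))).
  elim: n => [|n IH]; first by rewrite big_nil subrr !mulr0.
  rewrite big_nat_recr//=; apply: le_trans (lerD IH (lexx _)) _.
  suff : q n * expR (theta n) <= expR 1 * Num.sqrt Q *
      (2 * (Num.sqrt (t n) - Num.sqrt (t n.+1))) by lra.
  rewrite thE mulrCA ler_wpM2l ?mulr_ge0 ?expR_ge0 ?sqrtr_ge0//.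
  have -> : q n = Num.sqrt (t n) ^+ 2 - Num.sqrt (t n.+1) ^+ 2.
    by rewrite !sqr_sqrtr ?(ltW (t0 _))// tS addrK.
  have sn : 0 < Num.sqrt (t n) by rewrite sqrtr_gt0.
  have sn1 : 0 < Num.sqrt (t n.+1) by rewrite sqrtr_gt0.
  rewrite ler_pdivrMr// -subr_ge0.
  by rewrite [leRHS](_ : _ = (Num.sqrt (t n) - Num.sqrt (t n.+1)) ^+ 2) ?sqr_ge0//; ring.
rewrite ler_wpM2l ?mulr_ge0 ?expR_ge0 ?sqrtr_ge0// ler_pM2l//.
rewrite lerBlDr ler_wpDr ?sqrtr_ge0// ler_wsqrtr//; exact: tQ.
Qed.

End free_weight.

Lemma continuousDl (R : realType) (T : topologicalType) (f g : T -> R) :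
  continuous f -> continuous g -> continuous (fun x => f x + g x).
Proof. by move=> fc gc x; apply: cvgD; [exact: fc|exact: gc]. Qed.

(** * Convex duality for one entropy term *)

Section relative_entropy_term.
Context {R : realType}.
Implicit Types q t lam c : R.

(** Adding q makes the term nonnegative, with minimum 0 at t = q, so that partial sums of these
    terms increase. *)
Definition entropy_term q t : R := t * (ln (t / q) - 1) + q.

Lemma entropy_term0 q : entropy_term q 0 = q.
Proof. by rewrite /entropy_term mul0r add0r. Qed.

(** Fenchel-Young inequality: q (e^lam - 1) is the convex conjugate of the term. It reduces to e^u
    >= 1 + u at u = lam - ln (t / q). *)
Lemma entropy_term_young q t lam : 0 < q -> 0 <= t ->
  lam * t - q * expR lam + q <= entropy_term q t.
Proof.
move=> q0; rewrite le_eqVlt => /predU1P[<-|t0].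
  by rewrite entropy_term0 mulr0 add0r gerDr oppr_le0 mulr_ge0 ?expR_ge0 ?ltW.
rewrite /entropy_term lerD2r.
have -> : q * expR lam = t * expR (lam - ln (t / q)).
  rewrite expRB lnK ?posrE ?divr_gt0// invf_div.
  by field; rewrite !gt_eqF.
have := expR_ge1Dx (lam - ln (t / q)).
by rewrite -(ler_pM2l t0); lra.
Qed.

Lemma entropy_term_ge0 q t : 0 < q -> 0 <= t -> 0 <= entropy_term q t.
Proof.
move=> q0 t0; apply: le_trans (entropy_term_young 0 q0 t0).
by rewrite mul0r expR0 mulr1 sub0r addNr.
Qed.

(** For t > 0 the slope ln (t / q) gives equality. At t = 0 the supremum q is approached only as lam
    tends to -oo, so lam is taken with q e^lam = (q - c) / 2. *)
Lemma entropy_term_young_sharp q t c : 0 < q -> 0 <= t -> c < entropy_term q t ->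
  exists lam, c < lam * t - q * expR lam + q.
Proof.
move=> q0; rewrite le_eqVlt => /predU1P[<-|t0].
  rewrite entropy_term0 => cq; exists (ln ((q - c) / (2 * q))).
  rewrite lnK ?posrE ?divr_gt0 ?mulr_gt0 ?subr_gt0// mulr0 add0r.
  have -> : q * ((q - c) / (2 * q)) = (q - c) / 2 by field; rewrite gt_eqF.
  lra.
move=> ct; exists (ln (t / q)).
rewrite lnK ?posrE ?divr_gt0// mulrC (mulrC q) divfK ?gt_eqF//.
by move: ct; rewrite /entropy_term; lra.
Qed.

Lemma entropy_term_small q t : t <= 1 -> 0 < q -> 0 <= t -> entropy_term q t - q <= t * - ln q.
Proof.
move=> t1 q0; rewrite le_eqVlt => /predU1P[<-|t0].
  by rewrite entropy_term0 subrr mul0r.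
rewrite /entropy_term addrK ler_pM2l// ln_div ?posrE//.
have := ln_le0 t1; lra.
Qed.

End relative_entropy_term.

(** * The unnormalised rate function *)

Section pmf_rate_function.
Context {R : realType}.
Variables (d : nat) (a beta m : R).
Hypotheses (d0 : (0 < d)%N) (beta0 : 0 < beta) (a0 : 0 < a).
Let q := free_weight d beta (0 : R).
Let q0 k : 0 < q k := free_weight_gt0 d beta0 k.
Let qbar : R := limn (series q).
Implicit Types (x y : ell1 R) (n K : nat) (c L : R).

Definition psum_entropy n x : R := \sum_(0 <= k < n) entropy_term (q k) (x k).

Lemma psum_entropy_homo x : ell1_nonneg x ->
  {homo psum_entropy ^~ x : n k / (n <= k)%N >-> n <= k}.
Proof.
move=> x0; apply: (@nondecreasing_series _ _ predT 0) => k _ _.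
by apply: entropy_term_ge0 => //; exact: x0.
Qed.

Lemma ideal_rate_cvg x : ell1_nonneg x ->
  (psum_entropy n x)%:E @[n --> \oo] --> ideal_rate d beta x.
Proof.
move=> x0; rewrite /ideal_rate mem_set// free_weight_series// -/q -/qbar.
have cv : cvgn (fun n => (psum_entropy n x)%:E).
  apply: ereal_nondecreasing_is_cvgn => n k nk.
  by rewrite lee_fin; exact: psum_entropy_homo.
have cq : (fun n => (series q n)%:E) @ \oo --> qbar%:E.
  by apply: cvg_EFin; [exact: nearW|exact: free_weight_cvg].
(* The finite constant qbar is subtracted from the increasing sums [psum_entropy], whose limit may
   be +oo. *)
rewrite [X in _ --> (X + _)%E](_ : _ = (limn (fun n => (psum_entropy n x)%:E) - qbar%:E)%E).
  by rewrite subeK.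
apply/cvg_lim => //.
have -> : (fun n => \sum_(0 <= k < n) (x k * (ln (x k / q k) - 1))%:E)%E =
    (fun n => (psum_entropy n x)%:E - (series q n)%:E)%E.
  apply/funext => n; rewrite sumEFin -EFinB; congr (_%:E).
  by rewrite /psum_entropy /entropy_term big_split/= addrK.
by apply: cvgeB => //; rewrite fin_num_adde_defl.
Qed.

Lemma psum_entropy_le x n : ell1_nonneg x ->
  ((psum_entropy n x)%:E <= ideal_rate d beta x)%E.
Proof.
move=> x0; rewrite -(cvg_lim _ (ideal_rate_cvg x0))//.
apply: lime_ge; first by apply: cvgP; exact: ideal_rate_cvg.
exists n => // k /= nk; rewrite lee_fin; exact: psum_entropy_homo.
Qed.

Definition pmf_functional x : \bar R :=
  (beta%:E * pmf_hamiltonian_lsc a m x + ideal_rate d beta x)%E.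

Lemma pmf_functional_oo x : ~ ell1_nonneg x -> pmf_functional x = +oo%E.
Proof.
move=> x0; rewrite /pmf_functional /pmf_hamiltonian_lsc /ideal_rate.
by rewrite memNset// gt0_muley ?lte_fin.
Qed.

Lemma pmf_hamiltonian_lsc_lower x : ell1_nonneg x ->
  ((- (m ^+ 2 / (2 * a)))%:E <= pmf_hamiltonian_lsc a m x)%E.
Proof.
move=> x0; have := particle_density_ge0 x0; case E : (particle_density x) => [D| |] // D0.
  by rewrite (pmf_hamiltonian_lsc_fin m a0 x0 E) lee_fin pmf_profile_lower.
by rewrite (pmf_hamiltonian_lsc_oo m a0 x0 E) leey.
Qed.

Lemma pmf_functional_cvg x : ell1_nonneg x ->
  (beta * pmf_profile a m (psum_density n x) + psum_entropy n x)%:E @[n --> \oo]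
    --> pmf_functional x.
Proof.
move=> x0; under eq_fun do rewrite EFinD EFinM.
have hH : (pmf_profile a m (psum_density n x))%:E @[n --> \oo]
    --> pmf_hamiltonian_lsc a m x.
  have := particle_density_ge0 x0; case E : (particle_density x) => [D| |] // D0.
    rewrite (pmf_hamiltonian_lsc_fin m a0 x0 E).
    apply: cvg_EFin; first exact: nearW.
    apply: continuous_cvg; first exact: pmf_profile_continuous.
    by have := particle_density_cvg x0; rewrite E => /fine_cvgP[].
  rewrite (pmf_hamiltonian_lsc_oo m a0 x0 E); apply/cvgeryP.
  apply: (@pmf_profile_cvgy _ a m a0 (psum_density ^~ x)).
  by apply/cvgeryP; rewrite -E; exact: particle_density_cvg.
apply: cvgeD; last exact: ideal_rate_cvg.
  (* Both summands are bounded below, which excludes +oo - oo. *)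
  apply: ltninfty_adde_def; rewrite inE/=.
    have := pmf_hamiltonian_lsc_lower x0; case: (pmf_hamiltonian_lsc _ _ _) => [r| |] //.
      by move=> _; rewrite -EFinM ltNyr.
    by move=> _; rewrite gt0_muley ?lte_fin.
  by apply: lt_le_trans (psum_entropy_le 0 x0); rewrite ltNyr.
exact: cvgeZl.
Qed.

Lemma pmf_functional_ge x n : ell1_nonneg x ->
  ((beta * pmf_profile a m (psum_density n x) + psum_entropy n x)%:E <= pmf_functional x)%E.
Proof.
move=> x0; rewrite -(cvg_lim _ (pmf_functional_cvg x0))//.
apply: lime_ge; first by apply: cvgP; exact: pmf_functional_cvg.
exists n => // k /= nk; rewrite lee_fin lerD ?psum_entropy_homo// ler_pM2l//.
by apply: pmf_profile_homo => //; exact: psum_density_homo.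
Qed.

Lemma pmf_functional_lower x : ((- (beta * (m ^+ 2 / (2 * a))))%:E <= pmf_functional x)%E.
Proof.
have [x0|/pmf_functional_oo ->] := pselect (ell1_nonneg x); last by rewrite leey.
apply: le_trans (pmf_functional_ge 0 x0); rewrite lee_fin /psum_entropy big_nil addr0.
by rewrite -mulrN ler_pM2l// pmf_profile_lower.
Qed.

Lemma pmf_functional0 : (pmf_functional (0%R : ell1 R) < +oo)%E.
Proof.
have z0 : ell1_nonneg (0 : ell1 R) by move=> k; rewrite lexx.
have zD : particle_density (0 : ell1 R) = 0%:E.
  by rewrite (@particle_density_finite _ _ 0)// /psum_density big_nil.
rewrite /pmf_functional (pmf_hamiltonian_lsc_fin m a0 z0 zD).
have -> : ideal_rate d beta (0 : ell1 R) = qbar%:E.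
  rewrite -(cvg_lim _ (ideal_rate_cvg z0))//; apply/cvg_lim => //.
  rewrite (_ : (fun n => _) = (fun n => (series q n)%:E)).
    by apply: cvg_EFin; [exact: nearW|exact: free_weight_cvg].
  by apply/funext => n; congr (_%:E); apply: eq_bigr => k _; rewrite entropy_term0.
by rewrite -EFinM -EFinD ltry.
Qed.

Definition pmf_minorant n (lam : nat -> R) x : R :=
  beta * pmf_profile a m (psum_density n x) +
  \sum_(0 <= k < n) (lam k * x k - q k * expR (lam k) + q k).

Lemma pmf_minorant_le n lam x : ell1_nonneg x -> ((pmf_minorant n lam x)%:E <= pmf_functional x)%E.
Proof.
move=> x0; apply: le_trans (pmf_functional_ge n x0); rewrite lee_fin lerD2l.
by apply: ler_sum => k _; apply: entropy_term_young => //; exact: x0.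
Qed.

Lemma pmf_minorant_continuous n lam : continuous (pmf_minorant n lam).
Proof.
have c1 : continuous (pmf_profile a m \o @psum_density R n).
  move=> y; apply: continuous_comp; first exact: psum_density_continuous.
  exact: pmf_profile_continuous.
have c2 := @ell1_sum_continuous R lam n.
rewrite (_ : pmf_minorant n lam = (fun x : ell1 R => beta * (pmf_profile a m \o @psum_density R n) x
  + (\sum_(0 <= k < n) lam k * x k + \sum_(0 <= k < n) (- (q k * expR (lam k)) + q k)))).
  apply: (@continuousDl _ (ell1 R)); first exact: (@continuousZl _ (ell1 R)).
  by apply: (@continuousDl _ (ell1 R)) => //; exact: cst_continuous.
apply/funext => x; rewrite /pmf_minorant; congr (_ + _).
by rewrite -big_split/=; apply: eq_bigr => k _; rewrite addrA.
Qed.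

Lemma pmf_minorant_sharp x c : ell1_nonneg x -> (c%:E < pmf_functional x)%E ->
  exists n lam, c < pmf_minorant n lam x.
Proof.
move=> x0 cF.
have [n cn] : exists n, c < beta * pmf_profile a m (psum_density n x) + psum_entropy n x.
  apply: contrapT => /forallNP h; move: cF; rewrite ltNge => /negP; apply.
  rewrite -(cvg_lim _ (pmf_functional_cvg x0))//.
  apply: lime_le; first by apply: cvgP; exact: pmf_functional_cvg.
  by apply: nearW => n; rewrite lee_fin leNgt; apply/negP; exact: h.
(* The gap is cut into n + 1 shares of which n are spent, which keeps the inequality strict, also
   for n = 0. *)
pose e := (beta * pmf_profile a m (psum_density n x) + psum_entropy n x - c) / n.+1%:R.
have e0 : 0 < e by rewrite divr_gt0// subr_gt0.
have hlam k : exists l, entropy_term (q k) (x k) - e < l * x k - q k * expR l + q k.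
  by apply: entropy_term_young_sharp => //; rewrite ltrBlDr ltrDl.
have [lam lamP] := choice hlam.
exists n, lam; rewrite /pmf_minorant.
have : \sum_(0 <= k < n) (entropy_term (q k) (x k) - e) <=
    \sum_(0 <= k < n) (lam k * x k - q k * expR (lam k) + q k).
  by apply: ler_sum => k _; exact: ltW.
rewrite big_split/= sumrN sumr_const_nat subn0 -/(psum_entropy n x).
have : e *+ n < beta * pmf_profile a m (psum_density n x) + psum_entropy n x - c.
  have -> : beta * pmf_profile a m (psum_density n x) + psum_entropy n x - c = e *+ n.+1.
    by rewrite -[RHS]mulr_natr divfK.
  by rewrite mulrS ltrDr.
lra.
Qed.

Lemma pmf_functional_lsc : lower_semicontinuous pmf_functional.
Proof.
move=> x c cF; have [x0|x0] := pselect (ell1_nonneg x).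
  have [n [lam cn]] := pmf_minorant_sharp x0 cF.
  exists [set y | c < pmf_minorant n lam y].
    by apply: (@continuous_near_gt _ (ell1 R)) => //; exact: pmf_minorant_continuous.
  move=> y cy; have [y0|/pmf_functional_oo ->] := pselect (ell1_nonneg y); last exact: ltry.
  by apply: lt_le_trans (pmf_minorant_le n lam y0); rewrite lte_fin; exact: cy.
exists (~` @ell1_nonneg R).
  by apply: open_nbhs_nbhs; split => //; exact/closed_openC/closed_ell1_nonneg.
by move=> y /pmf_functional_oo ->; exact: ltry.
Qed.

(** The filled truncation has density at least m / a, where the Hamiltonian and its regularisation
    agree; the cost is thereby expressed through the original energy at a point that atoms of the
    measure can approach. *)
Lemma pmf_functional_finite_support x L (e : R) : 0 < e -> (pmf_functional x < L%:E)%E ->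
  exists y n, [/\ forall k, (n <= k)%N -> y k = 0, ell1_nonneg y, `|x - y| < e &
    beta * (- m * psum_density n y + a / 2 * psum_density n y ^+ 2)
    + \sum_(0 <= k < n) y k * (ln (y k / q k) - 1) + qbar < L].
Proof.
move=> e0 FL.
have x0 : ell1_nonneg x.
  by apply: contrapT => /pmf_functional_oo xoo; move: FL; rewrite xoo.
have [D xD] : exists D, particle_density x = D%:E.
  have := particle_density_ge0 x0; case E : (particle_density x) => [D| |] // _; first by exists D.
  move: FL; rewrite /pmf_functional (pmf_hamiltonian_lsc_oo m a0 x0 E) gt0_muley ?lte_fin//.
  by have := psum_entropy_le 0 x0; case: ideal_rate.
pose T := Num.max D (m / a).
have D0 : 0 <= D by have := particle_density_ge0 x0; rewrite xD.
have DT : D <= T by rewrite le_max lexx.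
have T0 : 0 <= T by exact: le_trans DT.
pose F := fine (pmf_functional x).
have FE : pmf_functional x = F%:E.
  rewrite /F fineK// fin_numE; have := pmf_functional_lower x; move: FL.
  by case: (pmf_functional x).
have FL' : 0 < L - F by move: FL; rewrite FE lte_fin subr_gt0.
have [A [A0 hA]] := ln_free_weight_le d beta0.
(* In order: the entropy cost of the fill, the bound 1 that makes the logarithm of its mass
   nonpositive, and the tail of q that emptied entries contribute. *)
have hK : \forall K \near \oo, T / K.+1%:R * (A * Num.sqrt K.+1%:R) < (L - F) / 2 /\
    T / K.+1%:R <= 1 /\ qbar - (series q K) < (L - F) / 2.
  have L2 : 0 < (L - F) / 2 by rewrite divr_gt0.
  have harm := @cvg_harmonic R.
  have c1 : (fun K => T * A * Num.sqrt (harmonic K)) @ \oo --> (0 : R).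
    rewrite -[X in _ --> X](mulr0 (T * A)); apply: cvgMr; rewrite -[X in _ --> X]sqrtr0.
    by apply: continuous_cvg => //; exact: sqrt_continuous.
  have c2 : (fun K => T * harmonic K) @ \oo --> (0 : R).
    by rewrite -[X in _ --> X](mulr0 T); exact: cvgMr.
  have c3 : series q @ \oo --> qbar by exact: free_weight_cvg.
  near=> K; split; last split.
  - have -> : T / K.+1%:R * (A * Num.sqrt K.+1%:R) = T * A * Num.sqrt (harmonic K).
      rewrite /harmonic sqrtrV// mulrACA; congr (_ * _).
      rewrite -{1}[K.+1%:R](@sqr_sqrtr R)// expr2 invfM mulfVK//.
    by near: K; apply: (cvgr_lt _ c1).
  - by apply/ltW; near: K; apply: (cvgr_lt _ c2).
  - rewrite ltrBlDr -ltrBlDl; near: K; apply: (cvgr_gt _ c3).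
    by rewrite ltrBlDr ltrDl.
have [n1 hn1] := trunc_fill_close x T e0.
have [n2 _ hn2] := hK.
pose K := maxn n1 n2.
have {hn2}[h1 [h2 h3]] := hn2 K (leq_maxr _ _).
have [y [yt y0 yT xy]] := trunc_fillP K x0 xD DT.
have yK k : (K < k)%N -> y k = 0.
  by move=> Kk; rewrite yt /trunc_fill ltnNge (ltnW Kk)/= gtn_eqF.
exists y, K.+1; split => //.
  by apply: le_lt_trans xy _; exact: (hn1 K (leq_maxl _ _)).
have yd : psum_density K.+1 y = T.
  by have := particle_density_finite yK; rewrite yT => -[].
rewrite yd -(pmf_profile_max a0 (erefl T)).
have -> : \sum_(0 <= k < K.+1) y k * (ln (y k / q k) - 1) = psum_entropy K.+1 y - series q K.+1.
  by rewrite /psum_entropy /entropy_term big_split/= addrK.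
have -> : psum_entropy K.+1 y = psum_entropy K x + entropy_term (q K) (y K).
  rewrite /psum_entropy big_nat_recr//=; congr (_ + _).
  by apply: eq_big_nat => k /andP[_ kK]; rewrite yt /trunc_fill kK.
have hF : beta * pmf_profile a m D + psum_entropy K x <= F.
  rewrite -lee_fin -FE EFinD EFinM /pmf_functional (pmf_hamiltonian_lsc_fin m a0 x0 xD).
  by rewrite leeD2l// psum_entropy_le.
have yK1 : y K <= T / K.+1%:R.
  rewrite yt /trunc_fill ltnn eqxx ler_pM2r ?invr_gt0//.
  by rewrite lerBlDr lerDl psum_density_ge0.
have := entropy_term_small (le_trans yK1 h2) (q0 K) (y0 K).
have : y K * - ln (q K) <= T / K.+1%:R * (A * Num.sqrt K.+1%:R).
  apply: (@le_trans _ _ (y K * (A * Num.sqrt K.+1%:R))).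
    by apply: ler_wpM2l => //; exact: y0.
  by rewrite ler_wpM2r// mulr_ge0// sqrtr_ge0.
have -> : series q K.+1 = series q K + q K by rewrite /series/= big_nat_recr.
move: h1 h3 hF FL'.
move: (T / K.+1%:R * (A * Num.sqrt K.+1%:R)) => u1; move: (y K * - ln (q K)) => u2.
move: (entropy_term _ _) => u3; move: (series q K) => u4; move: (q K) => u5.
move: (psum_entropy K x) (beta * pmf_profile a m D) => u6 u7.
move=> *; lra.
Unshelve. all: by end_near. Qed.

End pmf_rate_function.

(** * Finite volumes *)

Section poisson_counts.
Context {R : realType} {dO} {Om : measurableType dO} (P : probability Om R).
Variables (X : nat -> Om -> nat) (rate : nat -> R).
Hypothesis rate0 : forall k, 0 <= rate k.
Hypothesis rate_cvg : cvgn (series rate).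
Hypothesis PX : independent_poisson P rate X.

Let mX k (A : set nat) : measurable (X k @^-1` A).
Proof.
have [h _ _] := PX; rewrite -[Y in measurable Y]setTI.
exact: h.
Qed.

Definition poisson_mass (r : R) (n : nat) : R := expR (- r) * (r ^+ n / n`!%:R).

Lemma count_prob k n : P (X k @^-1` [set n]) = (poisson_mass (rate k) n)%:E.
Proof.
have [_ _ ->] := PX; rewrite /poisson_prob; case: ifPn => r0.
  by rewrite esum_set1 ?lee_fin ?poisson_pmf_ge0// /poisson_pmf r0 /poisson_mass mulrC.
(* At rate 0 the law is the Dirac mass at 0, in agreement with the formula since 0^0 = 1. *)
have -> : rate k = 0 by apply/eqP; rewrite eq_le rate0 andbT leNgt.
rewrite /poisson_mass oppr0 expR0 mul1r diracE; case: n => [|n].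
  by rewrite mem_set// expr0 fact0 divr1.
by rewrite memNset// expr0n/= mul0r.
Qed.

Lemma counts_prob_psum (n : nat -> nat) M :
  P [set w | forall k, (k < M)%N -> X k w = n k] =
  (\prod_(0 <= k < M) poisson_mass (rate k) (n k))%:E.
Proof.
have [_ ind _] := PX.
have := ind [fset k in iota 0 M]%fset (fun k => [set n k]).
rewrite (_ : \bigcap_(k in _) _ = [set w | forall k, (k < M)%N -> X k w = n k]).
  move=> ->; rewrite (perm_big (iota 0 M))/=; last first.
    by apply: uniq_perm; rewrite ?fset_uniq ?iota_uniq// => k; rewrite !inE.
  rewrite /index_iota subn0 -prodEFin.
  by apply: eq_bigr => k _; rewrite count_prob.
apply/seteqP; split => w /= h k.
  by move=> kM; apply: (h k); rewrite /= !inE mem_iota.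
by rewrite /= !inE mem_iota => kM; apply: h.
Qed.

Definition counts_event (n : nat -> nat) := [set w | forall k, X k w = n k].

Lemma measurable_counts_event n : measurable (counts_event n).
Proof.
have -> : counts_event n = \bigcap_(k in setT) (X k @^-1` [set n k]).
  by apply/seteqP; split => w h k; [move=> _; exact: h|exact: (h k I)].
by apply: bigcap_measurable => // k _; exact: mX.
Qed.

(** Continuity from above along cylinders: every index beyond M contributes a factor e^(- rate k),
    and these accumulate to the exponential of the whole series. *)
Lemma counts_prob (n : nat -> nat) M : (forall k, (M <= k)%N -> n k = 0%N) ->
  P (counts_event n) = (expR (- limn (series rate)) *
    \prod_(0 <= k < M) (rate k ^+ n k / (n k)`!%:R))%:E.
Proof.
move=> nM.
pose F M' := [set w | forall k, (k < M')%N -> X k w = n k].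
have mF M' : measurable (F M').
  have -> : F M' = \bigcap_(k in `I_M') (X k @^-1` [set n k]) by [].
  by apply: bigcap_measurableType => k _; exact: mX.
have FE : counts_event n = \bigcap_M' F M'.
  by apply/seteqP; split => w h; [move=> M' _ k _; exact: h|move=> k; exact: (h k.+1)].
have c1 : P \o F @ \oo --> P (counts_event n).
  rewrite FE; apply: nonincreasing_cvg_mu => //.
  - by rewrite (le_lt_trans (probability_le1 _ _))// ltry.
  - by rewrite -FE; exact: measurable_counts_event.
  - by move=> i j ij; apply/subsetPset => w h k ki; apply: h; exact: leq_trans ij.
have PF M' : (M <= M')%N -> P (F M') = (expR (- series rate M') *
    \prod_(0 <= k < M) (rate k ^+ n k / (n k)`!%:R))%:E.
  move=> MM'; rewrite /F counts_prob_psum; congr (_%:E).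
  rewrite /poisson_mass big_split/= -[in LHS]expR_sum sumrN; congr (_ * _).
  rewrite (big_cat_nat (leq0n M) MM')/= [X in _ * X]big_nat_cond.
  rewrite [X in _ * X]big1 ?mulr1// => k.
  by rewrite andbT => /andP[Mk _]; rewrite nM// expr0 fact0 divr1.
have c2 : P \o F @ \oo --> (expR (- limn (series rate)) *
    \prod_(0 <= k < M) (rate k ^+ n k / (n k)`!%:R))%:E.
  apply: (@cvg_trans _ ((fun M' => (expR (- series rate M') *
    \prod_(0 <= k < M) (rate k ^+ n k / (n k)`!%:R))%:E) @ \oo)).
    by apply: near_eq_cvg; exists M => // M' /= MM'; rewrite PF.
  apply: cvg_EFin; first exact: nearW.
  apply: cvgMl; apply: continuous_cvg; first exact: continuous_expR.
  exact: cvgN.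
exact: (cvg_unique _ c1 c2).
Qed.

Definition counts_infinite := lim_sup_set (fun k => ~` (X k @^-1` [set 0%N])).

Lemma measurable_counts_infinite : measurable counts_infinite.
Proof.
apply: bigcap_measurable => // k _; apply: bigcup_measurable => j _.
exact/measurableC/mX.
Qed.

(** Borel-Cantelli, with P(X_k <> 0) = 1 - e^(- rate k) <= rate k. *)
Lemma counts_infinite_null : P counts_infinite = 0%E.
Proof.
apply: lim_sup_set_cvg0 => [k|]; first exact/measurableC/mX.
apply: (@le_lt_trans _ _ (\sum_(0 <= n <oo) (rate n)%:E)%E); last first.
  rewrite (_ : limn _ = (limn (series rate))%:E) ?ltry//.
  apply/cvg_lim => //; rewrite (_ : (fun n => _) = EFin \o series rate).
    by apply: cvg_EFin; [exact: nearW|].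
  by apply/funext => n; rewrite sumEFin.
apply: lee_nneseries => [k *|k *]; first exact: measure_ge0.
rewrite [leLHS](probability_setC P (mX k [set 0%N])).
rewrite count_prob /poisson_mass expr0 fact0 divr1 mulr1 -EFinB lee_fin.
by have := expR_ge1Dx (- rate k); lra.
Qed.

Lemma counts_finiteP w : ~ counts_infinite w ->
  exists M, forall k, (M <= k)%N -> X k w = 0%N.
Proof.
move=> h; apply: contrapT => /forallNP hM; apply: h => M _.
have /existsNP[k /not_implyP[Mk Xk]] := hM M.
by exists k.
Qed.

(** Configurations whose counts and indices are bounded by M, coded by a finite type so that sums
    over them are finite and distribute over products of coordinates. *)
Definition ffun_counts M (n : {ffun 'I_M.+1 -> 'I_M.+1}) (k : nat) : nat :=
  if (k <= M)%N then nat_of_ord (n (inord k)) else 0%N.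

Definition counts_below M := [set w | forall k, (X k w <= M)%N /\ ((M < k)%N -> X k w = 0%N)].

Lemma counts_belowE M : counts_below M =
  \bigcup_(n in [set: {ffun 'I_M.+1 -> 'I_M.+1}]) counts_event (ffun_counts n).
Proof.
apply/seteqP; split => [w h|w [n _ wn] k].
  exists [ffun i : 'I_M.+1 => inord (X i w)] => // k; rewrite /ffun_counts.
  case: leqP => kM; last by rewrite (h k).2.
  by rewrite ffunE inordK// inordK// ltnS (h k).1.
rewrite wn /ffun_counts; case: leqP => // kM; split => //.
by rewrite -ltnS.
Qed.

Lemma counts_below_homo : {homo counts_below : M N / (M <= N)%N >-> (M <= N)%O}.
Proof.
move=> M N MN; apply/subsetPset => w h k; have [h1 h2] := h k; split.
  exact: leq_trans MN.
by move=> Nk; apply: h2; exact: leq_ltn_trans Nk.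
Qed.

Lemma measurable_counts_below M : measurable (counts_below M).
Proof.
rewrite counts_belowE; apply: fin_bigcup_measurable => // n _.
exact: measurable_counts_event.
Qed.

Lemma counts_below_cover : \bigcup_M counts_below M = ~` counts_infinite.
Proof.
apply/seteqP; split => [w [M _ h] /(_ M.+1 I)[k /= Mk]|w /counts_finiteP[M h]].
  by apply; rewrite (h k).2.
exists (maxn M (\max_(k < M) X k w)) => // k; split.
  have [kM|Mk] := ltnP k M; last by rewrite h.
  apply: leq_trans (leq_maxr _ _); exact: (@leq_bigmax _ (fun k : 'I_M => X k w) (Ordinal kM)).
by rewrite gtn_max => /andP[/ltnW Mk _]; exact: h.
Qed.

Lemma counts_event_disjoint M : trivIset [set: {ffun 'I_M.+1 -> 'I_M.+1}]
  (fun n => counts_event (ffun_counts n)).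
Proof.
move=> n1 n2 _ _ [w [h1 h2]]; apply/ffunP => i; apply/val_inj.
have := h1 i; rewrite h2 /ffun_counts -ltnS ltn_ord inord_val.
exact: esym.
Qed.

Variable vol : R.
Hypothesis vol0 : 0 < vol.

Definition counts_point (n : nat -> nat) : ell1 R :=
  insubd (0 : ell1 R) (fun k => (n k)%:R / vol).

Lemma counts_pointE n M : (forall k, (M <= k)%N -> n k = 0%N) ->
  counts_point n = (fun k => (n k)%:R / vol) :> (nat -> R).
Proof.
move=> nM.
have [x xn _] : exists2 x : ell1 R, x = (fun k => (n k)%:R / vol) :> (nat -> R) &
    `|x| <= \sum_(0 <= k < M) `|(n k)%:R / vol|.
  apply: ell1_bounded => p; have [pM|/ltnW Mp] := leqP p M.
    by rewrite (big_cat_nat (leq0n p) pM)/= lerDl sumr_ge0.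
  rewrite (big_cat_nat (leq0n M) Mp)/= [X in _ + X]sum_nat_eq0 ?addr0// => k /andP[Mk _].
  by rewrite nM// mul0r normr0.
by rewrite /counts_point -xn valKd.
Qed.

(** Infinitely many terms are at least 1 / vol, so the sequence is not summable and [insubd] returns
    its default 0. *)
Lemma counts_point_infinite n : (forall M, exists2 k, (M <= k)%N & n k <> 0%N) ->
  counts_point n = 0.
Proof.
move=> nM; rewrite /counts_point /insubd insubF//; apply/negP; rewrite inE/= => cn.
have := cvg_series_cvg_0 cn => /cvgrPdist_lt/(_ vol^-1).
rewrite invr_gt0 => /(_ vol0)[M _ hM]; have [k /hM/= + nk] := nM M.
rewrite sub0r normrN normr_id normrM [X in _ * X]gtr0_norm ?invr_gt0//.
rewrite -[ltRHS]mul1r ltr_pM2r ?invr_gt0// normr_nat ltrn1.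
by rewrite ltnS leqn0 => /eqP.
Qed.

Lemma empirical_countsE n w : counts_event n w -> empirical_counts vol X w = counts_point n.
Proof.
move=> wn; rewrite /empirical_counts (_ : (fun k => _) = (fun k => (n k)%:R / vol))//.
by apply/funext => k; rewrite wn.
Qed.

(** Off [counts_infinite] the point takes countably many values, each on a measurable event, and on
    [counts_infinite] it is 0; every preimage is a countable union of such pieces. *)
Lemma measurable_empirical_preimage (A : set (ell1 R)) :
  measurable (empirical_counts vol X @^-1` A).
Proof.
set pA := _ @^-1` _.
have -> : pA = (\bigcup_M \bigcup_(n in [set n : {ffun 'I_M.+1 -> 'I_M.+1} |
     A (counts_point (ffun_counts n))]) counts_event (ffun_counts n)) `|`
    (counts_infinite `&` [set w | A 0]).
  apply/seteqP; split => w.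
    move=> Aw; have [wi|wi] := pselect (counts_infinite w).
      right; split => //=; move: Aw; rewrite /pA/= /empirical_counts -/(counts_point (X ^~ w)).
      by rewrite counts_point_infinite// => M; have [k /= Mk Xk] := wi M I; exists k.
    left; have : (\bigcup_M counts_below M) w by rewrite counts_below_cover.
    move=> [M _]; rewrite counts_belowE => -[n _ wn]; exists M => //; exists n => //=.
    by rewrite -(empirical_countsE wn).
  move=> [[M _ [n /= An wn]]|[wi A0]].
    by rewrite /pA/= (empirical_countsE wn).
  rewrite /pA/= /empirical_counts -/(counts_point (X ^~ w)) counts_point_infinite// => M.
  by have [k /= Mk Xk] := wi M I; exists k.
apply: measurableU.
  apply: bigcup_measurable => M _; apply: fin_bigcup_measurable => // n _.
  exact: measurable_counts_event.
have [A0|A0] := pselect (A 0).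
  rewrite (_ : [set w | A 0] = setT) ?setIT; first exact: measurable_counts_infinite.
  by apply/seteqP; split.
rewrite (_ : [set w | A 0] = set0) ?setI0//.
by apply/seteqP; split.
Qed.

Local Notation borel := (g_sigma_algebraType (@open (ell1 R))).

Lemma measurable_empirical_counts :
  measurable_fun setT (empirical_counts vol X : Om -> borel).
Proof. by move=> _ A _; rewrite setTI; exact: measurable_empirical_preimage. Qed.

Local Open Scope ereal_scope.

Lemma counts_law_integral_ge (f : borel -> \bar R) (A : set borel) n M :
  measurable A -> measurable_fun A f -> (forall x, 0 <= f x) ->
  (forall k, (M <= k)%N -> n k = 0%N) -> A (counts_point n) ->
  f (counts_point n) * P (counts_event n) <= \int[counts_law P vol X]_(x in A) f x.
Proof.
move=> mA mf f0 nM An.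
rewrite /counts_law ge0_integral_pushforward//; last exact: measurable_empirical_counts.
have sub : counts_event n `<=` empirical_counts vol X @^-1` A.
  by move=> w wn; rewrite /preimage/= (empirical_countsE wn).
have mg : measurable_fun (empirical_counts vol X @^-1` A) (f \o (empirical_counts vol X)).
  apply: (@measurable_comp _ _ _ _ _ _ A) => //.
    by move=> _ [w Aw <-].
  by apply: measurable_funS measurable_empirical_counts.
rewrite -(integral_cst P (measurable_counts_event n)).
rewrite (_ : \int[P]_(x in counts_event n) cst _ x =
    \int[P]_(x in counts_event n) (f \o empirical_counts vol X) x); last first.
  by apply: eq_integral => w /set_mem wn /=; rewrite (empirical_countsE wn).
apply: ge0_subset_integral => //; first exact: measurable_counts_event.
  exact: measurable_empirical_preimage.
by move=> w _; exact: f0.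
Qed.

Lemma counts_law_integral_ge0 (f : borel -> \bar R) (A : set borel) :
  measurable A -> measurable_fun A f -> (forall x, 0 <= f x) ->
  0 <= \int[counts_law P vol X]_(x in A) f x.
Proof.
move=> mA mf f0; rewrite /counts_law ge0_integral_pushforward//.
  by apply: integral_ge0 => w _; exact: f0.
exact: measurable_empirical_counts.
Qed.

(** The null event is dropped, and monotone convergence along [counts_below] reduces the integral to
    finite sums over disjoint atoms. *)
Lemma counts_law_integral_le (f : borel -> \bar R) (A : set borel) (B : \bar R) :
  measurable A -> measurable_fun A f -> (forall x, 0 <= f x) ->
  (forall M, \sum_(n : {ffun 'I_M.+1 -> 'I_M.+1} | `[< A (counts_point (ffun_counts n)) >])
      f (counts_point (ffun_counts n)) * P (counts_event (ffun_counts n)) <= B) ->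
  \int[counts_law P vol X]_(x in A) f x <= B.
Proof.
move=> mA mf f0 fB.
rewrite /counts_law ge0_integral_pushforward//; last exact: measurable_empirical_counts.
set g := f \o _; set pA := _ @^-1` A.
have mpA : measurable pA by exact: measurable_empirical_preimage.
have mg : measurable_fun pA g.
  apply: (@measurable_comp _ _ _ _ _ _ A) => //; first by move=> _ [w Aw <-].
  by apply: measurable_funS measurable_empirical_counts.
have g0 w : 0 <= g w by exact: f0.
rewrite -(setIT pA) -(setUv counts_infinite) setIUr.
have mi := measurable_counts_infinite.
have msub C : C `<=` pA -> measurable_fun C g by move=> Cp; exact: measurable_funS mg.
rewrite ge0_integral_setU//=; [|exact: measurableI|
  by apply: measurableI => //; exact: measurableC|
  by apply: msub; rewrite -setIUr; exact: subIsetl|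
  by apply/disj_setPS => w /= [[_ wi] [_ +]]; exact].
rewrite null_set_integral ?add0e; last 3 first.
- exact: measurableI.
- by apply: msub; exact: subIsetl.
- by apply: (@subset_measure0 _ _ _ P _ counts_infinite) => //; [exact: measurableI|exact: counts_infinite_null].
rewrite -counts_below_cover setI_bigcupr.
have cvI : (fun M => \int[P]_(w in pA `&` counts_below M) g w) @ \oo -->
    \int[P]_(w in \bigcup_M (pA `&` counts_below M)) g w.
  apply: ge0_nondecreasing_set_cvg_integral => //.
  - move=> M N MN; apply/subsetPset => w [pw bw]; split => //.
  by move/subsetPset : (counts_below_homo MN); exact.
  - by move=> M; apply: measurableI => //; exact: measurable_counts_below.
  - by move=> M; apply: msub; exact: subIsetl.
rewrite -(cvg_lim _ cvI)//; apply: lime_le; first by apply: cvgP; exact: cvI.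
apply: nearW => M; apply: le_trans (fB M).
pose s := [seq n <- enum {: {ffun 'I_M.+1 -> 'I_M.+1}} | `[< A (counts_point (ffun_counts n)) >]].
have -> : pA `&` counts_below M = \big[setU/set0]_(n <- s) counts_event (ffun_counts n).
  rewrite -bigcup_seq counts_belowE; apply/seteqP; split => w.
    move=> [Aw [n _ wn]]; exists n => //=; rewrite mem_filter mem_enum andbT; apply/asboolP.
    by rewrite -(empirical_countsE wn).
  move=> [n /=]; rewrite mem_filter => /andP[/asboolP An _] wn; split; last by exists n.
  by rewrite /pA/= (empirical_countsE wn).
rewrite ge0_integral_bigsetU//=; last 4 first.
- by move=> n; exact: measurable_counts_event.
- by rewrite filter_uniq// enum_uniq.
- move=> n1 n2 _ _; exact: (@counts_event_disjoint M n1 n2 I I).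
- apply: msub; rewrite -bigcup_seq => w [n /=].
  rewrite mem_filter => /andP[/asboolP An _] wn.
  by rewrite /pA/= (empirical_countsE wn).
rewrite big_filter big_enum_cond/=; apply: lee_sum => n _.
rewrite -(integral_cst P (measurable_counts_event _)).
rewrite le_eqVlt; apply/orP; left; apply/eqP; apply: eq_integral => w /set_mem wn.
by rewrite /g/= (empirical_countsE wn).
Qed.

End poisson_counts.

(** * Borel measurability on l1 *)

Section borel_ell1_measurability.
Context {R : realType}.
Local Notation borel := (g_sigma_algebraType (@open (ell1 R))).

Lemma borel_ell1_open (U : set (ell1 R)) : open U -> measurable (U : set borel).
Proof. exact: sub_sigma_algebra. Qed.

Lemma borel_ell1_closed (U : set (ell1 R)) : closed U -> measurable (U : set borel).
Proof.
move=> cU; rewrite -(setCK U); apply: measurableC.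
by apply: borel_ell1_open; rewrite openC.
Qed.

Lemma borel_ell1_continuous (f : ell1 R -> R) : continuous f ->
  measurable_fun setT (f : borel -> R).
Proof.
move=> /continuousP cf; apply: (measurability _ (RGenOpens.measurableE R)).
move=> _ [_ [a [b ->] <-]]; rewrite setTI; apply: borel_ell1_open.
exact/cf/interval_open.
Qed.

Lemma borel_particle_density :
  measurable_fun (@ell1_nonneg R : set borel) (@particle_density R : borel -> \bar R).
Proof.
have -> : (@particle_density R : borel -> \bar R) =
    (fun x : borel => \sum_(0 <= k <oo | k \in xpredT) ((k.+1%:R * (x : ell1 R) k)%:E))%E.
  by apply/funext => x; apply: eq_eseriesl => k; rewrite ?inE.
apply: ge0_emeasurable_sum => [k x x0 _|k _].
  by rewrite lee_fin mulr_ge0//; exact: x0.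
apply: measurable_funTS; apply/measurable_EFinP.
apply: borel_ell1_continuous; apply: (@continuousZl _ (ell1 R)).
exact: ell1_coord_continuous.
Qed.

Lemma borel_pmf_density (c a m : R) : 0 < c ->
  measurable_fun setT (fun x : borel => expeR (- (c%:E * pmf_hamiltonian a m x))%E).
Proof.
move=> c0.
have mn : measurable (@ell1_nonneg R : set borel).
  by apply: borel_ell1_closed; exact: closed_ell1_nonneg.
have mD := borel_particle_density.
(* Spelled out by cases, with a real exponential where the density is finite; elsewhere c > 0 turns
   the infinite Hamiltonian into the value 0. *)
have -> : (fun x : borel => expeR (- (c%:E * pmf_hamiltonian a m x))%E) =
   (fun x => if x \in (@ell1_nonneg R : set borel) then
      (if (particle_density x < +oo)%E then
       (expR (- (c * (- m * fine (particle_density x) + a / 2 * fine (particle_density x) ^+ 2))))%:E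
       else 0%E) else 0%E).
  apply/funext => x; rewrite /pmf_hamiltonian; case: ifPn => [/set_mem x0|x0]; last first.
    by rewrite gt0_muley ?lte_fin.
  have := particle_density_ge0 x0; case: (particle_density x) => [D| |] //= D0.
    by rewrite ltry.
  by rewrite gt0_muley ?lte_fin.
apply: measurable_fun_if => //.
- apply: (measurable_fun_bool true); rewrite setTI.
  rewrite (_ : _ @^-1` _ = (@ell1_nonneg R : set borel))//.
  by apply/seteqP; split => x /=; [move/set_mem|move=> xn; exact: mem_set].
- rewrite setTI (_ : _ @^-1` _ = (@ell1_nonneg R : set borel)); last first.
    by apply/seteqP; split => x /=; [move/set_mem|move=> xn; exact: mem_set].
  apply: measurable_fun_if => //.
  + apply: measurable_fun_lte => //; exact: measurable_cst.
  + apply/measurable_EFinP; apply: measurableT_comp; first exact: measurable_expR.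
    apply: measurableT_comp => //; apply: measurable_funM; first exact: measurable_cst.
    have mf : measurable_fun ((@ell1_nonneg R : set borel) `&`
       (fun x : borel => (particle_density x < +oo)%E) @^-1` [set true])
       (fun x : borel => fine (particle_density x)).
      apply: measurableT_comp; first exact: fine_measurable.
      by apply: measurable_funS mD.
    apply: measurable_funD; first by apply: measurable_funM => //; exact: measurable_cst.
    by apply: measurable_funM; [exact: measurable_cst|exact: measurable_funX].
Qed.

End borel_ell1_measurability.

(** * Atoms of the tilted measure *)

Section finite_volume.
Context {R : realType} {dO} {Om : measurableType dO} (P : probability Om R).
Variables (X : nat -> Om -> nat) (vol : R) (w r : nat -> R) (a beta alpha mu : R).
Hypotheses (vol0 : 0 < vol) (beta0 : 0 < beta) (r0 : forall k, 0 <= r k).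
Hypothesis wr : forall k, w k = expR (beta * alpha * k.+1%:R) * r k.
Hypothesis w_cvg : cvgn (series (fun k => vol * w k)).
Hypothesis PX : independent_poisson P (fun k => vol * w k) X.
Let m := mu + alpha.
Let S := limn (series (fun k => vol * w k)).
Let w0 k : 0 <= vol * w k.
Proof. by rewrite wr !mulr_ge0 ?expR_ge0// ltW. Qed.

Local Notation borel := (g_sigma_algebraType (@open (ell1 R))).

Definition pmf_density (x : borel) : \bar R := expeR (- ((vol * beta)%:E * pmf_hamiltonian a mu x)).

Definition pmf_energy (D : R) : R := - m * D + a / 2 * D ^+ 2.

Lemma pmf_density_ge0 x : (0 <= pmf_density x)%E.
Proof. exact: expeR_ge0. Qed.

Lemma measurable_pmf_density : measurable_fun setT pmf_density.
Proof. by apply: borel_pmf_density; rewrite mulr_gt0. Qed.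

Lemma counts_point_nonneg n M : (forall k, (M <= k)%N -> n k = 0%N) ->
  ell1_nonneg (counts_point vol n).
Proof. by move=> nM k; rewrite (counts_pointE vol nM) divr_ge0// ltW. Qed.

Lemma pmf_atom n M : (forall k, (M <= k)%N -> n k = 0%N) ->
  (pmf_density (counts_point vol n) * P (counts_event X n))%E =
  (expR (- S) * (expR (- (vol * beta * pmf_energy (psum_density M (counts_point vol n)))) *
    \prod_(0 <= k < M) ((vol * r k) ^+ n k / (n k)`!%:R)))%:E.
Proof.
move=> nM; set x := counts_point vol n; set D := psum_density M x.
have xn : x = (fun k => (n k)%:R / vol) :> (nat -> R) by exact: counts_pointE nM.
have xD : particle_density x = D%:E.
  by apply: particle_density_finite => k Mk; rewrite xn nM// mul0r.
rewrite /pmf_density (pmf_hamiltonian_fin a mu (counts_point_nonneg nM) xD).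
rewrite (counts_prob w0 w_cvg PX nM)/= -EFinM; congr (_%:E).
rewrite mulrCA; congr (_ * _).
(* Since n_k is vol times entry k of the point, the tilts of all counts multiply to a function of D
   alone. *)
have -> : \prod_(0 <= k < M) ((vol * w k) ^+ n k / (n k)`!%:R) =
   expR (beta * alpha * vol * D) * \prod_(0 <= k < M) ((vol * r k) ^+ n k / (n k)`!%:R).
  rewrite /D/psum_density mulr_sumr expR_sum -big_split/=; apply: eq_bigr => k _.
  rewrite wr mulrCA exprMn -[LHS]mulrA; congr (_ * _).
  rewrite -expRM_natl xn; congr expR.
  by field; rewrite gt_eqF.
rewrite mulrA -expRD; congr (expR _ * _).
by rewrite /pmf_energy /m; ring.
Qed.

Lemma pmf_integral_ge (A : set borel) n M : measurable A ->
  (forall k, (M <= k)%N -> n k = 0%N) -> A (counts_point vol n) ->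
  ((expR (- S) * (expR (- (vol * beta * pmf_energy (psum_density M (counts_point vol n)))) *
    \prod_(0 <= k < M) ((vol * r k) ^+ n k / (n k)`!%:R)))%:E <=
  \int[counts_law P vol X]_(x in A) pmf_density x)%E.
Proof.
move=> mA nM An; rewrite -(pmf_atom nM).
have mf : measurable_fun A pmf_density by exact: measurable_funTS measurable_pmf_density.
have := @counts_law_integral_ge _ _ _ P X _ PX vol vol0 pmf_density A n M mA mf
  pmf_density_ge0 nM An.
exact.
Qed.

Lemma expR_psum_le (c : R) M : 0 <= c -> \sum_(0 <= j < M) c ^+ j / j`!%:R <= expR c.
Proof.
move=> c0; apply: (@nondecreasing_cvgn_le _ (series (exp_coeff c))).
  by apply: nondecreasing_series => k _ _; rewrite /exp_coeff/= divr_ge0// exprn_ge0.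
exact: is_cvg_series_exp_coeff.
Qed.

(** An atom with the common factor [expR (- S)] removed. *)
Definition atom_weight (n : nat -> nat) M : R :=
  expR (- (vol * beta * pmf_energy (psum_density M (counts_point vol n)))) *
  \prod_(0 <= k < M) ((vol * r k) ^+ n k / (n k)`!%:R).

Lemma atom_weight_ge0 n M : 0 <= atom_weight n M.
Proof.
rewrite mulr_ge0 ?expR_ge0// prodr_ge0// => k _.
by rewrite divr_ge0// exprn_ge0// mulr_ge0// ltW.
Qed.

(** Being a bound on finite sums, uniform in M, it passes to arbitrary subsets and unions;
    [pmf_integral_le] turns it into a bound on integrals. *)
Definition atoms_le (A : set (ell1 R)) (T : R) := forall M,
  \sum_(n : {ffun 'I_M.+1 -> 'I_M.+1} | `[< A (counts_point vol (ffun_counts n)) >])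
    atom_weight (ffun_counts n) M.+1 <= T.

Lemma atoms_le_trans A T T' : T <= T' -> atoms_le A T -> atoms_le A T'.
Proof. by move=> TT' AT M; exact: le_trans TT'. Qed.

Lemma atoms_leS (A B : set (ell1 R)) T : A `<=` B -> atoms_le B T -> atoms_le A T.
Proof.
move=> AB BT M; apply: le_trans (BT M).
rewrite [leLHS]big_mkcond [leRHS]big_mkcond; apply: ler_sum => n _.
case: asboolP => [/AB An|_]; first by rewrite asboolT.
by case: ifP => // _; exact: atom_weight_ge0.
Qed.

Lemma atoms_leU (A B : set (ell1 R)) T T' :
  atoms_le A T -> atoms_le B T' -> atoms_le (A `|` B) (T + T').
Proof.
move=> AT BT M; apply: le_trans (lerD (AT M) (BT M)).
rewrite [leLHS]big_mkcond [X in _ <= X + _]big_mkcond [X in _ <= _ + X]big_mkcond.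
rewrite -big_split/=; apply: ler_sum => n _.
case: asboolP => [h|_]; last by apply: addr_ge0; case: ifP => // _; exact: atom_weight_ge0.
have w1 := atom_weight_ge0 (ffun_counts n) M.+1.
by case: h => h; rewrite (asboolT h) ?lerDl ?lerDr; case: ifP.
Qed.

Lemma pmf_integral_le (A : set borel) T : measurable A -> atoms_le A T ->
  (\int[counts_law P vol X]_(x in A) pmf_density x <= (expR (- S) * T)%:E)%E.
Proof.
move=> mA AT.
have mf : measurable_fun A pmf_density by exact: measurable_funTS measurable_pmf_density.
apply: (@counts_law_integral_le _ _ _ P X _ w0 w_cvg PX vol vol0 pmf_density A _ mA mf
  pmf_density_ge0).
move=> M.
have nM (n : {ffun 'I_M.+1 -> 'I_M.+1}) k : (M.+1 <= k)%N -> ffun_counts n k = 0%N.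
  by move=> Mk; rewrite /ffun_counts leqNgt Mk.
under eq_bigr do rewrite (pmf_atom (nM _)).
by rewrite sumEFin lee_fin -mulr_sumr ler_wpM2l ?expR_ge0//; exact: AT.
Qed.

(* Exponential Chebyshev inequality; summing over all configurations factorises
   into the exponential series of each coordinate. *)
Lemma atoms_le_chebyshev (A : set (ell1 R)) (s : nat -> R) (b B : R) :
  (forall y M, ell1_nonneg y -> (forall k, (M <= k)%N -> y k = 0) -> A y ->
    b <= beta * pmf_energy (psum_density M y) + \sum_(0 <= k < M) s k * y k) ->
  (forall M, \sum_(0 <= k < M) r k * expR (s k) <= B) ->
  atoms_le A (expR (vol * (B - b))).
Proof.
move=> bA rB M.
have nM (n : {ffun 'I_M.+1 -> 'I_M.+1}) k : (M.+1 <= k)%N -> ffun_counts n k = 0%N.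
  by move=> Mk; rewrite /ffun_counts leqNgt Mk.
pose c k := vol * r k * expR (s k).
have c0 k : 0 <= c k by rewrite !mulr_ge0 ?expR_ge0// ltW.
apply: (@le_trans _ _ (\sum_(n : {ffun 'I_M.+1 -> 'I_M.+1})
    expR (- (vol * b)) * \prod_(i < M.+1) (c i ^+ n i / (n i)`!%:R))).
  rewrite [leLHS]big_mkcond/=; apply: ler_sum => n _; case: ifPn => [/asboolP An|_]; last first.
    rewrite mulr_ge0 ?expR_ge0// prodr_ge0// => i _.
    by rewrite divr_ge0// exprn_ge0.
  have -> : \prod_(i < M.+1) (c i ^+ n i / (n i)`!%:R) =
     expR (vol * \sum_(0 <= k < M.+1) s k * counts_point vol (ffun_counts n) k) *
     \prod_(0 <= k < M.+1) ((vol * r k) ^+ ffun_counts n k / (ffun_counts n k)`!%:R).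
    rewrite mulr_sumr expR_sum -big_split/= big_mkord; apply: eq_bigr => i _.
    rewrite /ffun_counts -ltnS ltn_ord inord_val /c exprMn -expRM_natl.
    rewrite (counts_pointE vol (nM n)) /ffun_counts -ltnS ltn_ord inord_val.
    rewrite mulrAC mulrC; congr (_ * _); congr expR.
    by field; rewrite gt_eqF.
  rewrite mulrA -expRD ler_wpM2r//.
    apply: prodr_ge0 => i _.
    by rewrite divr_ge0// exprn_ge0// mulr_ge0// ltW.
  rewrite ler_expR.
  have := bA _ M.+1 (counts_point_nonneg (nM n)).
  have yM k : (M.+1 <= k)%N -> counts_point vol (ffun_counts n) k = 0.
    by move=> Mk; rewrite (counts_pointE vol (nM n)) nM// mul0r.
  move=> /(_ yM An); rewrite -(ler_pM2l vol0); lra.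
rewrite -mulr_sumr -(bigA_distr_bigA (fun i j : 'I_M.+1 => c i ^+ j / j`!%:R))/=.
rewrite mulrBr expRD [leRHS]mulrC ler_wpM2l ?expR_ge0//.
apply: (@le_trans _ _ (\prod_(i < M.+1) expR (c i))).
  apply: ler_prod => i _; apply/andP; split.
    by apply: sumr_ge0 => j _; rewrite divr_ge0// exprn_ge0.
  rewrite -(big_mkord xpredT (fun j => c i ^+ j / j`!%:R)).
  exact: expR_psum_le.
rewrite -expR_sum ler_expR -(big_mkord xpredT c).
rewrite (eq_bigr (fun k => vol * (r k * expR (s k)))) => [|k _]; last by rewrite /c mulrA.
by rewrite -mulr_sumr ler_pM2l.
Qed.

End finite_volume.

(** * Large deviations *)

Section poisson_term_asymptotics.
Context {R : realType}.

(** The induction step is ln ((n + 1) / (n + 2)) <= - 1 / (n + 2), multiplied by n + 2. *)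
Lemma ln_fact_le n : ln n`!%:R <= n.+1%:R * ln n.+1%:R - n%:R :> R.
Proof.
elim: n => [|n IH]; first by rewrite fact0 ln1 mulr0 subr0.
rewrite factS natrM lnM ?posrE ?ltr0n ?fact_gt0//.
apply: le_trans (lerD (lexx _) IH) _.
have h : ln (n.+1%:R / n.+2%:R) <= - n.+2%:R^-1 :> R.
  have -> : n.+1%:R / n.+2%:R = 1 + (- n.+2%:R^-1) :> R.
    by rewrite -[in LHS](addrK 1 n.+1%:R) natr1 mulrDl divff// mulN1r.
  by apply: le_ln1Dx; rewrite ltrNl opprK invf_lt1 ?ltr1n.
rewrite ln_div ?posrE// in h.
move: h; rewrite -(ler_pM2l (ltr0Sn R n.+1)) mulrN divff// mulrBr => h.
rewrite -[n.+2%:R]natr1 -[n.+1%:R]natr1 in h *.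
by rewrite ?natr1 in h *; move: h; rewrite -[n.+2%:R]natr1 -[n.+1%:R]natr1; lra.
Qed.

Variable V : R^nat.
Hypothesis Voo : V @ \oo --> +oo.

Lemma volume_near_gt0 : \forall N \near \oo, 0 < V N.
Proof. by move/cvgryPgt : Voo; exact. Qed.

Lemma cvg_invr_volume : (fun N => (V N)^-1) @ \oo --> (0 : R).
Proof. by apply/gtr0_cvgV0 => //; exact: volume_near_gt0. Qed.

Lemma cvg_ln_volume : (fun N => ln (V N) / V N) @ \oo --> (0 : R).
Proof.
have c : (fun N => 2 * Num.sqrt ((V N)^-1)) @ \oo --> (0 : R).
  rewrite -[X in _ --> X](mulr0 2); apply: cvgMr; rewrite -[X in _ --> X]sqrtr0.
  by apply: continuous_cvg; [exact: sqrt_continuous|exact: cvg_invr_volume].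
apply: (@squeeze_cvgr _ _ _ _ (cst 0) (fun N => 2 * Num.sqrt ((V N)^-1))) => //; last exact: cvg_cst.
near=> N.
have V1 : 1 < V N by near: N; move/cvgryPgt : Voo; exact.
have V0 : 0 < V N by exact: lt_trans V1.
rewrite divr_ge0 ?ln_ge0 ?(ltW V1) ?(ltW V0)//= ler_pdivrMr// sqrtrV ?(ltW V0)//.
apply: le_trans (ln_le_sqrt V0) _; rewrite -mulrA ler_pM2l//.
rewrite -{3}(sqr_sqrtr (ltW V0)) expr2 mulKf// gt_eqF// sqrtr_gt0//.
Unshelve. all: by end_near. Qed.

Variable y : R.
Hypothesis y0 : 0 <= y.

Lemma cvg_truncn_volume : (fun N => (Num.truncn (V N * y))%:R / V N) @ \oo --> y.
Proof.
apply: (@squeeze_cvgr _ _ _ _ (fun N => y - (V N)^-1) (cst y)); last exact: cvg_cst; last first.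
  by rewrite -[X in _ --> X](subr0 y); apply: cvgB; [exact: cvg_cst|exact: cvg_invr_volume].
near=> N; have V0 : 0 < V N by near: N; exact: volume_near_gt0.
have /andP[h1 h2] := @truncn_itv R (V N * y) (mulr_ge0 (ltW V0) y0).
apply/andP; split; last by rewrite ler_pdivrMr// [y * _]mulrC.
by rewrite ler_pdivlMr// mulrBl mulVf ?gt_eqF// [y * _]mulrC lerBlDr natr1 ltW.
Unshelve. all: by end_near. Qed.

Lemma poisson_term_asymptotics (r : R^nat) (q : R) : r @ \oo --> q -> 0 < q ->
  exists2 g : R^nat, g @ \oo --> - (y * (ln (y / q) - 1)) &
    \forall N \near \oo, expR (V N * g N) <=
      (V N * r N) ^+ Num.truncn (V N * y) / (Num.truncn (V N * y))`!%:R.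
Proof.
move=> rq q0; move: (y0); rewrite le_eqVlt => /predU1P[<-|yp].
  (* For y = 0 the count is 0 and the term is 1; the continuity of ln at y, used below, would fail
     here. *)
  exists (cst 0); first by rewrite mul0r oppr0; exact: cvg_cst.
  by apply: nearW => N; rewrite !mulr0 expR0 truncn0 expr0 fact0 divr1.
pose n N := Num.truncn (V N * y).
pose v N := (n N)%:R / V N + (V N)^-1.
have cn := cvg_truncn_volume; rewrite -/(n _) in cn.
have cv : v @ \oo --> y.
  by rewrite -[X in _ --> X](addr0 y); apply: cvgD => //; exact: cvg_invr_volume.
(* This is 1 / V times the logarithm of (V r)^n divided by (n + 1)^(n + 1) e^(- n). Written with n /
   V and v = (n + 1) / V, the powers of V cancel up to (ln V) / V. *)
exists (fun N => (n N)%:R / V N * ln (r N) - v N * ln (v N) + (n N)%:R / V N - ln (V N) / V N).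
  have -> : - (y * (ln (y / q) - 1)) = y * ln q - y * ln y + y - 0.
    by rewrite ln_div ?posrE//; ring.
  apply: cvgB; last exact: cvg_ln_volume.
  apply: cvgD => //; apply: cvgB; apply: cvgM => //.
    by apply: continuous_cvg => //; exact: continuous_ln.
  by apply: continuous_cvg => //; exact: continuous_ln.
near=> N.
have V0 : 0 < V N by near: N; exact: volume_near_gt0.
have rN : 0 < r N by near: N; exact: (cvgr_gt _ rq).
have nN : 0 < (n N).+1%:R :> R by [].
have vE : v N = (n N).+1%:R / V N by rewrite /v -natr1 mulrDl mul1r.
have -> : (V N * r N) ^+ Num.truncn (V N * y) / (Num.truncn (V N * y))`!%:R =
    expR ((n N)%:R * ln (V N * r N) - ln (n N)`!%:R).
  rewrite expRB lnK ?posrE ?ltr0n ?fact_gt0// expRM_natl lnK ?posrE ?mulr_gt0//.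
rewrite ler_expR.
have := ln_fact_le (n N).
suff -> : V N * ((n N)%:R / V N * ln (r N) - v N * ln (v N) + (n N)%:R / V N - ln (V N) / V N) =
  (n N)%:R * ln (V N * r N) - ((n N).+1%:R * ln (n N).+1%:R - (n N)%:R) by lra.
rewrite vE ln_div ?posrE// lnM ?posrE// -natr1.
by field; rewrite gt_eqF.
Unshelve. all: by end_near. Qed.

End poisson_term_asymptotics.

Section ereal_real_bounds.
Context {R : realType}.
Implicit Types x z : \bar R.
Local Open Scope ereal_scope.

Lemma ereal_le_real x z : (forall t : R, z < t%:E -> x <= t%:E) -> x <= z.
Proof.
move=> h; case: z h => [r| |] h; last 2 first.
- exact: leey.
- case: x h => [s| |] // h.
    have /h : -oo < (s - 1)%:E :> \bar R by rewrite ltNyr.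
    by rewrite lee_fin => ?; exfalso; lra.
  have /h : -oo < 0%:E :> \bar R by rewrite ltNyr.
  by [].
by apply/lee_addgt0Pr => e e0; rewrite -EFinD; apply: h; rewrite lte_fin ltrDl.
Qed.

Lemma ereal_ge_real x z : (forall t : R, t%:E < z -> t%:E <= x) -> z <= x.
Proof.
move=> h; rewrite -leeN2; apply: ereal_le_real => t xt.
by rewrite leeNl -EFinN; apply: h; rewrite EFinN lteNl.
Qed.

Lemma ereal_lt_real_between x (t : R) : x < t%:E -> exists2 t' : R, (t' < t)%R & x < t'%:E.
Proof.
move=> xt; case: x xt => [r| |] // => [rt|_].
  by exists ((r + t) / 2)%R; move: rt; rewrite ?lte_fin; lra.
by exists (t - 1)%R; [lra|exact: ltNyr].
Qed.

Lemma limn_esup_near_le (u : (\bar R)^nat) z :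
  (\forall N \near \oo, u N <= z) -> limn_esup u <= z.
Proof.
move=> uz; rewrite /limn_esup limf_esupE; apply: ge_ereal_inf.
exists (ereal_sup [set u N | N in [set N | u N <= z]]); first by exists [set N | u N <= z].
by apply: ge_ereal_sup => _ [N /= Nz <-].
Qed.

Lemma limn_einf_near_ge (u : (\bar R)^nat) z :
  (\forall N \near \oo, z <= u N) -> z <= limn_einf u.
Proof.
move=> uz; rewrite /limn_einf /limf_einf leeNr; apply: limn_esup_near_le.
by apply: filterS uz => N; rewrite leeN2.
Qed.

Lemma lne_div_le (x y : \bar R) (u z : R) : 0 <= x -> (0 < z)%R -> (0 < u)%R ->
  x <= u%:E -> z%:E <= y -> lne (x / y) <= (ln (u / z))%:E.
Proof.
move=> x0 z0 u0 xu zy.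
have y0 : 0 <= y by apply: le_trans zy; rewrite lee_fin ltW.
have h : x / y <= (u / z)%:E.
  rewrite EFinM; apply: lee_pmul => //; first by rewrite inve_ge0.
  have -> : (z^-1)%:E = z%:E^-1 by rewrite inver gt_eqF.
  by rewrite lee_pV2// inE/= lee_fin ltW.
have -> : (ln (u / z))%:E = lne (u / z)%:E by rewrite /= leNgt divr_gt0.
by rewrite lee_lne// in_itv/= leey andbT ?mule_ge0 ?inve_ge0// lee_fin divr_ge0 ?ltW.
Qed.

Lemma lne_div_ge (x y : \bar R) (u z : R) : 0 <= y -> (0 < z)%R -> (0 < u)%R ->
  u%:E <= x -> y <= z%:E -> (ln (u / z))%:E <= lne (x / y).
Proof.
move=> y0 z0 u0 ux yz.
have x0 : 0 <= x by apply: le_trans ux; rewrite lee_fin ltW.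
have h : (u / z)%:E <= x / y.
  rewrite EFinM; apply: lee_pmul => //; [by rewrite lee_fin ltW|by rewrite lee_fin invr_ge0 ltW|].
  have -> : (z^-1)%:E = z%:E^-1 by rewrite inver gt_eqF.
  by rewrite lee_pV2// inE/= lee_fin ltW.
have -> : (ln (u / z))%:E = lne (u / z)%:E by rewrite /= leNgt divr_gt0.
by rewrite lee_lne// in_itv/= leey andbT ?mule_ge0 ?inve_ge0// lee_fin divr_ge0 ?ltW.
Qed.

End ereal_real_bounds.

(** * Upper bound, lower bound and the large deviation principle *)

Section pmf_large_deviations.
Context {R : realType}.
Variables (d : nat) (beta a alpha mu : R).
Hypotheses (d0 : (0 < d)%N) (beta0 : 0 < beta) (a0 : 0 < a) (alpha0 : alpha <= 0).
Variables (dO : nat -> measure_display) (Om : forall N, measurableType (dO N))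
  (P : forall N, probability (Om N) R) (X : forall N, nat -> Om N -> nat).
Variables (r w : nat -> nat -> R) (C : R^nat).
Let q := free_weight d beta (0 : R).
Let q0 k : 0 < q k := free_weight_gt0 d beta0 k.
Let qbar : R := limn (series q).
Let V N : R := cube_volume R d N.
Let m := mu + alpha.
Hypothesis r0 : forall N k, 0 <= r N k.
Hypothesis wr : forall N k, w N k = expR (beta * alpha * k.+1%:R) * r N k.
Hypothesis rC : forall N k, (0 < N)%N -> r N k <= C N * q k.
Hypothesis C1 : C @ \oo --> (1 : R).
Hypothesis rq : forall k, r ^~ k @ \oo --> q k.
Hypothesis PX : forall N, (0 < N)%N -> independent_poisson (P N) (fun k => V N * w N k) (@X N).
Local Notation borel := (g_sigma_algebraType (@open (ell1 R))).
Local Notation F := (pmf_functional d a beta m).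

Let V0 N : (0 < N)%N -> 0 < V N.
Proof. by move=> N0; rewrite /V/cube_volume exprn_gt0// mulr_gt0// ltr0n. Qed.

Lemma cube_volume_cvgy : V @ \oo --> +oo.
Proof.
apply/cvgryPge => A; near=> N.
have N1 : (1 <= N)%N by near: N; exists 1%N.
apply: (@le_trans _ _ N%:R); first by near: N; exact: nbhs_infty_ger.
rewrite /V/cube_volume; case: d d0 => // d' _.
apply: (@le_trans _ _ (2 * N%:R)); first by rewrite ler_peMl// ler1n.
by rewrite exprS ler_peMr ?mulr_ge0// exprn_ege1// -natrM ler1n muln_gt0.
Unshelve. all: by end_near. Qed.

Let C0 N : (0 < N)%N -> 0 <= C N.
Proof.
move=> N0; have := le_trans (r0 N 0) (rC 0 N0).
by rewrite pmulr_lge0.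
Qed.

(** As alpha <= 0, the tilt is at most 1 and the intensities inherit the summability of q. *)
Let w_cvg N : (0 < N)%N -> cvgn (series (fun k => V N * w N k)).
Proof.
move=> N0; apply: (@series_le_cvg _ _ (fun k => V N * C N * q k)).
- by move=> k; rewrite wr !mulr_ge0 ?expR_ge0 ?(ltW (V0 N0)).
- move=> k; apply: mulr_ge0; last exact/ltW/q0.
  by apply: mulr_ge0; [exact/ltW/V0|exact: C0].
- move=> k; rewrite -mulrA ler_pM2l ?V0// wr.
  apply: le_trans (rC k N0); rewrite ler_piMl// -expR0 ler_expR.
  by rewrite -mulrA mulr_ge0_le0 ?(ltW beta0)// mulr_le0_ge0.
- have -> : series (fun k => V N * C N * q k) = (fun n => V N * C N * series q n).
    by apply/funext => n; rewrite /series/= mulr_sumr.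
  by apply: is_cvgMr; exact: free_weight_cvg.
Qed.

Definition pmf_mass N (A : set borel) : \bar R :=
  \int[counts_law (P N) (V N) (@X N)]_(x in A) pmf_density (V N) a beta mu x.

Definition pmf_atoms_le N (A : set (ell1 R)) T := atoms_le (V N) (r N) a beta alpha mu A T.

Let Z N := expR (- limn (series (fun k => V N * w N k))).

Lemma pmf_mass_le N (A : set borel) T : (0 < N)%N -> measurable A -> pmf_atoms_le N A T ->
  (pmf_mass N A <= (Z N * T)%:E)%E.
Proof.
move=> N0 mA AT.
exact: (@pmf_integral_le _ _ _ (P N) (@X N) (V N) (w N) (r N) a beta alpha mu
  (V0 N0) beta0 (r0 N) (wr N) (w_cvg N0) (PX N0) A T mA AT).
Qed.

(* The exponential rate carried by an atom bound when all weights r N k are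
   eventually at most (1 + epsilon) q k. *)
Lemma near_atoms_le (A : set (ell1 R)) (s : nat -> R) (b B c : R) :
  (forall y M, ell1_nonneg y -> (forall k, (M <= k)%N -> y k = 0) -> A y ->
    b <= beta * pmf_energy a alpha mu (psum_density M y) + \sum_(0 <= k < M) s k * y k) ->
  (forall M, \sum_(0 <= k < M) q k * expR (s k) <= B) -> B - b < qbar - c ->
  \forall N \near \oo, pmf_atoms_le N A (expR (V N * (qbar - c))).
Proof.
move=> bA qB Bbc; near=> N.
have N0 : (0 < N)%N by near: N; exists 1%N.
apply: (@atoms_le_trans _ _ _ _ _ _ _ _ (expR (V N * (C N * B - b)))).
  rewrite ler_expR ler_pM2l ?V0//; apply: ltW; near: N.
  have cB : (fun N => C N * B - b) @ \oo --> (1 * B - b : R).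
    by apply: cvgB; [exact: cvgMl|exact: cvg_cst].
  by apply: (cvgr_lt _ cB); rewrite mul1r.
apply: (atoms_le_chebyshev (V0 N0) (r0 N) bA) => M.
apply: le_trans (ler_wpM2l (C0 N0) (qB M)).
by rewrite mulr_sumr; apply: ler_sum => k _; rewrite mulrA ler_wpM2r ?expR_ge0 ?rC.
Unshelve. all: by end_near. Qed.

Lemma sum_nat_widen (u : nat -> R) n p : (n <= p)%N -> (forall k, (n <= k)%N -> u k = 0) ->
  \sum_(0 <= k < p) u k = \sum_(0 <= k < n) u k.
Proof.
move=> np un; rewrite (big_cat_nat (leq0n n) np)/= [X in _ + X]sum_nat_eq0 ?addr0//.
by move=> k /andP[nk _]; exact: un.
Qed.

Lemma pmf_energy_ge (y : ell1 R) n M : ell1_nonneg y -> (forall k, (M <= k)%N -> y k = 0) ->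
  pmf_profile a m (psum_density n y) <= pmf_energy a alpha mu (psum_density M y).
Proof.
move=> y0 yM; have := @pmf_profile_le_hamiltonian R a m y n a0 y0.
by rewrite (pmf_hamiltonian_fin _ _ y0 (particle_density_finite yM)) lee_fin.
Qed.

(** A minorant that is large at x is large on an open set. Its slopes lambda_k serve as exponents in
    the Chebyshev bound, continued by 0 beyond n, where the weights contribute just the tail of
    q. *)
Lemma local_upper_bound (x : ell1 R) (c : R) : (c%:E < F x)%E ->
  exists U : set (ell1 R), [/\ open U, U x &
    \forall N \near \oo, pmf_atoms_le N U (expR (V N * (qbar - c)))].
Proof.
move=> cF; have [x0|x0] := pselect (ell1_nonneg x); last first.
  exists (~` @ell1_nonneg R); split => //; first exact/closed_openC/closed_ell1_nonneg.
  (* No atom lies off [ell1_nonneg], so b is at our disposal; c + 1 gives the strict inequality. *)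
  apply: (@near_atoms_le _ (cst 0) (c + 1) qbar); last by lra.
    by move=> y M y0 _ /(_ y0).
  move=> M; under eq_bigr do rewrite expR0 mulr1; exact: free_weight_psum_le.
(* The room between c and c' absorbs the factor C N, which is only close to 1. *)
have [c' cc' cF'] : exists2 c', c < c' & (c'%:E < F x)%E.
  have [n [lam h]] := pmf_minorant_sharp d0 beta0 a0 x0 cF.
  exists ((c + pmf_minorant d a beta m n lam x) / 2); first by lra.
  apply: lt_le_trans (pmf_minorant_le m d0 beta0 a0 n lam x0).
  by rewrite lte_fin; lra.
have [n [lam h]] := pmf_minorant_sharp d0 beta0 a0 x0 cF'.
pose U := [set y | c' < pmf_minorant d a beta m n lam y].
exists U; split => //.
  rewrite openE => y Uy; apply: (@continuous_near_gt _ (ell1 R)) => //.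
  exact: pmf_minorant_continuous.
pose s k := if (k < n)%N then lam k else 0.
pose E := \sum_(0 <= k < n) q k * expR (lam k).
apply: (@near_atoms_le _ s (c' + E - series q n) (E + (qbar - series q n))); last by lra.
  move=> y M y0 yM; rewrite /U/= /pmf_minorant => cy.
  have -> : \sum_(0 <= k < M) s k * y k = \sum_(0 <= k < n) lam k * y k.
    rewrite -(@sum_nat_widen _ M (n + M)) ?leq_addl//; last by move=> k /yM ->; rewrite mulr0.
    rewrite (@sum_nat_widen _ n) ?leq_addr//; last by move=> k nk; rewrite /s ltnNge nk mul0r.
    by apply: eq_big_nat => k /andP[_ kn]; rewrite /s kn.
  have := pmf_energy_ge n y0 yM; rewrite -(ler_pM2l beta0).
  move: cy; rewrite big_split/= big_split/= sumrN -/E.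
  rewrite (_ : series q n = \sum_(0 <= i < n) free_weight d beta 0 i)//.
  lra.
move=> M; apply: (@le_trans _ _ (\sum_(0 <= k < n + M) q k * expR (s k))).
  by rewrite [leRHS](@big_cat_nat _ _ _ M)//= ?leq_addl// lerDl sumr_ge0// => k _;
     rewrite mulr_ge0 ?expR_ge0 ?ltW.
rewrite (@big_cat_nat _ _ _ n)//= ?leq_addr//; apply: lerD.
  by rewrite le_eqVlt; apply/orP; left; apply/eqP/eq_big_nat => k /andP[_ kn]; rewrite /s kn.
rewrite lerBrDl; apply: le_trans (free_weight_psum_le d0 beta0 (n + M)).
rewrite [leRHS](@big_cat_nat _ _ _ n)//= ?leq_addr// lerD2l.
rewrite le_eqVlt; apply/orP; left; apply/eqP/eq_big_nat => k /andP[nk _].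
by rewrite /s ltnNge nk/= expR0 mulr1.
Qed.

Lemma exponential_tightness (c : R) : exists K : set (ell1 R), [/\ compact K, closed K &
  \forall N \near \oo, pmf_atoms_le N (~` K) (expR (V N * (qbar - c)))].
Proof.
have [theta [th0 thoo [B qB]]] := free_weight_tilt d0 beta0.
(* Chosen so that B - b = qbar - c - 1 for b = T - beta m^2 / (2 a), the value of b passed to
   [near_atoms_le]. *)
pose T := B + beta * (m ^+ 2 / (2 * a)) - qbar + c + 1.
pose K := [set x : ell1 R | ell1_nonneg x /\ forall n, \sum_(0 <= k < n) theta k * x k <= T].
exists K; split.
- exact: ell1_compact.
- rewrite (_ : K = @ell1_nonneg R `&` \bigcap_(n in setT)
     ((fun x : ell1 R => \sum_(0 <= k < n) theta k * x k) @^-1` [set t | t <= T])).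
    apply: closedI; first exact: closed_ell1_nonneg.
    apply: closed_bigI => n _; apply: closed_comp; last exact: closed_le.
    by move=> x _; exact: ell1_sum_continuous.
  by apply/seteqP; split => x [x0 xT]; split => // n; [move=> _; exact: xT|exact: (xT n I)].
apply: (@near_atoms_le _ theta (T - beta * (m ^+ 2 / (2 * a))) B) => //; last by rewrite /T; lra.
move=> y M y0 yM /not_andP[//|/existsNP[n /negP]]; rewrite -ltNge => Ty.
have h1 : \sum_(0 <= k < n) theta k * y k <= \sum_(0 <= k < M) theta k * y k.
  rewrite -(@sum_nat_widen _ M (n + M)) ?leq_addl//; last by move=> k /yM ->; rewrite mulr0.
  rewrite [leRHS](@big_cat_nat _ _ _ n)//= ?leq_addr// lerDl sumr_ge0// => k _.
  by rewrite mulr_ge0 ?(ltW (th0 k)).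
have h2' : - (m ^+ 2 / (2 * a)) <= pmf_energy a alpha mu (psum_density M y).
  by apply: le_trans (pmf_energy_ge 0 y0 yM); exact: pmf_profile_lower.
move: h2'; rewrite -(ler_pM2l beta0); lra.
Qed.

(** Compactness leaves finitely many local bounds besides the tightness bound off K; their number is
    absorbed by the slack c - c', since V tends to infinity. *)
Lemma closed_upper_bound (A : set (ell1 R)) (c c' : R) : closed A -> c' < c ->
  (forall x, A x -> (c%:E < F x)%E) ->
  \forall N \near \oo, (pmf_mass N A <= (Z N * expR (V N * (qbar - c')))%:E)%E.
Proof.
move=> cA cc' AF.
have [K [Kc Kcl KN]] := exponential_tightness c.
have AKc : compact (K `&` A) by exact: compact_closedI.
have /choice[U UP] : forall x : ell1 R, exists U : set (ell1 R), A x -> [/\ open U, U x &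
    \forall N \near \oo, pmf_atoms_le N U (expR (V N * (qbar - c)))].
  move=> x; have [Ax|nAx] := pselect (A x); last by exists setT.
  by have [U UP] := local_upper_bound (AF x Ax); exists U.
rewrite compact_cover in AKc.
have [D DA AD] : finite_subset_cover (K `&` A) U (K `&` A).
  apply: AKc => [x [_ Ax]|x [Kx Ax]]; first by have [] := UP x Ax.
  by exists x => //; have [] := UP x Ax.
have DN : \forall N \near \oo, pmf_atoms_le N (\bigcup_(x in [set` D]) U x)
    ((size D)%:R * expR (V N * (qbar - c))).
  rewrite bigcup_seq.
  have : forall x, x \in enum_fset D -> A x by move=> x /DA; rewrite inE => -[].
  elim: (enum_fset D) => [|x s IH] sA.
    apply: nearW => N M; rewrite big_nil mul0r big_pred0// => n.
    by apply/asboolP.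
  have Ax : A x by apply: sA; rewrite inE eqxx.
  have [_ _ h] := UP x Ax.
  near=> N; rewrite big_cons/= -natr1 mulrDl mul1r addrC.
  have N0 : (0 < N)%N by near: N; exists 1%N.
  apply: (atoms_leU (V0 N0) (r0 N)); first by near: N.
  by near: N; apply: IH => y ys; apply: sA; rewrite inE ys orbT.
near=> N.
have N0 : (0 < N)%N by near: N; exists 1%N.
apply: pmf_mass_le => //.
  exact: borel_ell1_closed.
apply: (@atoms_leS _ _ _ _ _ _ _ (V0 N0) (r0 N) _ (\bigcup_(x in [set` D]) U x `|` ~` K)).
  by move=> x Ax; have [Kx|] := pselect (K x); [left; exact: AD|right].
apply: (@atoms_le_trans _ _ _ _ _ _ _ _ ((size D)%:R * expR (V N * (qbar - c)) + expR (V N * (qbar - c)))).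
  rewrite -[X in _ + X]mul1r -mulrDl natr1.
  have -> : V N * (qbar - c') = V N * (c - c') + V N * (qbar - c) by ring.
  rewrite expRD ler_pM2r ?expR_gt0//.
  apply: le_trans (expR_ge1Dx _); rewrite -lerBlDl -ler_pdivrMr ?subr_gt0//.
  by near: N; move/cvgryPge : cube_volume_cvgy; exact.
by apply: (atoms_leU (V0 N0) (r0 N)); near: N.
Unshelve. all: by end_near. Qed.

(** The counts are V y rounded down, for a finitely supported y near x; half of the radius e pays
    for y, half for the rounding. Finite support makes every limit one over finitely many
    coordinates. *)
Lemma open_lower_bound (O : set (ell1 R)) (x : ell1 R) (c : R) : open O -> O x ->
  (F x < c%:E)%E ->
  \forall N \near \oo, ((Z N * expR (V N * (qbar - c)))%:E <= pmf_mass N O)%E.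
Proof.
move=> oO Ox Fc.
have [e e0 eO] : exists2 e : R, 0 < e & forall y : ell1 R, `|x - y| < e -> O y.
  by apply: (@nbhs_normP _ (ell1 R)); apply: open_nbhs_nbhs.
have e2 : 0 < e / 2 by lra.
have [y [n0 [yn y0 xy Ly]]] := pmf_functional_finite_support d0 beta0 a0 e2 Fc.
pose nN N k := Num.truncn (V N * y k).
have nN0 N k : (n0 <= k)%N -> nN N k = 0%N.
  by move=> nk; rewrite /nN yn// mulr0 truncn0.
have /choice[g gP] : forall k, exists g : R^nat, g @ \oo --> - (y k * (ln (y k / q k) - 1)) /\
    \forall N \near \oo, expR (V N * g N) <= (V N * r N k) ^+ nN N k / (nN N k)`!%:R.
  move=> k; have [g g1 g2] := poisson_term_asymptotics cube_volume_cvgy (y0 k) (@rq k) (q0 k).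
  by exists g.
have xc k : (fun N => counts_point (V N) (nN N) k : R) @ \oo --> (y k : R).
  under eq_fun do rewrite (counts_pointE _ (nN0 _)).
  exact: cvg_truncn_volume cube_volume_cvgy _ (y0 k).
have Dc : (fun N => psum_density n0 (counts_point (V N) (nN N))) @ \oo --> psum_density n0 y.
  by apply: cvg_sumr => k; apply: cvgMr; exact: xc.
have yx : \forall N \near \oo, `|y - counts_point (V N) (nN N)| < e / 2.
  have h : (fun N => \sum_(0 <= k < n0) `|y k - counts_point (V N) (nN N) k| : R) @ \oo -->
      (\sum_(0 <= k < n0) `|y k - y k| : R).
    by apply: cvg_sumr => k; apply: cvg_norm; apply: cvgB; [exact: cvg_cst|exact: xc].
  move: h; rewrite [X in _ --> X]big1 => [|k _]; last by rewrite subrr normr0.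
  move=> h.
  have hN : \forall N \near \oo, \sum_(0 <= k < n0) `|y k - counts_point (V N) (nN N) k| < e / 2.
    exact: (cvgr_lt _ h).
  apply: filterS hN => N; apply: le_lt_trans.
  apply: ell1_norm_le => p.
  apply: (@le_trans _ _ (\sum_(0 <= k < n0 + p) `|y k - counts_point (V N) (nN N) k|)).
    by rewrite [leRHS](@big_cat_nat _ _ _ p)//= ?leq_addl// lerDl sumr_ge0.
  rewrite (@sum_nat_widen _ n0) ?leq_addr// => k nk.
  by rewrite (counts_pointE _ (nN0 _)) nN0// yn// mul0r subrr normr0.
have Ec : (fun N => - (beta * pmf_energy a alpha mu (psum_density n0 (counts_point (V N) (nN N))))
     + \sum_(0 <= k < n0) g k N) @ \oo -->
   - (beta * pmf_energy a alpha mu (psum_density n0 y)) +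
   \sum_(0 <= k < n0) - (y k * (ln (y k / q k) - 1)).
  apply: cvgD; last by apply: cvg_sumr => k; have [] := gP k.
  apply: cvgN; apply: cvgMr; rewrite /pmf_energy; apply: cvgD; first exact: cvgMr.
  apply: cvgMr; rewrite expr2; under eq_fun do rewrite expr2; exact: cvgM.
have gN : \forall N \near \oo, forall i : 'I_n0,
    expR (V N * g i N) <= (V N * r N i) ^+ nN N i / (nN N i)`!%:R.
  by apply: filter_forall => i; have [] := gP i.
near=> N.
have N0 : (0 < N)%N by near: N; exists 1%N.
have ON : O (counts_point (V N) (nN N)).
  apply: eO; rewrite -(subrK y x) -addrA; apply: le_lt_trans (ler_normD _ _) _.
  by rewrite [e]splitr ltrD//; near: N.
apply: le_trans (@pmf_integral_ge _ _ _ (P N) (@X N) (V N) (w N) (r N) a beta alpha mu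
  (V0 N0) beta0 (r0 N) (wr N) (w_cvg N0) (PX N0) O (nN N) n0 (borel_ell1_open oO) (nN0 N) ON).
rewrite lee_fin ler_wpM2l ?expR_ge0//.
apply: (@le_trans _ _ (expR (V N * (- (beta * pmf_energy a alpha mu
    (psum_density n0 (counts_point (V N) (nN N)))) + \sum_(0 <= k < n0) g k N)))).
  rewrite ler_expR ler_pM2l ?V0//; apply: ltW; near: N; apply: (cvgr_gt _ Ec).
  have : beta * pmf_energy a alpha mu (psum_density n0 y) +
      \sum_(0 <= k < n0) y k * (ln (y k / q k) - 1) + qbar < c by exact: Ly.
  by rewrite sumrN; lra.
rewrite mulrDr expRD mulrN mulrA ler_wpM2l ?expR_ge0//.
rewrite mulr_sumr expR_sum !big_mkord; apply: ler_prod => i _.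
rewrite expR_ge0/=; move: i; near: N; exact: gN.
Unshelve. all: by end_near. Qed.

Lemma pmf_mass_ge0 N A : (0 < N)%N -> measurable A -> (0 <= pmf_mass N A)%E.
Proof.
move=> N0 mA; apply: (counts_law_integral_ge0 (PX N0) (V0 N0) mA); last exact: pmf_density_ge0.
by apply: measurable_funTS; exact: (measurable_pmf_density _ _ (V0 N0) beta0).
Qed.

Lemma pmf_functional_inf : exists g : R, ereal_inf (range F) = g%:E.
Proof.
have h1 : ((- (beta * (m ^+ 2 / (2 * a))))%:E <= ereal_inf (range F))%E.
  by apply: le_ereal_inf_tmp => _ [x _ <-]; exact: pmf_functional_lower.
have h2 : (ereal_inf (range F) < +oo)%E.
  apply: le_lt_trans (pmf_functional0 m d0 beta0 a0); apply: ereal_inf_lbound.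
  by exists (0 : ell1 R).
by move: h1 h2; case: ereal_inf => [g| |] //; exists g.
Qed.

Lemma pmf_large_deviation_principle : large_deviation_principle V
  (fun N => pmf_measure a mu beta (V N) (counts_law (P N) (V N) (@X N)))
  (pmf_rate d a beta m).
Proof.
have [g gE] := pmf_functional_inf.
have rateE x : pmf_rate d a beta m x = (F x - g%:E)%E by rewrite -gE.
have gF x : (g%:E <= F x)%E by rewrite -gE; apply: ereal_inf_lbound; exists x.
(* Both bounds applied to the whole space: the normalising constant has exponent qbar - g. *)
have massT (e : R) : 0 < e -> \forall N \near \oo,
    ((Z N * expR (V N * (qbar - (g + e))))%:E <= pmf_mass N setT)%E /\
    (pmf_mass N setT <= (Z N * expR (V N * (qbar - (g - e))))%:E)%E.
  move=> e0.
  have [_ [x _ <-] xg] : exists2 y, range F y & (y < (g + e)%:E)%E.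
    by apply: ereal_inf_lt; rewrite gE lte_fin ltrDl.
  have h1 := open_lower_bound openT I xg.
  have h2 : \forall N \near \oo, (pmf_mass N setT <= (Z N * expR (V N * (qbar - (g - e))))%:E)%E.
    apply: (@closed_upper_bound setT (g - e / 2)); [exact: closedT|lra|].
    by move=> y _; apply: lt_le_trans (gF y); rewrite lte_fin; lra.
  by near=> N; split; near: N.
have ratio N s t : (0 < N)%N ->
    ln ((Z N * expR (V N * s)) / (Z N * expR (V N * t))) = V N * (s - t).
  by move=> N0; rewrite -mulf_div divff ?gt_eqF ?expR_gt0// mul1r -expRB expRK mulrBr.
split.
- by move=> x; rewrite rateE sube_ge0.
- move=> x c; rewrite rateE lteBrDr// -EFinD => /(pmf_functional_lsc d0 beta0 a0)[U xU Uc].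
  by exists U => // y /Uc; rewrite rateE lteBrDr.
- move=> A cA; apply: ereal_le_real => t At.
  have [t' t't At'] := ereal_lt_real_between At.
  have AF x : A x -> ((g - t')%:E < F x)%E.
    move=> Ax; rewrite EFinB addeC -lteBrDr// -rateE -EFinN lteNl in At' *.
    by apply: lt_le_trans At' _; apply: ereal_inf_lbound; exists x.
  (* Half of the room t - t' goes to the numerator, half to the normalising constant. *)
  pose e := (t - t') / 2; have e0 : 0 < e by rewrite /e; lra.
  have ge : g - t' - e < g - t' by lra.
  have hA := closed_upper_bound cA ge AF.
  apply: limn_esup_near_le; near=> N.
  have N0 : (0 < N)%N by near: N; exists 1%N.
  have [T1 _] : ((Z N * expR (V N * (qbar - (g + e))))%:E <= pmf_mass N setT)%E /\
    (pmf_mass N setT <= (Z N * expR (V N * (qbar - (g - e))))%:E)%E.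
    by near: N; exact: massT.
  rewrite (_ : t = (V N)^-1 * (V N * ((qbar - (g - t' - e)) - (qbar - (g + e))))); last first.
    by rewrite mulKf ?gt_eqF ?V0// /e; field.
  rewrite EFinM lee_pmul2l ?lte_fin ?invr_gt0 ?V0// -ratio//.
  apply: lne_div_le => //; rewrite ?mulr_gt0 ?expR_gt0//; last by near: N.
  exact: pmf_mass_ge0 N0 (borel_ell1_closed cA).
- move=> O oO; apply: ereal_ge_real => t Ot.
  have [_ [x Ox <-] xt] : exists2 y, (pmf_rate d a beta m @` O) y & (y < (- t)%:E)%E.
    by apply: ereal_inf_lt; rewrite EFinN lteNr.
  have [L Lt xL] : exists2 L : R, L < g - t & (F x < L%:E)%E.
    by apply: ereal_lt_real_between; rewrite EFinB addeC -lteBlDr// -rateE -EFinN.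
  (* The numerator is already controlled by L, so all the remaining room goes to the normalising
     constant. *)
  have e0 : 0 < g - t - L by rewrite subr_gt0.
  have hO := open_lower_bound oO Ox xL.
  apply: limn_einf_near_ge; near=> N.
  have N0 : (0 < N)%N by near: N; exists 1%N.
  have [_ T2] : ((Z N * expR (V N * (qbar - (g + (g - t - L)))))%:E <= pmf_mass N setT)%E /\
    (pmf_mass N setT <= (Z N * expR (V N * (qbar - (g - (g - t - L)))))%:E)%E.
    by near: N; exact: massT.
  rewrite (_ : t = (V N)^-1 * (V N * ((qbar - L) - (qbar - (g - (g - t - L)))))); last first.
    by rewrite mulKf ?gt_eqF ?V0//; ring.
  rewrite EFinM lee_pmul2l ?lte_fin ?invr_gt0 ?V0// -ratio//.
  apply: lne_div_ge => //; rewrite ?mulr_gt0 ?expR_gt0//; last by near: N.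
  exact: pmf_mass_ge0 N0 measurableT.
Unshelve. all: by end_near. Qed.

End pmf_large_deviations.

(** * Periodic boundary conditions *)

Section heat_kernel_lemmas.
Context {R : realType} {d : nat}.

(** The value of [heat_kernel t] on the diagonal. *)
Definition heat_peak (t : R) : R := (4 * pi * t) `^ (- (d%:R / 2)).

Lemma heat_peak_gt0 t : 0 < t -> 0 < heat_peak t.
Proof. by move=> t0; rewrite powR_gt0// !mulr_gt0// pi_gt0. Qed.

Lemma free_weight_heat_peak (beta : R) k : 0 < beta ->
  heat_peak (k.+1%:R * beta) / k.+1%:R = free_weight d beta 0 k.
Proof.
move=> beta0; rewrite free_weightE /heat_peak.
have c0 : 0 < 4 * pi * beta by rewrite !mulr_gt0// pi_gt0.
rewrite (mulrC k.+1%:R) mulrA powRM ?(ltW c0)// !powRN -mulrA; congr (_ * _).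
by rewrite powRD ?pnatr_eq0 ?implybT// powRr1// invfM mulrC.
Qed.

Lemma cubeE N : @cube R d N = [set x | forall i : 'I_d, `[- N%:R, N%:R]%classic (tnth x i)].
Proof. by apply/seteqP; split => x h i; have := h i; rewrite /= in_itv. Qed.

Lemma lebesgue_cube N : lebesgue_tuple d (@cube R d N) = (cube_volume R d N)%:E.
Proof.
rewrite cubeE (lebesgue_tuple_box (A := fun=> `[- N%:R, N%:R]%classic))//.
rewrite lebesgue_measure_itv/= lte_fin.
rewrite (eq_bigr (fun=> (2 * N%:R)%:E)) => [|i _].
  by rewrite prodEFin prodr_const card_ord.
case: ifPn => [_|]; first by rewrite -EFinB opprK -mulr2n mulr_natl.
case: N => [|N]; first by rewrite mulr0.
by rewrite gtrN.
Qed.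

End heat_kernel_lemmas.

(** * Lattice sums *)

Section theta_sum.
Context {R : realType}.

Lemma ler_sum_subset (I : eqType) (s t : seq I) (f : I -> R) : uniq s -> uniq t ->
  {subset s <= t} -> (forall i, 0 <= f i) -> \sum_(i <- s) f i <= \sum_(i <- t) f i.
Proof.
move=> us ut st f0.
have ps : perm_eq s [seq i <- t | i \in s].
  apply: uniq_perm; rewrite ?filter_uniq// => i; rewrite mem_filter.
  by case: (boolP (i \in s)) => // /st ->.
by rewrite (perm_big _ ps)/= big_filter [leLHS]big_mkcond; apply: ler_sum => i _; case: ifP.
Qed.

Variable rho : R.
Hypotheses (rho0 : 0 <= rho) (rho1 : rho < 1).

Lemma geometric_psum_le n : \sum_(0 <= j < n) rho ^+ j <= (1 - rho)^-1.
Proof.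
rewrite -[leRHS]mul1r ler_pdivlMr ?subr_gt0// mulrC.
suff -> : (1 - rho) * \sum_(0 <= j < n) rho ^+ j = 1 - rho ^+ n.
  by rewrite lerBlDr lerDl exprn_ge0.
elim: n => [|n IH]; first by rewrite big_nil mulr0 expr0 subrr.
by rewrite big_nat_recr//= mulrDr IH exprS; ring.
Qed.

(** The differences j - M run through the integers from - M to M: one geometric series starting at 1
    and one starting at rho. *)
Lemma two_sided_geometric_le M :
  \sum_(j < M.*2.+1) rho ^+ `|(j : nat)%:Z - M%:Z|%N <= (1 + rho) / (1 - rho).
Proof.
rewrite -(big_mkord xpredT (fun j => rho ^+ `|j%:Z - M%:Z|%N)).
have MM : (M <= M.*2.+1)%N by rewrite -addnn leqW// leq_addr.
rewrite (big_cat_nat (leq0n M) MM)/= mulrDl mul1r addrC; apply: lerD.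
  rewrite -{1}[M]add0n big_addn (eq_bigr (fun j => rho ^+ j)) ?geometric_psum_le// => j _.
  by rewrite PoszD addrK absz_nat.
rewrite big_nat_rev/= add0n.
apply: (@le_trans _ _ (\sum_(0 <= j < M) rho * rho ^+ j)).
  rewrite le_eqVlt; apply/orP; left; apply/eqP/eq_big_nat => j /andP[_ jM].
  rewrite -exprS; congr (_ ^+ _).
  by rewrite distnC distnEl ?leq_subr// subKn.
by rewrite -mulr_sumr ler_wpM2l// geometric_psum_le.
Qed.

(** A finite set of lattice points lies in a cube, over which the sum of products factorises. *)
Lemma theta_sum_le d (s : seq (d.-tuple int)) : uniq s ->
  \sum_(z <- s) \prod_(i < d) rho ^+ `|tnth z i|%N <= ((1 + rho) / (1 - rho)) ^+ d.
Proof.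
move=> us.
pose M := \max_(z <- s) \max_(i < d) `|tnth z i|%N.
have zM z i : z \in s -> (`|tnth z i| <= M)%N.
  move=> zs; apply: leq_trans (leq_bigmax_seq _ zs isT).
  exact: (@leq_bigmax _ (fun i => `|tnth z i|%N)).
pose g (f : {ffun 'I_d -> 'I_M.*2.+1}) := [tuple (f i : nat)%:Z - M%:Z | i < d].
have g_inj : injective g.
  move=> f1 f2 /(congr1 (fun z => tnth z)) e; apply/ffunP => i; apply/val_inj.
  have := congr1 (fun u => u i) e; rewrite /= !tnth_mktuple => /addIr.
  by case.
apply: (@le_trans _ _ (\sum_(z <- [seq g f | f <- enum {ffun 'I_d -> 'I_M.*2.+1}])
    \prod_(i < d) rho ^+ `|tnth z i|%N)).
  apply: ler_sum_subset => //.
  - by rewrite map_inj_uniq ?enum_uniq.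
  - move=> z zs; apply/mapP.
    exists [ffun i => inord (absz (tnth z i + M%:Z)%R)]; first by rewrite mem_enum.
    apply/eq_from_tnth => i; rewrite tnth_mktuple ffunE.
    have := zM _ i zs; move: (tnth z i) => j jM.
    rewrite inordK; first by lia.
    by rewrite -addnn; lia.
  - by move=> z; apply: prodr_ge0 => i _; rewrite exprn_ge0.
rewrite big_map big_enum/=.
rewrite (eq_bigr (fun f : {ffun 'I_d -> 'I_M.*2.+1} =>
    \prod_(i < d) rho ^+ `|(f i : nat)%:Z - M%:Z|%N)); last first.
  by move=> f _; apply: eq_bigr => i _; rewrite tnth_mktuple.
rewrite -(bigA_distr_bigA (fun (i : 'I_d) (j : 'I_M.*2.+1) => rho ^+ `|(j : nat)%:Z - M%:Z|%N))/=.
rewrite prodr_const card_ord lerXn2r ?nnegrE ?two_sided_geometric_le//.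
  by apply: sumr_ge0 => j _; rewrite exprn_ge0.
by rewrite divr_ge0 ?subr_ge0 ?(ltW rho1)// addr_ge0.
Qed.

End theta_sum.

Section periodic_weights.
Context {R : realType}.
Variables (d : nat) (beta : R).
Hypotheses (beta0 : 0 < beta).
Let q := free_weight d beta (0 : R).

(** For t <= N beta, (2 N z)^2 / (4 t) >= N z^2 / beta >= N |z| / beta, so each unit of |z| costs
    this factor. *)
Definition periodic_rho N : R := expR (- (N%:R / beta)).

Definition periodic_constant N : R := ((1 + periodic_rho N) / (1 - periodic_rho N)) ^+ d.

Lemma periodic_rho_lt1 N : (0 < N)%N -> periodic_rho N < 1.
Proof.
by move=> N0; rewrite /periodic_rho -[ltRHS]expR0 ltr_expR oppr_lt0 divr_gt0 ?ltr0n.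
Qed.

Lemma periodic_constant_cvg : periodic_constant @ \oo --> (1 : R).
Proof.
have rho_cvg : periodic_rho @ \oo --> (0 : R).
  apply/cvgrPdist_lt => e e0; near=> N; rewrite sub0r normrN ger0_norm ?expR_ge0//.
  rewrite -ltr_ln ?posrE ?expR_gt0// expRK ltrNl ltr_pdivlMr//.
  by near: N; exact: nbhs_infty_gtr.
have h : (fun N => (1 + periodic_rho N) / (1 - periodic_rho N)) @ \oo --> (1 : R).
  rewrite -[X in _ --> X](_ : (1 + 0) / (1 - 0) = 1 :> R); last by rewrite addr0 subr0 divr1.
  apply: cvgM; first by apply: cvgD => //; exact: cvg_cst.
  by apply: cvgV; [rewrite subr0 oner_neq0|apply: cvgB => //; exact: cvg_cst].
suff H n : (fun N => ((1 + periodic_rho N) / (1 - periodic_rho N)) ^+ n) @ \oo --> (1 : R).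
  exact: H.
elim: n => [|n IH]; first by under eq_fun do rewrite expr0; exact: cvg_cst.
by rewrite -[X in _ --> X](mulr1 1); under eq_fun do rewrite exprS; exact: cvgM.
Unshelve. all: by end_near. Qed.

Let periodic_sum N (t : R) : \bar R :=
  \esum_(z in [set: d.-tuple int])
    (heat_peak (d := d) t * expR (- (\sum_(i < d) (2 * N%:R * (tnth z i)%:~R) ^+ 2) / (4 * t)))%:E.

Lemma periodic_heat_kernel_diag N t (x : d.-tuple R) :
  periodic_heat_kernel N t x x = periodic_sum N t.
Proof.
apply: eq_esum => z _; rewrite /heat_kernel.
rewrite (eq_bigr (fun i => (2 * N%:R * (tnth z i)%:~R) ^+ 2))// => i _.
by rewrite tnth_mktuple opprD addrA subrr add0r sqrrN.
Qed.

(** The term z = 0 is the lower bound. The restriction t <= N beta reflects the cutoff at cycle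
    length N and makes the other terms a small theta series. *)
Lemma periodic_sum_bounds N t : (0 < N)%N -> 0 < t -> t <= N%:R * beta ->
  ((heat_peak (d := d) t)%:E <= periodic_sum N t <= (heat_peak (d := d) t * periodic_constant N)%:E)%E.
Proof.
move=> N0 t0 tN; have p0 := heat_peak_gt0 (d := d) t0; apply/andP; split.
  pose z0 : d.-tuple int := [tuple 0 | i < d].
  apply: le_trans (esum_ge _); last first.
    exists [set z0]; first by split => //; exact: finite_set1.
    by rewrite fsbig_set1.
  rewrite lee_fin big1 ?oppr0 ?mul0r ?expR0 ?mulr1// => i _.
  by rewrite tnth_mktuple mulr0 expr0n.
apply: ge_ereal_sup => _ [A [fA _] <-].
rewrite fsbig_finite//= sumEFin lee_fin -mulr_sumr ler_pM2l//.
have r0 : 0 <= periodic_rho N by exact: expR_ge0.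
apply: le_trans (theta_sum_le r0 (periodic_rho_lt1 N0) (fset_uniq (fset_set A))).
apply: ler_sum => z _; rewrite /periodic_rho.
rewrite [leRHS](eq_bigr (fun i => expR (`|tnth z i|%N%:R * - (N%:R / beta)))); last first.
  by move=> i _; rewrite expRM_natl.
rewrite -expR_sum ler_expR mulNr mulr_suml -sumrN; apply: ler_sum => i _.
rewrite mulrN lerN2 exprMn.
set j := tnth z i.
have N0' : 0 < N%:R :> R by rewrite ltr0n.
apply: (@le_trans _ _ (`|j|%N%:R ^+ 2 * (N%:R / beta))).
  apply: ler_wpM2r; first by rewrite divr_ge0// ltW.
  by rewrite -natrX ler_nat; case: (`|j|%N) => // n; rewrite expnS leq_pmulr.
have -> : (j%:~R : R) ^+ 2 = `|j|%N%:R ^+ 2.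
  by rewrite -[LHS]real_normK ?num_real// -intr_norm -abszE.
have -> : (2 * N%:R) ^+ 2 * `|j|%N%:R ^+ 2 / (4 * t) = `|j|%N%:R ^+ 2 * (N%:R ^+ 2 / t).
  by field; rewrite gt_eqF.
apply: ler_wpM2l; first exact: sqr_ge0.
by rewrite ler_pdivlMr// mulrAC ler_pdivrMr// expr2 -[leRHS]mulrA ler_pM2l.
Qed.

Lemma measurable_cube N : measurable (@cube R d N).
Proof.
rewrite cubeE (_ : [set x | _] = \bigcap_(i in [set: 'I_d])
    ((fun x : d.-tuple R => tnth x i) @^-1` `[- N%:R, N%:R]%classic)); last first.
  by apply/seteqP; split => x h i; [move=> _; exact: h|exact: (h i I)].
apply: fin_bigcap_measurable => // i _.
by rewrite -[X in measurable X]setTI; exact: (measurable_tnth i).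
Qed.

Lemma cube_volume_gt0 N : (0 < N)%N -> 0 < cube_volume R d N.
Proof. by move=> N0; rewrite /cube_volume exprn_gt0// mulr_gt0// ltr0n. Qed.

Lemma periodic_weight_bounds N k (gDir : R -> d.-tuple R -> d.-tuple R -> R) :
  (k < N)%N -> q k <= cycle_weight beta 0 gDir BCper N k <= periodic_constant N * q k.
Proof.
move=> kN; have N0 : (0 < N)%N by exact: leq_ltn_trans kN.
have t0 : 0 < k.+1%:R * beta by rewrite mulr_gt0.
have tN : k.+1%:R * beta <= N%:R * beta by rewrite ler_pM2r// ler_nat.
have /andP[] := periodic_sum_bounds N0 t0 tN.
rewrite /cycle_weight kN mulr0 mul0r expR0 div1r.
rewrite (eq_integral (cst (periodic_sum N (k.+1%:R * beta)))); last first.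
  by move=> x _; rewrite periodic_heat_kernel_diag.
rewrite integral_cst; last exact: measurable_cube.
have V0 := cube_volume_gt0 N0.
rewrite [X in fine (_ * X)]lebesgue_cube; case: (periodic_sum _ _) => [c| |]//.
rewrite !lee_fin => c1 c2; rewrite /= invfM mulrACA mulVf ?gt_eqF// mulr1.
rewrite /q -free_weight_heat_peak// [_^-1 * c]mulrC ler_pM2r ?invr_gt0// c1/=.
by rewrite mulrCA mulrA ler_pM2r ?invr_gt0.
Qed.

End periodic_weights.

(** * Dirichlet boundary conditions *)

Section independent_triple.
Context {R : realType} {dO} {Om : measurableType dO} (P : probability Om R).
Context {d1 d2 d3} {T1 : measurableType d1} {T2 : measurableType d2} {T3 : measurableType d3}.
Variables (U : {mfun Om >-> T1}) (V : {mfun Om >-> T2}) (W : {mfun Om >-> T3}).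
Local Open Scope ereal_scope.
Hypothesis UVW : forall A B C, measurable A -> measurable B -> measurable C ->
  P (U @^-1` A `&` V @^-1` B `&` W @^-1` C) = P (U @^-1` A) * P (V @^-1` B) * P (W @^-1` C).

Let mpre d (T : measurableType d) (f : {mfun Om >-> T}) A :
  measurable A -> measurable (f @^-1` A).
Proof. by move=> mA; rewrite -[X in measurable X]setTI; exact: measurable_funP. Qed.

Let UV w := (U w, V w).

Let mUV : measurable_fun setT UV.
Proof. by apply: measurable_fun_pair; exact: measurable_funP. Qed.

HB.instance Definition _ := isMeasurableFun.Build _ _ _ _ UV mUV.

Lemma independent_pair_product Y : measurable Y ->
  P (UV @^-1` Y) = (distribution P U \x distribution P V) Y.
Proof.
move=> mY; apply/esym.
apply: (@product_measure_unique _ _ _ _ _ (distribution P U) (distribution P V) (distribution P UV)) => //.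
move=> A B mA mB; rewrite /distribution/= /pushforward.
have := UVW mA mB measurableT.
by rewrite preimage_setT setIT probability_setT mule1.
Qed.

(** Independence is given on rectangles; for fixed C both sides are finite measures in Y that agree
    on the rectangles, a generating class stable under intersection. *)
Lemma independent_triple_split Y C : measurable Y -> measurable C ->
  P (UV @^-1` Y `&` W @^-1` C) = P (UV @^-1` Y) * P (W @^-1` C).
Proof.
move=> mY mC.
have mWC := mpre W mC.
have pE : P (W @^-1` C) = (fine (P (W @^-1` C)))%:E by rewrite fineK// fin_num_measure.
have p0 : (0 <= fine (P (W @^-1` C)))%R by rewrite fine_ge0.
pose m0 : {measure set (T1 * T2) -> \bar R} := pushforward (mrestr P mWC) UV.
pose m1 := m0 mUV.
pose m2 : {measure set (T1 * T2) -> \bar R} :=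
  [the measure _ _ of mscale (NngNum p0) (distribution P U \x distribution P V)].
have : forall Y, measurable Y -> m1 Y = m2 Y.
  apply: (@measure_unique _ R _ [set A `*` B | A in measurable & B in measurable] (fun=> setT)).
  - exact: measurable_prod_measurableType.
  - move=> _ _ [A1 mA1 [B1 mB1 <-]] [A2 mA2 [B2 mB2 <-]].
    exists (A1 `&` A2); first exact: measurableI.
    by exists (B1 `&` B2); [exact: measurableI|rewrite -setXI].
  - by move=> _; exists setT => //; exists setT => //; rewrite setXTT.
  - by apply/seteqP; split => // x _; exists 0%N.
  - move=> _ [A mA [B mB <-]].
    rewrite /m1/m0/m2/= /pushforward/mrestr/mscale/=.
    rewrite product_measure1E//.
    rewrite /distribution/= /pushforward -pE muleC.
    exact: UVW.
  - move=> _; rewrite /m1/m0/= /pushforward /mrestr.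
    by apply: le_lt_trans (probability_le1 _ _) _; [apply: measurableI => //; exact: mpre|exact: ltry].
move=> /(_ _ mY); rewrite /m1/m0/m2/= /pushforward/mrestr/mscale/= => ->.
by rewrite -pE muleC independent_pair_product.
Qed.

(** Fubini: the section of S at (u, v) has probability at most c if u is in E and is empty
    otherwise. *)
Lemma independent_triple_le (S : set ((T1 * T2) * T3)) (E : set T1) (c : R) :
  measurable S -> measurable E -> (0 <= c)%R ->
  (forall u v, E u -> P [set w | S ((u, v), W w)] <= c%:E) ->
  (forall u v z, S ((u, v), z) -> E u) ->
  P [set w | S ((U w, V w), W w)] <= c%:E * P (U @^-1` E).
Proof.
move=> mS mE c0 Sc SE.
pose UVW3 w := (UV w, W w).
have mUVW : measurable_fun setT UVW3 by apply: measurable_fun_pair => //; exact: measurable_funP.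
pose m0 : {measure set ((T1 * T2) * T3) -> \bar R} := pushforward P UVW3.
pose m' := m0 mUVW.
have -> : P [set w | S ((U w, V w), W w)] = (distribution P UV \x distribution P W) S.
  apply/esym; apply: (@product_measure_unique _ _ _ _ _ (distribution P UV) (distribution P W) m') => //.
  by move=> Y C mY mC; exact: independent_triple_split.
rewrite /product_measure1/=.
apply: (@le_trans _ _ (\int[distribution P UV]_x (c%:E * (\1_(E `*` [set: T2]) x)%:E))).
  apply: ge0_le_integral => //.
  - exact: measurable_fun_xsection.
  - by apply: measurable_funeM; apply/measurable_EFinP; apply: measurable_indic; exact: measurableX.
  - move=> [u v] _ /=; rewrite indicE.
    have [Eu|nEu] := pselect (E u).
      rewrite mem_set//= mule1; apply: le_trans (Sc u v Eu).
      rewrite /distribution/= /pushforward le_eqVlt; apply/orP; left; apply/eqP; congr (P _).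
      by apply/seteqP; split => w /=; rewrite /xsection/= inE.
    rewrite memNset/=; last by case.
    rewrite mule0 le_eqVlt; apply/orP; left; apply/eqP.
    rewrite (_ : xsection S (u, v) = set0) ?measure0//.
    by apply/seteqP; split => // z; rewrite /xsection/= inE => /SE.
rewrite ge0_integralZl//; last by apply/measurable_EFinP; apply: measurable_indic; exact: measurableX.
rewrite integral_indic//; last exact: measurableX.
rewrite setIT lee_wpmul2l// /distribution/= /pushforward le_eqVlt; apply/orP; left; apply/eqP.
by congr (P _); apply/seteqP; split => w /=; [case|].
Qed.

End independent_triple.

(** * Gaussian laws and Brownian increments *)

Section heat_law.
Context {R : realType} {d : nat}.
Local Open Scope ereal_scope.

Lemma measurable_heat_kernel (h : R) :
  measurable_fun setT (fun y : d.-tuple R => (heat_kernel h tuple_zero y)%:E).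
Proof.
apply/measurable_EFinP; rewrite /heat_kernel.
apply: measurable_funM => //; apply: measurableT_comp => //.
apply: measurable_funM => //; apply: measurableT_comp => //.
apply: measurable_sum => i.
apply: measurable_funX; apply: measurable_funB => //; exact: measurable_tnth.
Qed.

Lemma heat_kernel_ge0 (h : R) (x y : d.-tuple R) : (0 <= heat_kernel h x y)%R.
Proof. by rewrite mulr_ge0// ?powR_ge0// expR_ge0. Qed.

Lemma heat_kernel_le_peak (h : R) (x y : d.-tuple R) : (0 < h)%R ->
  (heat_kernel h x y <= heat_peak (d := d) h)%R.
Proof.
move=> h0; rewrite /heat_kernel -/(heat_peak _) ler_piMr ?powR_ge0//.
rewrite -[leRHS]expR0 ler_expR mulNr oppr_le0 divr_ge0//; last by rewrite mulr_ge0// ltW.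
by apply: sumr_ge0 => i _; exact: sqr_ge0.
Qed.

Lemma heat_law_le_volume (h : R) (A : set (d.-tuple R)) : (0 < h)%R -> measurable A ->
  \int[lebesgue_tuple d]_(y in A) (heat_kernel h tuple_zero y)%:E <=
  (heat_peak (d := d) h)%:E * lebesgue_tuple d A.
Proof.
move=> h0 mA; rewrite -integral_cst//.
apply: ge0_le_integral => //.
- by move=> y _; rewrite lee_fin heat_kernel_ge0.
- exact: (measurable_funS _ _ (measurable_heat_kernel h)).
- by move=> y _; rewrite lee_fin heat_kernel_le_peak.
Qed.

Definition far_tuples (l : R) : set (d.-tuple R) :=
  [set y | exists i : 'I_d, (l <= `|tnth y i|)%R].

Lemma measurable_far_tuples l : measurable (far_tuples l).
Proof.
rewrite (_ : far_tuples l = \bigcup_(i in [set: 'I_d])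
    ((fun y : d.-tuple R => `|tnth y i|%R) @^-1` `[l, +oo[%classic)); last first.
  apply/seteqP; split => y /=; first by move=> [i li]; exists i => //=; rewrite in_itv/= andbT.
  by move=> [i _ /=]; rewrite in_itv/= andbT => li; exists i.
apply: fin_bigcup_measurable => // i _; rewrite -[X in measurable X]setTI.
have : measurable_fun setT (fun y : d.-tuple R => `|tnth y i|%R).
  by apply: measurableT_comp => //; exact: measurable_tnth.
by apply.
Qed.

(** The exponential is split into two equal factors: one is at most e^(- l^2 / (8 h)) on the tail,
    the other belongs to the kernel at time 2 h, whose prefactor differs by 2^(d/2). *)
Lemma heat_tail_pointwise (h l : R) (y : d.-tuple R) : (0 < h)%R -> (0 <= l)%R ->
  far_tuples l y ->
  (heat_kernel h tuple_zero y <=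
   2 `^ (d%:R / 2) * expR (- (l ^+ 2 / (8 * h))) * heat_kernel (2 * h) tuple_zero y)%R.
Proof.
move=> h0 l0 [i li]; rewrite /heat_kernel.
set S := (\sum_(j < d) _)%R.
have Sl : (l ^+ 2 <= S)%R.
  rewrite /S (bigD1 i)//= tnth_mktuple sub0r sqrrN -[leLHS]addr0 lerD//.
    by rewrite -[leRHS]real_normK ?num_real// lerXn2r// nnegrE.
  by apply: sumr_ge0 => j _; exact: sqr_ge0.
have -> : (4 * pi * (2 * h) = 2 * (4 * pi * h))%R by ring.
rewrite (@powRM _ 2 (4 * pi * h)%R)//; last by rewrite !mulr_ge0// ?pi_ge0// ltW.
rewrite [leRHS](_ : _ = 2 `^ (d%:R / 2) * 2 `^ (- (d%:R / 2)) * (4 * pi * h) `^ (- (d%:R / 2)) *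
  (expR (- (l ^+ 2 / (8 * h))) * expR (- S / (4 * (2 * h)))))%R; last by ring.
rewrite (@powRN _ 2) mulfV ?mul1r; last by rewrite gt_eqF// powR_gt0.
rewrite ler_wpM2l ?powR_ge0// -expRD ler_expR -subr_ge0.
rewrite (_ : (_ - _ = (S - l ^+ 2) / (8 * h))%R); last by field; lra.
by rewrite divr_ge0 ?subr_ge0// mulr_ge0// ltW.
Qed.

End heat_law.

Section brownian_increments.
Context {R : realType} {d : nat} {dO} {Om : measurableType dO}.
Variables (P : probability Om R) (B : R -> Om -> d.-tuple R).
Hypothesis BM : brownian_motion P B.
Local Open Scope ereal_scope.

Definition increment (s u : R) (w : Om) : d.-tuple R := tuple_sub (B u w) (B s w).

Lemma measurable_increment s u : (0 <= s)%R -> (0 <= u)%R ->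
  measurable_fun setT (increment s u).
Proof.
have [mB _ _ _] := BM; move=> s0 u0.
apply/measurable_fun_tnthP => i /=.
rewrite (_ : _ \o _ = (fun w => tnth (B u w) i - tnth (B s w) i)%R); last first.
  by apply/funext => w /=; rewrite tnth_mktuple.
have mt v : (0 <= v)%R -> measurable_fun setT (fun w => tnth (B v w) i).
  by move=> v0; apply: (measurableT_comp (measurable_tnth i)); exact: mB.
by apply: measurable_funB; exact: mt.
Qed.

Lemma increment_law s u A : (0 <= s)%R -> (s < u)%R -> measurable A ->
  P (increment s u @^-1` A) =
  \int[lebesgue_tuple d]_(y in A) (heat_kernel (u - s) tuple_zero y)%:E.
Proof.
move=> s0 su mA; have [_ _ _ fdd] := BM.
(* The time sequence must increase strictly at all indices, so it is continued past u by unit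
   steps. *)
have := fdd 1%N (fun j => match j with 0 => s | j'.+1 => u + j'%:R end)%R (fun=> A) s0.
rewrite big_ord1/= addr0 => <- //.
- congr (P _); apply/seteqP; split => w /=.
    by move=> Aw [|//] _; rewrite addr0.
  by move=> /(_ 0%N isT); rewrite addr0.
- by case=> [|j]; rewrite ?addr0// ltrD2l ltr_nat.
Qed.

(** The Gaussian integral is read off from the law of an increment, which has total mass 1. *)
Lemma heat_law_probability h : (0 < h)%R ->
  \int[lebesgue_tuple d]_(y in [set: d.-tuple R]) (heat_kernel h tuple_zero y)%:E = 1.
Proof.
move=> h0; have := increment_law (lexx 0%R) h0 measurableT.
by rewrite preimage_setT probability_setT subr0 => <-.
Qed.

Lemma increment_tail s u l : (0 <= s)%R -> (s < u)%R -> (0 <= l)%R ->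
  P (increment s u @^-1` far_tuples l) <=
  (2 `^ (d%:R / 2) * expR (- (l ^+ 2 / (8 * (u - s)))))%:E.
Proof.
move=> s0 su l0; have h0 : (0 < u - s)%R by rewrite subr_gt0.
rewrite increment_law//; last exact: measurable_far_tuples.
set c := (_ * _)%R.
have c0 : (0 <= c)%R by rewrite mulr_ge0 ?powR_ge0 ?expR_ge0.
have h20 : (0 < 2 * (u - s))%R by rewrite mulr_gt0.
have <- : c%:E * \int[lebesgue_tuple d]_(y in [set: d.-tuple R]) (heat_kernel (2 * (u - s)) tuple_zero y)%:E = c%:E.
  by rewrite heat_law_probability// mule1.
have mH := measurable_heat_kernel (d := d) (2 * (u - s)).
rewrite -ge0_integralZl//; last by move=> y _; rewrite lee_fin heat_kernel_ge0.
have mF := measurable_far_tuples (d := d) l.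
apply: (@le_trans _ _ (\int[lebesgue_tuple d]_(y in far_tuples l)
  (c%:E * (heat_kernel (2 * (u - s)) tuple_zero y)%:E))).
  apply: ge0_le_integral => //.
  - by move=> y _; rewrite lee_fin heat_kernel_ge0.
  - exact: (measurable_funS _ _ (measurable_heat_kernel _)).
  - by apply: measurable_funeM; exact: (measurable_funS _ _ mH).
  - by move=> y Fy; rewrite -EFinM lee_fin; exact: heat_tail_pointwise.
apply: ge0_subset_integral => //.
- by apply: measurable_funeM.
- by move=> y _; rewrite mule_ge0// lee_fin heat_kernel_ge0.
Qed.

Lemma increments3_independent s0 s1 s2 s3 A1 A2 A3 : (0 <= s0)%R ->
  (s0 < s1)%R -> (s1 < s2)%R -> (s2 < s3)%R ->
  measurable A1 -> measurable A2 -> measurable A3 ->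
  P (increment s0 s1 @^-1` A1 `&` increment s1 s2 @^-1` A2 `&` increment s2 s3 @^-1` A3) =
  P (increment s0 s1 @^-1` A1) * P (increment s1 s2 @^-1` A2) * P (increment s2 s3 @^-1` A3).
Proof.
move=> s00 s01 s12 s23 m1 m2 m3; have [_ _ _ fdd] := BM.
have s10 : (0 <= s1)%R by exact: le_trans (ltW s01).
have s20 : (0 <= s2)%R by exact: le_trans (ltW s12).
rewrite !increment_law//.
pose s j := match j with 0 => s0 | 1 => s1 | 2 => s2 | j'.+3 => s3 + j'%:R end%R.
have s_s3 : (s3 + 0 = s3)%R by rewrite addr0.
have := fdd 3%N s (fun j => match j with 0 => A1 | 1 => A2 | _ => A3 end) s00.
rewrite !big_ord_recl big_ord0 /= mule1 muleA s_s3 => <- //.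
- congr (P _); apply/seteqP; split => w /=.
    by move=> [[a1 a2] a3] [|[|[|//]]] _ //=; rewrite s_s3.
  move=> aw; split; first split.
  + exact: (aw 0%N).
  + exact: (aw 1%N).
  + by have := aw 2%N isT; rewrite /= s_s3.
- by case=> [|[|[|j]]]//=; rewrite ?s_s3// ltrD2l ltr_nat.
- by case=> [|[|j]].
Qed.

End brownian_increments.

(** * Dyadic chaining *)

Section dyadic_chaining.
Context {R : realType}.
Variables (f : R -> R) (t : R).
Hypothesis t0 : 0 < t.

Definition dyadic n j : R := t * (j%:R / 2 ^+ n).

Lemma dyadic_half n j : dyadic n.+1 j.*2 = dyadic n j.
Proof.
rewrite /dyadic -mul2n natrM exprS; congr (_ * _).
by rewrite -mulf_div divff ?mul1r.
Qed.

(** A point of odd index at level n + 1 is one step away from a point of level n. At level 0 there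
    are the endpoints 0 and t, which is why a bound on f t enters. *)
Lemma dyadic_chaining (delta : R) (l : nat -> R) :
  f 0 = 0 -> `|f t| <= delta -> (forall n, 0 <= l n) ->
  (forall n j, (j < 2 ^ n.+1)%N -> `|f (dyadic n.+1 j.+1) - f (dyadic n.+1 j)| <= l n) ->
  forall n j, (j <= 2 ^ n)%N -> `|f (dyadic n j)| <= delta + \sum_(0 <= m < n) l m.
Proof.
move=> f0 ft l0 fl; elim => [|n IH] j.
  rewrite /dyadic expr0 divr1 big_geq// addr0.
  by case: j => [|[|//]] _; rewrite ?mulr0 ?mulr1 ?f0 ?normr0// (le_trans _ ft).
rewrite big_nat_recr//= addrA.
rewrite -[j in dyadic _ j]odd_double_half expnS => j2.
case: (odd j) (odd_double_half j) => /= jE; last first.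
  by rewrite add0n dyadic_half (le_trans (IH _ _)) ?lerDl//; lia.
rewrite add1n -[f _](subrK (f (dyadic n.+1 j./2.*2))) addrC.
rewrite (le_trans (ler_normD _ _))// lerD//; first by apply: fl; rewrite expnS; lia.
by rewrite dyadic_half IH//; lia.
Qed.

(** Rounding s / t down to multiples of 2^(- n) gives dyadic points that tend to s inside the
    half-line on which f is continuous. *)
Lemma dyadic_dense (a b : R) : {within `[0, +oo[, continuous f} ->
  (forall n j, (j <= 2 ^ n)%N -> a <= f (dyadic n j) <= b) ->
  forall s, 0 <= s <= t -> a <= f s <= b.
Proof.
move=> cf fab s /andP[s0 st].
pose j n := Num.truncn (s / t * 2 ^+ n).
have st0 : 0 <= s / t by rewrite divr_ge0// ltW.
have jlt n : (j n)%:R <= s / t * 2 ^+ n < (j n).+1%:R.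
  by apply: truncn_itv; rewrite mulr_ge0// exprn_ge0.
have jn n : (j n <= 2 ^ n)%N.
  rewrite -(ler_nat R) (le_trans (proj1 (andP (jlt n))))// natrX ler_piMl//.
  by rewrite ler_pdivrMr// mul1r.
have dn n : s - t / 2 ^+ n <= dyadic n (j n) <= s.
  have p2 : 0 < 2 ^+ n :> R by rewrite exprn_gt0.
  have /andP[h1 h2] := jlt n; rewrite /dyadic; apply/andP; split.
    rewrite -subr_ge0 (_ : _ - _ = t / 2 ^+ n * ((j n).+1%:R - s / t * 2 ^+ n)).
      by rewrite mulr_ge0// ?subr_ge0 ?(ltW h2)// divr_ge0// ?ltW.
    by rewrite -natr1; field; rewrite !gt_eqF.
  rewrite -subr_ge0 (_ : _ - _ = t / 2 ^+ n * (s / t * 2 ^+ n - (j n)%:R)).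
    by rewrite mulr_ge0// ?subr_ge0// divr_ge0// ?ltW.
  by field; rewrite !gt_eqF.
have cd : (fun n => dyadic n (j n)) @ \oo --> s.
  apply: (@squeeze_cvgr _ _ _ _ (fun n => s - t / 2 ^+ n) (fun=> s)).
  - by apply: nearW => n; exact: dn.
  - rewrite -[X in _ --> X]subr0; apply: cvgB; first exact: cvg_cst.
    rewrite -[X in _ --> X](mulr0 t); apply: cvgM; first exact: cvg_cst.
    have := @cvg_geometric R 1 (2^-1) _.
    rewrite ger0_norm ?invr_ge0// invf_lt1// ltr1n => /(_ isT).
    by apply: cvg_trans; apply: near_eq_cvg; apply: nearW => n /=; rewrite /geometric/= mul1r exprVn.
  - exact: cvg_cst.
have cfd : (fun n => f (dyadic n (j n))) @ \oo --> f s.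
  have := (subspace_continuousP _ _).1 cf s; rewrite /= in_itv/= andbT => /(_ s0).
  move=> cfs U /cfs fU.
  have dU : \forall n \near \oo, `[0, +oo[%classic (dyadic n (j n)) -> U (f (dyadic n (j n))).
    exact: (cd _ fU).
  suff : \forall n \near \oo, U (f (dyadic n (j n))) by [].
  apply: filterS dU => n; apply.
  by rewrite /= in_itv/= andbT mulr_ge0 ?(ltW t0)// divr_ge0// exprn_ge0.
have fa n : a <= f (dyadic n (j n)) <= b by exact: fab.
have cvd : cvgn (fun n => f (dyadic n (j n))) by apply/cvg_ex; exists (f s).
rewrite -(cvg_lim (@Rhausdorff R) cfd).
apply/andP; split; [apply: limr_ge|apply: limr_le] => //; apply: nearW => n;
  by have /andP[] := fa n.
Qed.

End dyadic_chaining.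

Section tuple_box.
Context {R : realType} {d : nat}.

Definition tuple_box (c : d.-tuple R) (e : R) : set (d.-tuple R) :=
  [set y | forall i, `|tnth y i - tnth c i| <= e].

Lemma tuple_boxE c e : tuple_box c e =
  [set y | forall i, `[tnth c i - e, tnth c i + e]%classic (tnth y i)].
Proof. by apply/seteqP; split => y cy i; have := cy i; rewrite /= in_itv/= ler_distl. Qed.

Lemma measurable_tuple_box c e : measurable (tuple_box c e).
Proof.
rewrite tuple_boxE (_ : [set x | _] = \bigcap_(i in [set: 'I_d])
    ((fun x : d.-tuple R => tnth x i) @^-1` `[tnth c i - e, tnth c i + e]%classic)); last first.
  by apply/seteqP; split => x h i; [move=> _; exact: h|exact: (h i I)].
apply: fin_bigcap_measurable => // i _; rewrite -[X in measurable X]setTI.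
by apply: (measurable_tnth i).
Qed.

Lemma lebesgue_tuple_box_volume c e : 0 < e ->
  lebesgue_tuple d (tuple_box c e) = ((2 * e) ^+ d)%:E.
Proof.
move=> e0; rewrite tuple_boxE (lebesgue_tuple_box
  (A := fun i => `[tnth c i - e, tnth c i + e]%classic))//.
rewrite (eq_bigr (fun=> (2 * e)%:E)) => [|i _].
  by rewrite prodEFin prodr_const card_ord.
rewrite lebesgue_measure_itv/= lte_fin ler_ltD ?gtrN// -EFinB; congr _%:E; ring.
Qed.

End tuple_box.

(** * Increments of a path pinned at its end *)

Section pinned_increments.
Context {R : realType} {d : nat} {dO} {Om : measurableType dO}.
Variables (P : probability Om R).
Local Open Scope ereal_scope.

Definition independent3 (U V W : {mfun Om >-> d.-tuple R}) :=
  forall A B C, measurable A -> measurable B -> measurable C ->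
  P (U @^-1` A `&` V @^-1` B `&` W @^-1` C) = P (U @^-1` A) * P (V @^-1` B) * P (W @^-1` C).

Lemma independent3_swap12 U V W : independent3 U V W -> independent3 V U W.
Proof. by move=> UVW A B C mA mB mC; rewrite (setIC (V @^-1` A)) UVW// (muleC (P (V @^-1` A))). Qed.

Lemma independent3_swap23 U V W : independent3 U V W -> independent3 U W V.
Proof. by move=> UVW A B C mA mB mC; rewrite setIAC UVW// muleAC. Qed.

(** Given U and V, the constraint confines W to a box centred at - (U + V) of volume (2 e)^d, where
    its density is at most p. *)
Lemma pinned_increment_le (U V W : {mfun Om >-> d.-tuple R}) (p e : R) (E : set (d.-tuple R)) :
  independent3 U V W -> (0 <= p)%R -> (0 < e)%R -> measurable E ->
  (forall C, measurable C -> P (W @^-1` C) <= p%:E * lebesgue_tuple d C) ->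
  P [set w | E (U w) /\ forall i, (`|tnth (U w) i + tnth (V w) i + tnth (W w) i| <= e)%R] <=
  (p * (2 * e) ^+ d)%:E * P (U @^-1` E).
Proof.
move=> ind p0 e0 mE lW.
pose S := [set x : (d.-tuple R * d.-tuple R) * d.-tuple R | E x.1.1 /\
  forall i, (`|tnth x.1.1 i + tnth x.1.2 i + tnth x.2 i| <= e)%R].
have := independent_triple_le ind (S := S) (E := E); apply => //.
- rewrite (_ : S = (fun x => x.1.1) @^-1` E `&` \bigcap_(i in [set: 'I_d])
     ((fun x => `|tnth x.1.1 i + tnth x.1.2 i + tnth x.2 i|%R) @^-1` `]-oo, e]%classic)); last first.
    apply/seteqP; split => x /=; first by move=> [Ex xe]; split => // i _ /=; rewrite in_itv/=.
    by move=> [Ex xe]; split => // i; have := xe i I; rewrite /= in_itv.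
  apply: measurableI.
    rewrite -[X in measurable X]setTI.
    by apply: (measurableT_comp measurable_fst measurable_fst) => //.
  apply: fin_bigcap_measurable => // i _; rewrite -[X in measurable X]setTI.
  have mt : measurable_fun [set: (d.-tuple R * d.-tuple R) * d.-tuple R]
      (fun x => `|tnth x.1.1 i + tnth x.1.2 i + tnth x.2 i|%R).
    apply: measurableT_comp => //; apply: measurable_funD; first apply: measurable_funD.
    + by apply: (measurableT_comp (measurable_tnth i)); exact: measurableT_comp.
    + by apply: (measurableT_comp (measurable_tnth i)); exact: measurableT_comp.
    + by apply: (measurableT_comp (measurable_tnth i)).
  by apply: mt.
- by rewrite mulr_ge0// exprn_ge0// mulr_ge0// ltW.
- move=> u v Eu; pose c := [tuple (- (tnth u i + tnth v i))%R | i < d].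
  rewrite (_ : [set w | _] = W @^-1` tuple_box c e).
    by rewrite EFinM -(lebesgue_tuple_box_volume c e0) lW//; exact: measurable_tuple_box.
  apply/seteqP; split => w /=.
    by move=> [_ h] i; rewrite tnth_mktuple opprK addrC.
  by move=> h; split => // i; have := h i; rewrite tnth_mktuple opprK addrC.
- by move=> u v z [].
Qed.

End pinned_increments.

Section pinned_brownian.
Context {R : realType} {d : nat} {dO} {Om : measurableType dO}.
Variables (P : probability Om R) (B : R -> Om -> d.-tuple R).
Hypothesis BM : brownian_motion P B.
Local Open Scope ereal_scope.

Lemma heat_peak_anti (s u : R) : (0 < s)%R -> (s <= u)%R ->
  (heat_peak (d := d) u <= heat_peak (d := d) s)%R.
Proof.
move=> s0 su; have c0 : (0 < 4 * pi :> R)%R by rewrite mulr_gt0// pi_gt0.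
have s1 : (0 < 4 * pi * s)%R by rewrite mulr_gt0.
have su1 : (4 * pi * s <= 4 * pi * u)%R by rewrite ler_pM2l.
have u1 := lt_le_trans s1 su1.
by rewrite /heat_peak !powRN lef_pV2 ?posrE ?powR_gt0// ge0_ler_powR// nnegrE ltW.
Qed.

Lemma increment_density_le s u h C : (0 < h)%R -> (0 <= s)%R -> (h <= u - s)%R -> measurable C ->
  P (increment B s u @^-1` C) <= (heat_peak (d := d) h)%:E * lebesgue_tuple d C.
Proof.
move=> h0 s0 hu mC; have us0 : (0 < u - s)%R by exact: lt_le_trans hu.
have su : (s < u)%R by rewrite -subr_gt0.
rewrite (increment_law BM s0 su mC); apply: le_trans (heat_law_le_volume us0 mC) _.
by rewrite lee_wpmul2r// lee_fin heat_peak_anti.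
Qed.

Let inc s u (s0 : (0 <= s)%R) (u0 : (0 <= u)%R) : {mfun Om >-> d.-tuple R} :=
  mfun_Sub (mem_set (measurable_increment BM s0 u0)).

(* The increment over [s, u] and B t are decoupled by a third increment of length
   at least t / 4, independent of the first: its bounded density pays for the
   constraint on B t. *)
Lemma pinned_increment_tail s u t l e :
  (0 <= s)%R -> (s < u)%R -> (u <= t)%R -> (u - s <= t / 2)%R -> (0 <= l)%R -> (0 < e)%R ->
  P [set w | far_tuples l (increment B s u w) /\ tuple_box tuple_zero e (B t w)] <=
  (heat_peak (d := d) (t / 4) * (2 * e) ^+ d *
   (2 `^ (d%:R / 2) * expR (- (l ^+ 2 / (8 * (u - s))))))%:E.
Proof.
move=> s0 su ut ust l0 e0.
have t0 : (0 < t / 4)%R by lra.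
rewrite EFinM; apply: le_trans (lee_wpmul2l _ (increment_tail BM s0 su l0)); last first.
  by rewrite lee_fin mulr_ge0// ?powR_ge0// exprn_ge0// mulr_ge0// ltW.
have [_ B0 _ _] := BM.
(* W is an increment of length at least t / 4 and V makes up the remainder of B t. *)
have key (V W : {mfun Om >-> d.-tuple R}) s' u' (u0 : (0 <= u)%R) :
    independent3 P (inc s0 u0) V W -> (0 <= s')%R -> (t / 4 <= u' - s')%R ->
    (W : Om -> d.-tuple R) = increment B s' u' ->
    (forall w i, tnth (increment B s u w) i + tnth (V w) i + tnth (W w) i = tnth (B t w) i)%R ->
    P [set w | far_tuples l (increment B s u w) /\ tuple_box tuple_zero e (B t w)] <=
    (heat_peak (d := d) (t / 4) * (2 * e) ^+ d)%:E * P (increment B s u @^-1` far_tuples l).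
  move=> ind s'0 tu' WE sumE.
  have := pinned_increment_le (p := heat_peak (d := d) (t / 4)) (e := e) (E := far_tuples l) ind.
  rewrite (_ : [set w | _ /\ forall i, _] =
    [set w | far_tuples l (increment B s u w) /\ tuple_box tuple_zero e (B t w)]).
    apply => //; first exact: powR_ge0; first exact: measurable_far_tuples.
    by move=> C mC; rewrite WE; exact: increment_density_le.
  by apply/seteqP; split => w /= [? h]; split => // i; have := h i; rewrite /= sumE tnth_mktuple subr0.
have u0 : (0 <= u)%R by lra.
have incE a b (a0 : (0 <= a)%R) (b0 : (0 <= b)%R) w i :
  tnth (inc a0 b0 w) i = (tnth (B b w) i - tnth (B a w) i)%R by rewrite /= tnth_mktuple.
have B0E w i : tnth (B 0 w) i = 0%R by rewrite B0 tnth_mktuple.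
have ind a b c x (a0 : (0 <= a)%R) (b0 : (0 <= b)%R) (c0 : (0 <= c)%R) (x0 : (0 <= x)%R) :
    (a < b)%R -> (b < c)%R -> (c < x)%R -> independent3 P (inc a0 b0) (inc b0 c0) (inc c0 x0).
  by move=> ab bc cx A1 A2 A3 m1 m2 m3; exact: (increments3_independent BM).
have tt0 : (0 <= t)%R by lra.
(* Three nondegenerate increments are required. If s = 0 or u = t, the remaining interval, of length
   at least t / 2, is halved. Otherwise W lives on [0, s] if that has length at least t / 4, and on
   [u, t] if not. *)
have [sE|sn0] := eqVneq s 0%R.
  have m0 : (0 <= (u + t) / 2)%R by lra.
  apply: (key (inc u0 m0) (inc m0 tt0) ((u + t) / 2)%R t u0) => //; [apply: ind; lra|lra|].
  by move=> w i; rewrite -[increment B s u w]/(inc s0 u0 w) !incE sE B0E; ring.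
have s_gt0 : (0 < s)%R by rewrite lt_neqAle eq_sym sn0.
have z0 : (0 <= 0 :> R)%R by [].
have [uE|unt] := eqVneq u t.
  have m0 : (0 <= s / 2)%R by lra.
  apply: (key (inc m0 s0) (inc z0 m0) 0%R (s / 2)%R u0) => //; last 2 first.
  - lra.
  - by move=> w i; rewrite -[increment B s u w]/(inc s0 u0 w) !incE uE B0E; ring.
  - by apply/independent3_swap12/independent3_swap23/independent3_swap12/ind; lra.
have ut' : (u < t)%R by rewrite lt_neqAle unt.
have [h|h] := leP (t / 4)%R s.
  apply: (key (inc u0 tt0) (inc z0 s0) 0%R s u0) => //; last 2 first.
  - lra.
  - by move=> w i; rewrite -[increment B s u w]/(inc s0 u0 w) !incE B0E; ring.
  - by apply/independent3_swap23/independent3_swap12/ind; lra.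
apply: (key (inc z0 s0) (inc u0 tt0) u t u0) => //; last 2 first.
- lra.
- by move=> w i; rewrite -[increment B s u w]/(inc s0 u0 w) !incE B0E; ring.
- by apply/independent3_swap12/ind; lra.
Qed.

End pinned_brownian.

Section brownian_excursion.
Context {R : realType} {d : nat} {dO} {Om : measurableType dO}.
Variables (P : probability Om R) (B : R -> Om -> d.-tuple R).
Hypothesis BM : brownian_motion P B.
Variables (t r e : R).
Hypotheses (t0 : 0 < t) (r0 : 0 < r) (e0 : 0 < e).

(** The ratio 7/8 makes the radii sum to 8 r, while their squares divided by the dyadic step still
    grow like (49/32)^n, fast enough to beat the doubling number of increments. *)
Definition chaining_radius n : R := r * (7 / 8) ^+ n.

Let l := chaining_radius.

Let l_ge0 n : 0 <= l n.
Proof. by rewrite /l /chaining_radius mulr_ge0 ?exprn_ge0 ?(ltW r0). Qed.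

Lemma chaining_radius_sum n : \sum_(0 <= m < n) l m <= 8 * r.
Proof.
rewrite /l /chaining_radius -mulr_sumr mulrC ler_wpM2r ?(ltW r0)//.
have h : 0 <= 7 / 8 :> R by lra.
have h1 : 7 / 8 < 1 :> R by lra.
by apply: le_trans (geometric_psum_le h h1 n) _; rewrite -[leRHS]invrK lef_pV2 ?posrE; lra.
Qed.

(** The return to the small box is part of the event, so that its probability carries the factor (2
    e)^d. *)
Definition dyadic_jump n j : set Om :=
  [set w | far_tuples (l n) (increment B (dyadic t n.+1 j) (dyadic t n.+1 j.+1) w) /\
           tuple_box tuple_zero e (B t w)].

Definition large_excursion : set Om :=
  \bigcup_n \big[setU/set0]_(j < 2 ^ n.+1) dyadic_jump n j.

Let dy0 n j : 0 <= dyadic t n j.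
Proof. by rewrite mulr_ge0 ?(ltW t0)// divr_ge0// exprn_ge0. Qed.

Let dyt n j : (j <= 2 ^ n)%N -> dyadic t n j <= t.
Proof.
move=> jn; rewrite /dyadic ger_pMr// ler_pdivrMr ?exprn_gt0// mul1r -natrX ler_nat.
exact: jn.
Qed.

Let dyS n j : dyadic t n j.+1 - dyadic t n j = t / 2 ^+ n.
Proof. by rewrite /dyadic -mulrBr -mulrBl -natrB// subSnn mul1r. Qed.

Lemma small_excursion w : tuple_box tuple_zero e (B t w) -> ~ large_excursion w ->
  forall s, 0 <= s <= t -> forall i, `|tnth (B s w) i| <= e + 8 * r.
Proof.
move=> Bt nG s st i; have [_ B0 cB _] := BM.
rewrite ler_norml; apply: (dyadic_dense t0 (cB w i)) st => n j jn.
rewrite -ler_norml; apply: le_trans (lerD (lexx e) (chaining_radius_sum n)).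
have f0 : tnth (B 0 w) i = 0 by rewrite B0 tnth_mktuple.
have ft : `|tnth (B t w) i| <= e by have := Bt i; rewrite tnth_mktuple subr0.
apply: (dyadic_chaining (f := fun s => tnth (B s w) i) t0 f0 ft l_ge0 _ jn) => {jn}n {}j jn.
rewrite leNgt; apply/negP => lt; apply: nG; exists n => //.
rewrite -bigcup_mkord; exists j => //; split => //.
by exists i; rewrite tnth_mktuple ltW.
Qed.

(* 2048 / 2401 = 2 (32 / 49)^2 is the ratio of the union bounds at consecutive
   dyadic levels, the Gaussian tails being bounded by expRN_le. *)
Definition excursion_constant : R :=
  heat_peak (d := d) (t / 4) * 2 `^ (d%:R / 2) * (128 * t ^+ 2) * (1 - 2048 / 2401)^-1.

(** A quadratic bound is enough: e^u >= (1 + u / 2)^2 >= u^2 / 4. *)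
Lemma expRN_le (u : R) : 0 < u -> expR (- u) <= 4 / u ^+ 2.
Proof.
move=> u0; rewrite expRN -[leRHS]invrK lef_pV2 ?posrE ?expR_gt0 ?invr_gt0 ?divr_gt0 ?exprn_gt0//.
rewrite invf_div.
have h : 1 + u / 2 <= expR (u / 2) by exact: expR_ge1Dx.
have -> : expR u = expR (u / 2) ^+ 2 by rewrite expr2 -expRD -splitr.
apply: le_trans (_ : (1 + u / 2) ^+ 2 <= _); last by rewrite lerXn2r ?nnegrE ?expR_ge0//; lra.
by rewrite -subr_ge0 (_ : _ - _ = 1 + u)//; [lra|field].
Qed.

Local Open Scope ereal_scope.

Lemma measurable_dyadic_jump n j : measurable (dyadic_jump n j).
Proof.
have [mB _ _ _] := BM.
apply: measurableI; rewrite -[X in measurable X]setTI.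
  by apply: (measurable_increment BM (dy0 _ _) (dy0 _ _)) => //; exact: measurable_far_tuples.
by apply: (mB t (ltW t0)) => //; exact: measurable_tuple_box.
Qed.

Lemma measurable_large_excursion : measurable large_excursion.
Proof.
apply: bigcup_measurable => n _; apply: bigsetU_measurable => j _.
exact: measurable_dyadic_jump.
Qed.

Lemma large_excursion_le :
  P large_excursion <= ((2 * e) ^+ d * (excursion_constant / r ^+ 4))%:E.
Proof.
pose rho : R := (2048 / 2401)%R.
have rho0 : (0 <= rho)%R by rewrite /rho; lra.
have rho1 : (rho < 1)%R by rewrite /rho; lra.
pose c := (heat_peak (d := d) (t / 4) * (2 * e) ^+ d * 2 `^ (d%:R / 2) * (128 * t ^+ 2) / r ^+ 4)%R.
have e20 : (0 <= (2 * e) ^+ d)%R by rewrite exprn_ge0// mulr_ge0// ltW.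
have c0 : (0 <= c)%R.
  apply: divr_ge0; last by rewrite exprn_ge0 ?(ltW r0).
  apply: mulr_ge0; last by apply: mulr_ge0; rewrite ?exprn_ge0 ?(ltW t0).
  by apply: mulr_ge0; rewrite ?powR_ge0//; apply: mulr_ge0; rewrite ?powR_ge0.
have mU n : measurable (\big[setU/set0]_(j < 2 ^ n.+1) dyadic_jump n j).
  by apply: bigsetU_measurable => j _; exact: measurable_dyadic_jump.
have level n : P (\big[setU/set0]_(j < 2 ^ n.+1) dyadic_jump n j) <= (c * rho ^+ n)%:E.
  apply: (@le_trans _ _ (\sum_(j < 2 ^ n.+1) P (dyadic_jump n j))).
    by apply: content_subadditive => // j _; exact: measurable_dyadic_jump.
  (* With u = r^2 / (4 t) (49/32)^n the tail is at most 4 / u^2; the 2^(n + 1) increments of the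
     level then give 128 t^2 / r^4 times rho^n. *)
  pose b := (heat_peak (d := d) (t / 4) * (2 * e) ^+ d *
    (2 `^ (d%:R / 2) * (4 / (r ^+ 2 / (4 * t) * (49 / 32) ^+ n) ^+ 2)))%R.
  apply: (@le_trans _ _ (\sum_(j < 2 ^ n.+1) b%:E)).
    apply: lee_sum => j _.
    apply: le_trans (pinned_increment_tail BM (dy0 _ _) _ _ _ (l_ge0 n) e0) _.
    - by rewrite -subr_gt0 dyS divr_gt0// exprn_gt0.
    - exact: dyt.
    - rewrite dyS ler_pM2l// lef_pV2 ?posrE ?exprn_gt0// exprS ler_peMr// exprn_ege1//.
      by rewrite ler1n.
    rewrite lee_fin dyS /b ler_wpM2l ?mulr_ge0 ?powR_ge0// ler_wpM2l ?powR_ge0//.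
    have -> : (l n ^+ 2 / (8 * (t / 2 ^+ n.+1)) = r ^+ 2 / (4 * t) * (49 / 32) ^+ n)%R.
      have -> : ((49 / 32) ^+ n = ((7 / 8) ^+ n) ^+ 2 * 2 ^+ n :> R)%R.
        by rewrite -exprM mulnC exprM -exprMn; congr (_ ^+ n)%R; field.
      rewrite /l /chaining_radius exprMn (exprS 2 n).
      have p0 : (2 ^+ n != 0 :> R)%R by rewrite expf_neq0.
      by field; rewrite p0 gt_eqF.
    apply: expRN_le; rewrite mulr_gt0// ?divr_gt0 ?exprn_gt0// ?mulr_gt0//; lra.
  rewrite sumEFin lee_fin sumr_const card_ord -mulr_natl natrX.
  rewrite le_eqVlt; apply/orP; left; apply/eqP; rewrite /b /c /rho.
  have -> : ((2048 / 2401) ^+ n = 2 ^+ n * ((32 / 49) ^+ n) ^+ 2 :> R)%R.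
    by rewrite -exprM mulnC exprM -exprMn; congr (_ ^+ n)%R; field.
  have -> : ((49 / 32) ^+ n = ((32 / 49) ^+ n)^-1 :> R)%R by rewrite -exprVn invf_div.
  rewrite (exprS 2 n).
  have h : ((32 / 49) ^+ n != 0 :> R)%R by rewrite expf_neq0//; lra.
  by field; rewrite h !gt_eqF.
have := @measure_sigma_subadditive _ _ _ P _ _ mU measurable_large_excursion (@subset_refl _ _).
move=> /le_trans; apply.
apply: lime_le; first by apply: is_cvg_nneseries => n _ _.
apply: nearW => n; apply: (@le_trans _ _ (\sum_(0 <= k < n) (c * rho ^+ k)%:E)).
  by apply: lee_sum => k _; exact: level.
rewrite sumEFin lee_fin -mulr_sumr.
apply: le_trans (ler_wpM2l c0 (geometric_psum_le rho0 rho1 n)) _.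
rewrite /c /excursion_constant -/rho le_eqVlt; apply/orP; left; apply/eqP.
ring.
Qed.

End brownian_excursion.

(** * Paths that stay in the cube *)

Section staying_event.
Context {R : realType} {d : nat} {dO} {Om : measurableType dO}.
Variables (P : probability Om R) (B : R -> Om -> d.-tuple R).
Hypothesis BM : brownian_motion P B.
Variables (N : nat) (t : R).
Hypothesis t0 : 0 < t.

Definition stay_in_cube (x : d.-tuple R) : set Om :=
  [set w | forall s, 0 <= s <= t -> cube N (tuple_add x (B s w))].

(** The cube being closed and paths continuous, the countably many dyadic times decide the event. *)
Lemma measurable_stay_in_cube x : measurable (stay_in_cube x).
Proof.
have [mB _ cB _] := BM.
have dy0 n j : 0 <= dyadic t n j.
  by rewrite mulr_ge0 ?(ltW t0)// divr_ge0// exprn_ge0.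
have dyt n j : (j <= 2 ^ n)%N -> dyadic t n j <= t.
  move=> jn; rewrite /dyadic ger_pMr// ler_pdivrMr ?exprn_gt0// mul1r -natrX ler_nat.
  exact: jn.
pose F n j i := (fun w => tnth x i + tnth (B (dyadic t n j) w) i) @^-1`
  `[- N%:R, N%:R]%classic.
rewrite (_ : stay_in_cube x = \bigcap_n \bigcap_(j in `I_(2 ^ n).+1)
  \bigcap_(i in [set: 'I_d]) F n j i); last first.
  apply/seteqP; split => w /=.
    move=> h n _ j /= jn i _; rewrite /F/= in_itv/=.
    have jt : 0 <= dyadic t n j <= t by rewrite dy0 dyt// -ltnS.
    by have := h _ jt i; rewrite tnth_mktuple.
  move=> h s st i; rewrite tnth_mktuple.
  suff : - N%:R - tnth x i <= tnth (B s w) i <= N%:R - tnth x i.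
    by rewrite lerBlDl lerBrDl.
  apply: (dyadic_dense t0 (cB w i)) st => n j jn; rewrite lerBlDl lerBrDl.
  by have := h n I j _ i I; rewrite /F/= in_itv/=; apply; rewrite /= ltnS.
apply: bigcap_measurable => // n _; apply: bigcap_measurable => //.
  by exists 0%N => /=; rewrite ltnS.
move=> j _; apply: fin_bigcap_measurable => // i _; rewrite /F -[X in measurable X]setTI.
have mF : measurable_fun setT (fun w => tnth x i + tnth (B (dyadic t n j) w) i).
  apply: measurable_funD => //.
  by apply: (measurableT_comp (measurable_tnth i)); exact: mB.
exact: mF.
Qed.

Lemma measurable_brownian_box e : measurable (B t @^-1` tuple_box tuple_zero e).
Proof.
have [mB _ _ _] := BM; rewrite -[X in measurable X]setTI.
by apply: (mB t (ltW t0)) => //; exact: measurable_tuple_box.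
Qed.

Local Open Scope ereal_scope.

Lemma brownian_law A : measurable A -> P (B t @^-1` A) =
  \int[lebesgue_tuple d]_(y in A) (heat_kernel t tuple_zero y)%:E.
Proof.
move=> mA; have [_ B0 _ _] := BM.
rewrite -[in RHS](subr0 t) -(increment_law BM (lexx 0%R) t0 mA).
suff -> : increment B 0 t = B t by [].
apply/funext => w; apply: eq_from_tnth => i.
by rewrite tnth_mktuple B0 tnth_mktuple subr0.
Qed.

(** On the box the squared length is at most d e^2, and e^(- u) >= 1 - u. *)
Lemma brownian_box_ge e : (0 < e)%R ->
  ((2 * e) ^+ d * (heat_peak (d := d) t * (1 - d%:R * e ^+ 2 / (4 * t))))%:E <=
  P (B t @^-1` tuple_box tuple_zero e).
Proof.
move=> e0; rewrite brownian_law; last exact: measurable_tuple_box.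
have mb := measurable_tuple_box (tuple_zero : d.-tuple R) e.
set c := (_ * (1 - _))%R.
have h y : tuple_box tuple_zero e y -> (c <= heat_kernel t (tuple_zero : d.-tuple R) y)%R.
  move=> ye; rewrite /c /heat_kernel -/(heat_peak _) ler_wpM2l ?powR_ge0//.
  apply: le_trans (expR_ge1Dx _); rewrite lerD2l -mulNr ler_pM2r ?invr_gt0 ?mulr_gt0//.
  rewrite lerN2 (_ : d%:R * e ^+ 2 = \sum_(i < d) e ^+ 2)%R; last first.
    by rewrite sumr_const card_ord mulr_natl.
  apply: ler_sum => i _; have := ye i; rewrite tnth_mktuple subr0 sub0r sqrrN => yi.
  by rewrite -real_normK ?num_real// lerXn2r// nnegrE// (le_trans _ yi).
(* For large e the constant is negative and the bound is trivial. *)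
have [c0|c0] := ltP c 0%R.
  apply: (@le_trans _ _ 0); first by rewrite lee_fin mulr_ge0_le0 ?(ltW c0)// exprn_ge0// mulr_ge0// ltW.
  by apply: integral_ge0 => y _; rewrite lee_fin heat_kernel_ge0.
rewrite mulrC EFinM -(lebesgue_tuple_box_volume tuple_zero e0) -integral_cst//.
apply: ge0_le_integral => //.
exact: (measurable_funS _ _ (measurable_heat_kernel t)).
Qed.

Lemma stay_le x e : (0 < e)%R ->
  P (B t @^-1` tuple_box tuple_zero e `&` stay_in_cube x) <=
  (heat_peak (d := d) t * (2 * e) ^+ d)%:E.
Proof.
move=> e0; have mb := measurable_brownian_box e.
apply: (@le_trans _ _ (P (B t @^-1` tuple_box tuple_zero e))).
  by apply: le_measure; rewrite ?inE//; apply: measurableI => //; exact: measurable_stay_in_cube.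
rewrite brownian_law; last exact: measurable_tuple_box.
by rewrite EFinM -(lebesgue_tuple_box_volume tuple_zero e0) heat_law_le_volume//; exact: measurable_tuple_box.
Qed.

(** A path that ends in the box without a large excursion stays within e + 8 r of x, hence in the
    cube; the excursion probability is subtracted. *)
Lemma stay_ge x e r : (0 < r)%R -> (0 < e)%R ->
  (forall i, `|tnth x i| + (e + 8 * r) <= N%:R)%R ->
  ((2 * e) ^+ d * (heat_peak (d := d) t * (1 - d%:R * e ^+ 2 / (4 * t)) -
     excursion_constant (d := d) t / r ^+ 4))%:E <=
  P (B t @^-1` tuple_box tuple_zero e `&` stay_in_cube x).
Proof.
move=> r0 e0 xN; have mb := measurable_brownian_box e.
have mS := measurable_stay_in_cube x.
have mG := measurable_large_excursion BM r e t0.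
rewrite mulrBr EFinB leeBlDr//.
apply: (@le_trans _ _ (P (B t @^-1` tuple_box tuple_zero e))); first exact: brownian_box_ge.
apply: le_trans (leeD2l _ (large_excursion_le BM t0 r0 e0)).
apply: le_trans (measureU2 _ _ _) => //; last exact: measurableI.
apply: le_measure; rewrite ?inE//; first by apply: measurableU => //; exact: measurableI.
move=> w wb; have [G|nG] := pselect (large_excursion B t r e w); [by right|left].
split => // s st i; rewrite tnth_mktuple -ler_norml.
apply: le_trans (ler_normD _ _) _; apply: le_trans (xN i); rewrite lerD2l.
exact: (small_excursion BM t0 r0 wb nG).
Qed.

End staying_event.

(** * The diagonal of the killed density *)

Section killed_density.
Context {R : realType} {d : nat}.
Variables (N : nat) (g : R -> d.-tuple R -> d.-tuple R -> R).
Hypothesis gP : killed_transition_density N g.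
Variables (t : R).
Hypothesis t0 : 0 < t.

Lemma killed_density_continuous x (eps : R) : open_cube N x -> 0 < eps ->
  exists2 eta : R, 0 < eta & forall y, tuple_box x eta y -> `|g t x y - g t x x| <= eps.
Proof.
move: gP => [d0 [Om [P [B [_ /(_ t t0)[_ _ _ cg]]]]]] xN eps0.
pose row (y : d.-tuple R) := (\row_i tnth y i)%R : 'rV[R]_d.
have rowE (y : d.-tuple R) : tuple_of_row (row y) = y.
  by apply: eq_from_tnth => i; rewrite tnth_mktuple mxE.
have uN : open_cube N (tuple_of_row (row x)) by rewrite rowE.
have /cvgrPdist_le/(_ _ eps0) := cg (row x) (row x) uN uN.
move=> /nbhs_ballP[eta /= eta0 ball_eta]; exists (eta / 2); first by rewrite divr_gt0.
move=> y xy; have : ball (row x, row x) eta (row x, row y).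
  split => /=; first exact: ballxx.
  split => // i j; rewrite /ball/= /ball_/= !mxE distrC.
  by apply: le_lt_trans (xy j) _; rewrite ltr_pdivrMr// ltr_pMr// ltr1n.
by move=> /ball_eta /=; rewrite !rowE distrC.
Qed.

Lemma open_cube_margin (x : d.-tuple R) : open_cube N x ->
  exists2 eta : R, 0 < eta & forall i, `|tnth x i| + eta <= N%:R.
Proof.
move=> xN; exists (\big[Num.min/1]_(i < d) (N%:R - `|tnth x i|)).
  by apply: lt_bigmin => // i _; rewrite subr_gt0 ltr_norml; exact: xN.
by move=> i; rewrite addrC -lerBrDr; exact: bigmin_le.
Qed.

Lemma tuple_box_cube (x : d.-tuple R) e : (forall i, `|tnth x i| + e <= N%:R) ->
  tuple_box x e `<=` cube N.
Proof.
move=> xN y xy i; rewrite -ler_norml; apply: le_trans (xN i).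
by rewrite -[tnth y i](subrK (tnth x i)) addrC (le_trans (ler_normD _ _))// lerD2l; exact: xy.
Qed.

Local Open Scope ereal_scope.

Let mass x e := \int[lebesgue_tuple d]_(y in tuple_box x e) (g t x y)%:E.

Lemma killed_mass_le x e : (0 < e)%R -> (forall i, `|tnth x i| + e <= N%:R)%R ->
  mass x e <= (heat_peak (d := d) t * (2 * e) ^+ d)%:E.
Proof.
move: gP => [d0 [Om [P [B [BM /(_ t t0)[_ _ law _]]]]]] e0 xN.
have xc : cube N x.
  by move=> i; rewrite -ler_norml; apply: le_trans (xN i); rewrite lerDl ltW.
rewrite /mass -law//; [|exact: measurable_tuple_box|exact: tuple_box_cube].
apply: le_trans (stay_le BM N t0 x e0); rewrite le_eqVlt; apply/orP; left; apply/eqP.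
congr (P _); apply/seteqP; split => w [h st]; split => // i; have := h i;
  by rewrite /= !tnth_mktuple ?subr0 addrC addKr.
Qed.

Lemma killed_mass_ge x e r : (0 < r)%R -> (0 < e)%R ->
  (forall i, `|tnth x i| + (e + 8 * r) <= N%:R)%R ->
  ((2 * e) ^+ d * (heat_peak (d := d) t * (1 - d%:R * e ^+ 2 / (4 * t)) -
     excursion_constant (d := d) t / r ^+ 4))%:E <= mass x e.
Proof.
move: gP => [d0 [Om [P [B [BM /(_ t t0)[_ _ law _]]]]]] r0 e0 xN.
have xNe i : (`|tnth x i| + e <= N%:R)%R.
  by apply: le_trans (xN i); rewrite lerD2l lerDl mulr_ge0// ltW.
have xc : cube N x.
  by move=> i; rewrite -ler_norml; apply: le_trans (xN i); rewrite lerDl addr_ge0 ?mulr_ge0// ltW.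
rewrite /mass -law//; [|exact: measurable_tuple_box|exact: tuple_box_cube].
apply: le_trans (stay_ge BM t0 r0 e0 xN) _; rewrite le_eqVlt; apply/orP; left; apply/eqP.
congr (P _); apply/seteqP; split => w [h st]; split => // i; have := h i;
  by rewrite /= !tnth_mktuple ?subr0 addrC addKr.
Qed.

(** Continuity at the diagonal turns the mass of a small box into [g t x x] times its volume, up to
    eps; this is how the law of the killed motion reaches the diagonal. *)
Lemma killed_mass_diagonal x (eps : R) : open_cube N x -> (0 < eps)%R ->
  exists2 eta : R, (0 < eta)%R & (forall i, `|tnth x i| + eta <= N%:R)%R /\
    forall e, (0 < e)%R -> (e <= eta)%R ->
    ((g t x x - eps) * (2 * e) ^+ d)%:E <= mass x e <= ((g t x x + eps) * (2 * e) ^+ d)%:E.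
Proof.
move=> xN eps0; have [eta1 eta10 xeta1] := killed_density_continuous xN eps0.
have [eta2 eta20 xeta2] := open_cube_margin xN.
exists (Num.min eta1 eta2); first by rewrite lt_min eta10.
split; first by move=> i; apply: le_trans (xeta2 i); rewrite lerD2l ge_min lexx orbT.
move=> e e0; rewrite le_min => /andP[e1 e2].
move: gP => [d0 [Om [P [B [_ /(_ t t0)[g0 mg _ _]]]]]].
have xc : cube N x by move=> i; have /andP[a b] := xN i; rewrite !ltW.
have be : tuple_box x e `<=` cube N.
  by apply: tuple_box_cube => i; apply: le_trans (xeta2 i); rewrite lerD2l.
have mb := measurable_tuple_box x e.
have ge y : tuple_box x e y -> (g t x x - eps <= g t x y <= g t x x + eps)%R.
  by move=> xy; rewrite -ler_distl; apply: xeta1 => i; exact: le_trans (xy i) e1.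
have mge : measurable_fun (tuple_box x e) (fun y => (g t x y)%:E).
  by apply/measurable_EFinP; apply: (measurable_funS _ be (mg x xc)); exact: measurable_cube.
have g0e y : tuple_box x e y -> 0 <= (g t x y)%:E.
  by move=> xy; rewrite lee_fin g0//; exact: be.
apply/andP; split.
  have [c0|c0] := ltP (g t x x - eps)%R 0%R.
    apply: (@le_trans _ _ 0); last exact: integral_ge0.
    by rewrite lee_fin mulr_le0_ge0 ?(ltW c0)// exprn_ge0// mulr_ge0// ltW.
  rewrite EFinM -(lebesgue_tuple_box_volume x e0) -integral_cst//.
  by apply: ge0_le_integral => // y xy; rewrite lee_fin; have /andP[] := ge y xy.
rewrite EFinM -(lebesgue_tuple_box_volume x e0) -integral_cst//.
by apply: ge0_le_integral => // y xy; rewrite lee_fin; have /andP[] := ge y xy.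
Qed.

Local Close Scope ereal_scope.

Lemma killed_diagonal_le x : open_cube N x -> g t x x <= heat_peak (d := d) t.
Proof.
move=> xN; apply/ler_addgt0Pr => eps eps0.
have [eta eta0 [xeta /(_ _ eta0 (lexx _))/andP[lo _]]] := killed_mass_diagonal xN eps0.
have := le_trans lo (killed_mass_le eta0 xeta); rewrite lee_fin ler_pM2r ?lerBlDr//.
by rewrite exprn_gt0// mulr_gt0.
Qed.

End killed_density.

Lemma excursion_constant_ge0 {R : realType} (d : nat) (t : R) : 0 <= excursion_constant (d := d) t.
Proof.
apply: mulr_ge0; last by rewrite invr_ge0; lra.
apply: mulr_ge0; last by apply: mulr_ge0; rewrite ?sqr_ge0.
by apply: mulr_ge0; exact: powR_ge0.
Qed.

(** The point is uniformity: rho depends on d, t and eps alone. The radius r is fixed first to make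
    the excursion term small; then e may shrink depending on x and g, because (2 e)^d cancels. *)
Lemma killed_diagonal_ge {R : realType} (d : nat) (t eps : R) : 0 < t -> 0 < eps ->
  exists2 rho : R, 0 < rho &
  forall N (g : R -> d.-tuple R -> d.-tuple R -> R), killed_transition_density N g ->
  forall x : d.-tuple R, (forall i, `|tnth x i| + rho <= N%:R) ->
  heat_peak (d := d) t - eps <= g t x x.
Proof.
move=> t0 eps0.
have [K KE K0] : exists2 K : R, K = excursion_constant (d := d) t & 0 <= K.
  by exists (excursion_constant (d := d) t) => //; exact: excursion_constant_ge0.
have [p pE p0] : exists2 p : R, p = heat_peak (d := d) t & 0 < p.
  by exists (heat_peak (d := d) t) => //; exact: heat_peak_gt0.
(* With this r, (eps / 4) r = eps / 4 + K >= K, and r >= 1 gives r <= r^4. *)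
have [r rE] : exists r, r = 1 + 4 * K / eps by exists (1 + 4 * K / eps).
have r1 : 1 <= r by rewrite rE lerDl divr_ge0 ?mulr_ge0// ltW.
have r0 : 0 < r by exact: lt_le_trans r1.
have Kr : K / r ^+ 4 <= eps / 4.
  rewrite ler_pdivrMr ?exprn_gt0//; apply: (@le_trans _ _ (eps / 4 * r)).
    rewrite rE (_ : _ * _ = eps / 4 + K); last by field; rewrite gt_eqF.
    by rewrite lerDr divr_ge0// ltW.
  by rewrite ler_pM2l ?divr_gt0// ler_eXnr.
exists (1 + 8 * r); first by rewrite addr_gt0// mulr_gt0.
move=> N g gP x xN.
have xo : open_cube N x.
  move=> i; rewrite -ltr_norml; apply: lt_le_trans (xN i).
  by rewrite ltrDl addr_gt0// mulr_gt0.
have eps4 : 0 < eps / 4 by rewrite divr_gt0.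
(* Three losses of eps / 4 are allowed: the excursions, the continuity of g, and the Gaussian factor
   on the box. *)
have [eta eta0 [xeta mass_eta]] := killed_mass_diagonal gP t0 xo eps4.
have d1 : 0 < d%:R + 1 :> R by rewrite ltr_wpDl.
(* Together e <= 1 and e <= q give e^2 <= q, so that the Gaussian loss p d e^2 / (4 t) is at most
   eps / 4. *)
have [q qE] : exists q, q = eps / 4 * (4 * t) / (p * (d%:R + 1)).
  by exists (eps / 4 * (4 * t) / (p * (d%:R + 1))).
have q0 : 0 < q by rewrite qE divr_gt0 ?mulr_gt0// divr_gt0.
have [e [e0 e_eta e1 eq]] : exists e : R, [/\ 0 < e, e <= eta, e <= 1 & e <= q].
  exists (Num.min eta (Num.min 1 q)).
  by rewrite !lt_min eta0 q0 ltr01 !ge_min !lexx !orbT.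
have /andP[_ hi] := mass_eta e e0 e_eta.
have xNe i : `|tnth x i| + (e + 8 * r) <= N%:R by apply: le_trans (xN i); rewrite lerD2l lerD2r.
have := le_trans (killed_mass_ge gP t0 r0 e0 xNe) hi.
rewrite lee_fin mulrC ler_pM2r ?exprn_gt0 ?mulr_gt0// -pE -KE.
suff h : p * (d%:R * e ^+ 2 / (4 * t)) <= eps / 4 by rewrite mulrBr mulr1; lra.
have ee : e ^+ 2 <= q.
  by apply: le_trans eq; rewrite ler_iXnr// ltW.
have dd : d%:R * e ^+ 2 <= (d%:R + 1) * q.
  by apply: ler_pM; rewrite ?sqr_ge0// lerDl.
have -> : eps / 4 = p * ((d%:R + 1) * q / (4 * t)).
  by rewrite qE; field; rewrite !gt_eqF.
by rewrite ler_pM2l// ler_pM2r// invr_gt0 mulr_gt0.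
Qed.

(* The diagonal of the killed density is not known to be measurable. *)
Section unmeasurable_integrand.
Context {d} {T : measurableType d} {R : realType} (mu : {measure set T -> \bar R}).
Local Open Scope ereal_scope.
Implicit Types (D N : set T) (f : T -> \bar R).

(** The integral of a nonnegative function is a supremum over simple functions below it, hence
    monotone by inclusion. *)
Lemma ge0_integral_mono D f1 f2 : (forall x, D x -> 0 <= f1 x) ->
  (forall x, D x -> f1 x <= f2 x) -> \int[mu]_(x in D) f1 x <= \int[mu]_(x in D) f2 x.
Proof.
move=> f10 f12; rewrite !ge0_integralE//; last first.
  by move=> x Dx; apply: le_trans (f10 x Dx) (f12 x Dx).
apply: le_ereal_sup => _ [h /= hf <-]; exists h => // x.
by apply: le_trans (hf x) _; exact: lee_restrict.
Qed.

Lemma ge0_integral_le_cst D N f (c : R) : measurable D -> measurable N -> mu N = 0 ->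
  (0 <= c)%R -> (forall x, D x -> 0 <= f x) -> (forall x, D x -> ~ N x -> f x <= c%:E) ->
  \int[mu]_(x in D) f x <= c%:E * mu D.
Proof.
(* U is a measurable majorant: c off N and +oo on the null set N. *)
move=> mD mN N0 c0 f0 fc; pose U x := c%:E + (\1_N x)%:E * +oo : \bar R.
have U0 x : 0 <= U x by rewrite /U adde_ge0// mule_ge0.
have UN x : ~ N x -> U x = c%:E by move=> nN; rewrite /U indicE memNset// mul0e adde0.
apply: (@le_trans _ _ (\int[mu]_(x in D) U x)).
  apply: ge0_integral_mono => // x Dx; have [Nx|nN] := pselect (N x).
    by rewrite /U indicE mem_set// mul1e addey// leey.
  by rewrite UN//; exact: fc.
rewrite (ge0_negligible_integral mN)//; last first.
  apply: emeasurable_funD; first exact: measurable_cst.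
  apply: emeasurable_funM; last exact: measurable_cst.
  by apply/measurable_EFinP; exact: measurable_indic.
rewrite (eq_integral (cst c%:E)); last by move=> x; rewrite inE => -[_ /UN].
rewrite integral_cst; last exact: measurableD.
by rewrite lee_wpmul2l// le_measure ?inE//; exact: measurableD.
Qed.

Lemma ge0_integral_ge_cst D E f (c : R) : measurable D -> measurable E -> E `<=` D ->
  (0 <= c)%R -> (forall x, D x -> 0 <= f x) -> (forall x, E x -> c%:E <= f x) ->
  c%:E * mu E <= \int[mu]_(x in D) f x.
Proof.
move=> mD mE ED c0 f0 fc; apply: (@le_trans _ _ (\int[mu]_(x in D) (c%:E * (\1_E x)%:E))).
  rewrite ge0_integralZl//; last by apply/measurable_EFinP; exact: measurable_indic.
  by rewrite integral_indic// setIidl.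
apply: ge0_integral_mono => x Dx; first by rewrite mule_ge0.
have [Ex|nE] := pselect (E x); rewrite indicE; first by rewrite mem_set// mule1 fc.
by rewrite memNset// mule0 f0.
Qed.

End unmeasurable_integrand.

(** * Dirichlet weights *)

Section dirichlet_weights.
Context {R : realType}.
Variables (d : nat) (beta : R).
Hypotheses (beta0 : 0 < beta).
Let q := free_weight d beta (0 : R).

Lemma open_cubeE N : @open_cube R d N =
  [set x | forall i : 'I_d, `]- N%:R, N%:R[%classic (tnth x i)].
Proof. by apply/seteqP; split => x h i; have := h i; rewrite /= in_itv. Qed.

Lemma measurable_open_cube N : measurable (@open_cube R d N).
Proof.
rewrite open_cubeE (_ : [set x | _] = \bigcap_(i in [set: 'I_d])
    ((fun x : d.-tuple R => tnth x i) @^-1` `]- N%:R, N%:R[%classic)); last first.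
  by apply/seteqP; split => x h i; [move=> _; exact: h|exact: (h i I)].
apply: fin_bigcap_measurable => // i _; rewrite -[X in measurable X]setTI.
by apply: (measurable_tnth i).
Qed.

Lemma lebesgue_open_cube N : lebesgue_tuple d (@open_cube R d N) = (cube_volume R d N)%:E.
Proof.
rewrite open_cubeE (lebesgue_tuple_box (A := fun=> `]- N%:R, N%:R[%classic))//.
rewrite -lebesgue_cube cubeE (lebesgue_tuple_box (A := fun=> `[- N%:R, N%:R]%classic))//.
by apply: eq_bigr => i _; rewrite !lebesgue_measure_itv.
Qed.

Lemma lebesgue_cube_boundary N :
  lebesgue_tuple d (cube N `\` @open_cube R d N) = 0%E.
Proof.
have mC := @measurable_cube R d N; have mO := measurable_open_cube N.
have hC : (lebesgue_tuple d (@cube R d N) < +oo)%E by rewrite lebesgue_cube ltry.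
rewrite (@measureD _ _ _ (lebesgue_tuple d) _ _ mC mO hC).
rewrite setIidr; last by move=> x h i; have /andP[a b] := h i; rewrite !ltW.
by rewrite [X in (X - _)%E]lebesgue_cube [X in (_ - X)%E]lebesgue_open_cube -EFinB subrr.
Qed.

Section one_cube.
Variables (N : nat) (g : R -> d.-tuple R -> d.-tuple R -> R).
Hypothesis gP : killed_transition_density N g.
Hypothesis N0 : (0 < N)%N.
Variable t : R.
Hypothesis t0 : 0 < t.

Let I := (\int[lebesgue_tuple d]_(x in cube N) (g t x x)%:E)%E.

Let g0 x : cube N x -> (0 <= (g t x x)%:E)%E.
Proof.
move: gP => [d0 [Om [P [B [_ /(_ t t0)[h _ _ _]]]]]] xN.
by rewrite lee_fin; exact: h.
Qed.

(** The diagonal is controlled in the open cube, where g is continuous; the boundary is a null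
    set. *)
Lemma killed_trace_le : (0 <= I <= (heat_peak (d := d) t * cube_volume R d N)%:E)%E.
Proof.
apply/andP; split; first exact: integral_ge0.
rewrite EFinM -lebesgue_cube; apply: (@ge0_integral_le_cst _ _ _ (lebesgue_tuple d) (cube N) (cube N `\` open_cube N)).
- exact: measurable_cube.
- by apply: measurableD; [exact: measurable_cube|exact: measurable_open_cube].
- exact: lebesgue_cube_boundary.
- exact: powR_ge0.
- exact: g0.
- move=> x xN nN; rewrite lee_fin; apply: (killed_diagonal_le gP t0).
  by apply: contrapT => nO; apply: nN.
Qed.

Lemma killed_trace_ge (c rho : R) : 0 <= c -> 0 <= rho -> rho < N%:R ->
  (forall x : d.-tuple R, (forall i, `|tnth x i| + rho <= N%:R) -> c <= g t x x) ->
  ((c * (2 * (N%:R - rho)) ^+ d)%:E <= I)%E.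
Proof.
move=> c0 rho0 rhoN gc; have r0 : 0 < N%:R - rho by rewrite subr_gt0.
rewrite EFinM -(lebesgue_tuple_box_volume tuple_zero r0).
have bN (x : d.-tuple R) : tuple_box tuple_zero (N%:R - rho) x -> forall i, `|tnth x i| + rho <= N%:R.
  by move=> xb i; rewrite -lerBrDr; have := xb i; rewrite tnth_mktuple subr0.
apply: (@ge0_integral_ge_cst _ _ _ (lebesgue_tuple d)) => //.
- exact: measurable_cube.
- exact: measurable_tuple_box.
- by move=> x /bN xb i; rewrite -ler_norml; apply: le_trans (xb i); rewrite lerDl.
- by move=> x /bN xb; rewrite lee_fin; exact: gc.
Qed.

End one_cube.

Lemma killed_weightE N k (g : R -> d.-tuple R -> d.-tuple R -> R) : (k < N)%N ->
  cycle_weight beta 0 g BCdir N k =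
  fine (\int[lebesgue_tuple d]_(x in cube N) (g (k.+1%:R * beta) x x)%:E) /
  (k.+1%:R * cube_volume R d N).
Proof. by move=> kN; rewrite /cycle_weight kN mulr0 mul0r expR0 div1r mulrC. Qed.

Lemma killed_weight_bounds N k (g : R -> d.-tuple R -> d.-tuple R -> R) :
  killed_transition_density N g -> 0 <= cycle_weight beta 0 g BCdir N k <= q k.
Proof.
move=> gP; have [kN|kN] := ltnP k N; last first.
  by rewrite /cycle_weight ltnNge kN/= lexx ltW// free_weight_gt0.
have N0 : (0 < N)%N by exact: leq_ltn_trans kN.
have t0 : 0 < k.+1%:R * beta by rewrite mulr_gt0.
rewrite killed_weightE//; have V0 := cube_volume_gt0 (R := R) d N0.
have /andP[] := killed_trace_le gP t0; case: (integral _ _ _) => [c| |]//=.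
rewrite !lee_fin => c0 c1; rewrite divr_ge0 ?mulr_ge0 ?(ltW V0)//=.
rewrite ler_pdivrMr ?mulr_gt0// /q -free_weight_heat_peak// mulrA divfK//.
Qed.

(** The weight never exceeds q k. From below, points at distance at least rho from the boundary fill
    the fraction (1 - rho / N)^d of the cube, and there the diagonal is nearly the heat peak. *)
Lemma killed_weight_cvg k (g : nat -> R -> d.-tuple R -> d.-tuple R -> R) :
  (forall N, (0 < N)%N -> killed_transition_density N (g N)) ->
  (fun N => cycle_weight beta 0 (g N) BCdir N k) @ \oo --> q k.
Proof.
move=> gP; have t0 : 0 < k.+1%:R * beta by rewrite mulr_gt0.
have p0 := heat_peak_gt0 (d := d) t0; have q0 : 0 < q k by exact: free_weight_gt0.
apply/cvgrPdist_le => eps eps0.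
(* The weight divides the diagonal by k + 1, so a loss (k + 1) del there is a loss del here;
   [del <= q k] keeps the lower constant nonnegative. *)
have [del [del0 delq deleps]] : exists del : R, [/\ 0 < del, del <= q k & del <= eps / 2].
  exists (Num.min (q k) (eps / 2)).
  by rewrite lt_min q0 divr_gt0// !ge_min !lexx orbT.
have kd0 : 0 < k.+1%:R * del by rewrite mulr_gt0.
have [rho rho0 rhoP] := killed_diagonal_ge d t0 kd0.
have s1 : (fun N => 1 - rho / N%:R) @ \oo --> (1 : R).
  rewrite -[X in _ --> X]subr0; apply: cvgB; first exact: cvg_cst.
  apply/cvgrPdist_lt => e e0; near=> N; rewrite sub0r normrN ger0_norm; last first.
    by rewrite divr_ge0// ltW.
  rewrite ltr_pdivrMr; last by rewrite ltr0n; near: N; exists 1%N.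
  by rewrite mulrC -ltr_pdivrMr//; near: N; exact: nbhs_infty_gtr.
have sX n : (fun N => (1 - rho / N%:R) ^+ n) @ \oo --> (1 : R).
  elim: n => [|n IH]; first by under eq_fun do rewrite expr0; exact: cvg_cst.
  by rewrite -[X in _ --> X](mulr1 1); under eq_fun do rewrite exprS; exact: cvgM.
have sh : (fun N => (q k - del) * (1 - rho / N%:R) ^+ d) @ \oo --> q k - del.
  by rewrite -[X in _ --> X]mulr1; apply: cvgM; [exact: cvg_cst|exact: sX].
have : \forall N \near \oo, q k - eps < (q k - del) * (1 - rho / N%:R) ^+ d.
  by apply: (cvgr_gt _ sh); lra.
move=> lower; near=> N.
have kN : (k < N)%N by near: N; exists k.+1.
have N0 : (0 < N)%N by exact: leq_ltn_trans kN.
have rhoN : rho < N%:R.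
  by near: N; exact: nbhs_infty_gtr.
have NR0 : 0 < N%:R :> R by rewrite ltr0n.
have /andP[r0 r1] := killed_weight_bounds k (gP N N0).
rewrite ger0_norm ?subr_ge0//.
rewrite lerBlDl -lerBlDr; apply: (@le_trans _ _ ((q k - del) * (1 - rho / N%:R) ^+ d)).
  by apply: ltW; near: N; exact: lower.
have qd0 : 0 <= q k - del by rewrite subr_ge0.
have hE : heat_peak (d := d) (k.+1%:R * beta) = k.+1%:R * q k.
  by rewrite /q -free_weight_heat_peak// [RHS]mulrC divfK.
have c0 : 0 <= heat_peak (d := d) (k.+1%:R * beta) - k.+1%:R * del.
  by rewrite hE -mulrBr mulr_ge0.
have := killed_trace_ge (gP N N0) t0 c0 (ltW rho0) rhoN (rhoP N (g N) (gP N N0)).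
have /andP[] := killed_trace_le (gP N N0) t0.
rewrite killed_weightE//; case: (integral _ _ _) => [c| |]//=.
rewrite !lee_fin => _ _ lo; rewrite ler_pdivlMr; last by rewrite mulr_gt0// cube_volume_gt0.
apply: le_trans lo; rewrite le_eqVlt; apply/orP; left; apply/eqP.
have -> : 2 * (N%:R - rho) = 2 * N%:R * (1 - rho / N%:R) by field; rewrite gt_eqF.
by rewrite hE [in RHS]exprMn -/(cube_volume R d N); ring.
Unshelve. all: by end_near.
Qed.

End dirichlet_weights.

(** * The three boundary conditions together *)

Lemma cycle_weight_tilt (R : realType) (d : nat) (beta alpha : R)
    (g : R -> d.-tuple R -> d.-tuple R -> R) bc N k :
  cycle_weight beta alpha g bc N k =
  expR (beta * alpha * k.+1%:R) * cycle_weight beta 0 g bc N k.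
Proof.
case: bc => /=.
- by rewrite /free_weight mulr0 mul0r expR0 div1r.
- by case: ifP => _; rewrite ?mulr0// mul0r expR0 div1r !mulrA.
- by case: ifP => _; rewrite ?mulr0// mul0r expR0 div1r !mulrA.
Qed.

(** These four properties are the interface between a boundary condition and the large deviation
    argument. The constant C differs from 1 only in the periodic case, where the images of the point
    raise the weights. *)
Lemma cycle_weight_cvg (R : realType) (d : nat) (beta : R) bc
    (g : nat -> R -> d.-tuple R -> d.-tuple R -> R) :
  0 < beta ->
  (bc = BCdir -> forall N, (0 < N)%N -> killed_transition_density N (g N)) ->
  let r N k := cycle_weight beta 0 (g N) bc N k in
  exists C : R^nat, [/\ forall N k, 0 <= r N k,
    forall N k, (0 < N)%N -> r N k <= C N * free_weight d beta 0 k,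
    C @ \oo --> (1 : R) &
    forall k, r ^~ k @ \oo --> free_weight d beta 0 k].
Proof.
move=> beta0 gP r.
have q0 k : 0 < free_weight d beta 0 k by exact: free_weight_gt0.
case: bc gP @r => [_|_|/(_ erefl) gP] r.
- exists (cst 1); split.
  + by move=> N k; rewrite ltW ?q0.
  + by move=> N k _; rewrite mul1r.
  + exact: cvg_cst.
  + by move=> k; exact: cvg_cst.
- have late N k : (N <= k)%N -> r N k = 0 by rewrite /r /cycle_weight ltnNge => ->.
  exists (periodic_constant d beta); split.
  + move=> N k; have [kN|/late->//] := ltnP k N.
    by have /andP[h _] := periodic_weight_bounds (d := d) beta0 (g N) kN; exact: le_trans (ltW (q0 k)) h.
  + move=> N k N0; have [kN|/late->] := ltnP k N.
      by have /andP[] := periodic_weight_bounds (d := d) beta0 (g N) kN.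
    rewrite mulr_ge0 ?(ltW (q0 k))//.
    apply: exprn_ge0; apply: divr_ge0; first by rewrite addr_ge0// expR_ge0.
    by rewrite subr_ge0 (ltW (periodic_rho_lt1 beta0 N0)).
  + exact: periodic_constant_cvg.
  + move=> k; apply: (@squeeze_cvgr _ _ _ _ (fun=> free_weight d beta 0 k)
      (fun N => periodic_constant d beta N * free_weight d beta 0 k)).
    * by exists k.+1 => // N kN; exact: periodic_weight_bounds.
    * exact: cvg_cst.
    * rewrite -[X in _ --> X]mul1r; apply: cvgM; last exact: cvg_cst.
      exact: periodic_constant_cvg.
- exists (cst 1); split.
  (* At N = 0 no kernel is specified, but the cutoff makes every weight 0. *)
  + case=> [|N] k; first by rewrite /r.
    by have /andP[] := killed_weight_bounds beta0 k (gP N.+1 isT).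
  + by move=> N k N0; rewrite mul1r; have /andP[] := killed_weight_bounds beta0 k (gP N N0).
  + exact: cvg_cst.
  + by move=> k; exact: killed_weight_cvg.
Qed.

Unset Implicit Arguments.
Theorem theorem1p4 (R : realType) (d : nat) (beta a alpha mu : R)
    (bc : boundary_condition)
    (gDir : nat -> R -> d.-tuple R -> d.-tuple R -> R)
    (dO : nat -> measure_display) (Om : forall N : nat, measurableType (dO N))
    (P : forall N : nat, probability (Om N) R)
    (X : forall N : nat, nat -> Om N -> nat) :
  (0 < d)%N -> 0 < beta -> 0 < a -> alpha <= 0 ->
  (bc = BCdir -> forall N : nat, (0 < N)%N ->
     killed_transition_density N (gDir N)) ->
  (forall N : nat, (0 < N)%N ->
     independent_poisson (P N)
       (fun k => cube_volume R d N * cycle_weight beta alpha (gDir N) bc N k)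
       (X N)) ->
  (forall (m : R) (x : ell1 R), ell1_nonneg x ->
     pmf_hamiltonian_lsc a m x =
       (pmf_hamiltonian a m x -
        ((2 * a)^-1)%:E * maxe (m%:E - a%:E * particle_density x) 0 ^+ 2)%E /\
     pmf_hamiltonian_lsc a m x =
       (if ((m / a)%:E <= particle_density x)%E then pmf_hamiltonian a m x
        else (- (m ^+ 2 / (2 * a)))%:E)) /\
  large_deviation_principle (cube_volume R d)
    (fun N => pmf_measure a mu beta (cube_volume R d N)
                (counts_law (P N) (cube_volume R d N) (X N)))
    (pmf_rate d a beta (mu + alpha)).
Proof.
move=> d0 beta0 a0 alpha0 gP PX; split; first by move=> m x; exact: pmf_hamiltonian_lscE.
have [C [r0 rC C1 rq]] := cycle_weight_cvg beta0 gP.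
apply: (pmf_large_deviation_principle mu d0 beta0 a0 alpha0 r0 _ rC C1 rq PX).
by move=> N k; exact: cycle_weight_tilt.
Qed.
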